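(* Let $(\zeta_k)_{k\ge1}$ be the mean-zero Gaussian sequence with covariances $$\operatorname{Cov}(\zeta_r,\zeta_s)=\frac{1}{4\pi^2}\oint_{\Gamma_0}\oint_{\Gamma_{0,w}}\frac{w}{z-w}\,\frac{r!\,s!}{z^{r}w^{s}}\,e^{z+w}\left(1-\frac{z}{r}\right)\left(1-\frac{w}{s}\right)\frac{dz}{z}\frac{dw}{w}\qquad (r\ge s\ge1),$$ where the $w$-contour $\Gamma_0$ encloses $0$ and is enclosed by the $z$-contour $\Gamma_{0,w}$ (both positively oriented). Let $(Y_T)_{T\ge0}$ be the process with $Y_0=0$, $Y_n=\zeta_n$ for $n\in\mathbb{Z}_{\ge1}$, and $Y$ linearly interpolated between consecutive integers. Then the process $$R^{(T)}_s:=T^{1/4}\,Y_{T+s\sqrt T}$$ converges in finite-dimensional distributions as $T\to\infty$ to the unique mean-zero stationary Gaussian process $(R_s)_{s\in\mathbb{R}}$ with covariances $$\operatorname{Cov}(R_a,R_b)=\int_0^\infty y^2e^{-y^2-|b-a|y}\,dy,\qquad a,b\in\mathbb{R}.$$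
   Context: The sequence $(\zeta_k)_{k\ge1}$ is the fixed-time marginal $(Z^{(k)}_0)_{k\ge1}$ of the unique stationary solution of the SDE system $dZ^{(k)}_T=\left((k-1)Z^{(k-1)}_T-kZ^{(k)}_T\right)dT+dW^{(k)}_T$, $k=1,2,\ldots$, with $W^{(k)}$ independent standard Brownian motions (for $k=1$ the term $(k-1)Z^{(k-1)}_T$ is $0$). Linear interpolation means $Y_{n+\alpha}=(1-\alpha)Y_n+\alpha Y_{n+1}$ for integers $n\ge0$ and $\alpha\in(0,1)$. For fixed $s\in\mathbb{R}$, $R^{(T)}_s$ is defined as soon as $T+s\sqrt T\ge0$, hence for all large $T$; convergence in finite-dimensional distributions means that for all $s_1,\ldots,s_m\in\mathbb{R}$ the vector $(R^{(T)}_{s_1},\ldots,R^{(T)}_{s_m})$ converges in distribution to $(R_{s_1},\ldots,R_{s_m})$. *)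

(* Defs.v *)
From HB Require Import structures.
From mathcomp Require Import all_boot all_order all_algebra.
From mathcomp Require Import complex.
From mathcomp Require Import all_classical all_reals all_analysis.

Set Implicit Arguments.
Unset Strict Implicit.
Unset Printing Implicit Defensive.

Import Order.TTheory GRing.Theory Num.Theory.
Import numFieldNormedType.Exports.

Local Open Scope classical_set_scope.
Local Open Scope ring_scope.

Section ContourIntegrals.
Context {R : realType}.

Definition cexp (z : R[i]) : R[i] :=
  Complex (expR (complex.Re z) * cos (complex.Im z))
          (expR (complex.Re z) * sin (complex.Im z)).

Definition cintegral (a b : R) (f : R -> R[i]) : R[i] :=
  Complex (\int[lebesgue_measure]_(t in `[a, b]) complex.Re (f t))%R
          (\int[lebesgue_measure]_(t in `[a, b]) complex.Im (f t))%R.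

Definition circle (rho t : R) : R[i] := Complex (rho * cos t) (rho * sin t).

(* derivative of circle rho at t *)
Definition circle' (rho t : R) : R[i] :=
  Complex (- (rho * sin t)) (rho * cos t).

(* integral of f over the positively oriented circle |z| = rho *)
Definition oint (rho : R) (f : R[i] -> R[i]) : R[i] :=
  cintegral 0 (2 * pi) (fun t => f (circle rho t) * circle' rho t).

(* The w-contour is |w| = rho_w and the z-contour is |z| = rho_z; the nesting
   of the contours is the condition 0 < rho_w < rho_z. *)
Definition zeta_cov (rho_w rho_z : R) (r s : nat) : R[i] :=
  (4 * pi%:C%C ^+ 2)^-1 *
  oint rho_w (fun w => oint rho_z (fun z =>
    w / (z - w) * ((r`!)%:R * (s`!)%:R / (z ^+ r * w ^+ s)) * cexp (z + w)
    * (1 - z / r%:R) * (1 - w / s%:R) / z / w)).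

End ContourIntegrals.

Section Processes.
Context {R : realType}.

(* normal_prob m 0 is not a point mass but the uniform law on [0, 1], hence
   the case distinction. *)
Definition normal_law (m s : R) (A : set R) : \bar R :=
  if s == 0 then \d_m A else normal_prob m s A.

Definition gaussian_process {d} {T : measurableType d} (P : probability T R)
    (I : Type) (X : I -> {RV P >-> R}) : Prop :=
  forall (n : nat) (t : 'I_n -> I) (a : 'I_n -> R), exists m s : R,
    forall A : set R, measurable A ->
      pushforward P (fun x => \sum_(i < n) a i * X (t i) x) A
      = normal_law m s A.

Definition mean_zero {d} {T : measurableType d} (P : probability T R)
    (I : Type) (X : I -> {RV P >-> R}) : Prop :=
  forall t : I, ('E_P[X t] = 0)%E.

Definition same_fdd {d d'} {T : measurableType d} {T' : measurableType d'}
    (P : probability T R) (P' : probability T' R) (I : Type)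
    (X : I -> {RV P >-> R}) (X' : I -> {RV P' >-> R}) : Prop :=
  forall (n : nat) (t : 'I_n -> I) (A : set (n.-tuple R)), measurable A ->
    pushforward P (fun x => [tuple X (t i) x | i < n]) A =
    pushforward P' (fun x => [tuple X' (t i) x | i < n]) A.

Definition stationary {d} {T : measurableType d} (P : probability T R)
    (X : R -> {RV P >-> R}) : Prop :=
  forall h : R, same_fdd (fun t => X (t + h)) X.

Definition limit_process {d} {T : measurableType d} (P : probability T R)
    (X : R -> {RV P >-> R}) : Prop :=
  [/\ gaussian_process X, mean_zero X, stationary X &
    forall a b : R, covariance P (X a) (X b) =
      (\int[lebesgue_measure]_(y in `[0%R, +oo[)
         (y ^+ 2 * expR (- y ^+ 2 - `|b - a| * y))%:E)%E].

(* For a real parameter T -> +oo and a family X T of real processes: weak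
   convergence of all finite-dimensional marginals, tested against bounded
   continuous functions. *)
Definition cvg_fdd {d d'} {W : measurableType d} {W' : measurableType d'}
    (P : probability W R) (P' : probability W' R) (I : Type)
    (X : R -> I -> W -> R) (Z : I -> W' -> R) : Prop :=
  forall (n : nat) (t : 'I_n -> I) (f : 'rV[R]_n -> R),
    continuous f -> (exists M : R, forall x, `|f x| <= M) ->
    'E_P[(fun w => f (\row_i X T (t i) w))]%E @[T --> +oo] -->
    'E_P'[(fun w => f (\row_i Z (t i) w))]%E.

(* Intended for t >= 0; for t < 0, where truncn t = 0, the first segment is
   extrapolated. *)
Definition lin_interp (y : nat -> R) (t : R) : R :=
  let n := Num.truncn t in
  let alpha := t - n%:R in
  (1 - alpha) * y n + alpha * y n.+1.

Definition Yproc (W : Type) (zeta : nat -> W -> R) (t : R) (x : W) : R :=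
  lin_interp (fun n => if n == 0%N then 0 else zeta n x) t.

Definition Rproc (W : Type) (zeta : nat -> W -> R) (T s : R) (x : W) : R :=
  T `^ (4^-1) * Yproc zeta (T + s * Num.sqrt T) x.

End Processes.

(* Main.v *)
Require Import Defs.
From HB Require Import structures.
From mathcomp Require Import all_boot all_order all_algebra.
From mathcomp Require Import complex.
From mathcomp Require Import all_classical all_reals all_analysis.
From mathcomp Require Import measurable_realfun zify ring lra.

(** The contour integral defining the covariance collapses, by residues, to a finite
sum.  Setting [i = r - 1], [j = s - 1], this kernel solves the Lyapunov equation
[(i + j + 2) K(i,j) = i K(i-1,j) + j K(i,j-1) + delta_ij] of the linear SDE, and a
null vector paired with that equation vanishes; so the kernel is positive definite and
Gram-Schmidt turns [zeta] into an i.i.d. standard normal sequence on the given space.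

For [r, s = T + O(sqrt T)], [sqrt T Cov (zeta_r, zeta_s)] is a Riemann sum of mesh
[1 / sqrt T] which converges, by dominated convergence, to
[C(a - b) = int_0^oo y^2 e^(- y^2 - |a - b| y) dy].  Hence [C] is positive semidefinite.
Being Lipschitz, it yields the limit process: realize it at rational times by linear
combinations of the i.i.d. sequence (Cholesky), then pass to a.s. limits.

For weak convergence, the Gaussian vectors [R^(T)] have the law of [A_T xi], where [A_T] is
the Cholesky factor of their covariance matrix and [xi] is i.i.d. normal.  The [A_T]
stay bounded, and along any convergent subsequence [A_T xi] converges pointwise to
[A xi], whose covariance matrix is that of the limit process. *)

Set Implicit Arguments.
Unset Strict Implicit.
Unset Printing Implicit Defensive.

Import Order.TTheory GRing.Theory Num.Theory.
Import numFieldNormedType.Exports.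

Local Open Scope classical_set_scope.
Local Open Scope ring_scope.

(** Everything happens on the one probability space that carries [zeta]; no product space is built.
    This is why the kernel has to be definite and not merely semidefinite: Gram-Schmidt then never
    meets a null vector, so it yields infinitely many independent standard normals, enough to
    realize any covariance on a countable index set. Finitely supported coefficient sequences are
    encoded as polynomials, ['X^k] standing for the variable of index k; [combo] is then an isometry
    from the form [pform] into L^2, and the random vectors are images of polynomials until almost
    sure limits are taken. The characteristic function of a normal law is never computed. Two
    centered Gaussian families with the same second moments have linear combinations with the same
    laws, hence equal cosine integrals, and these determine the joint law. In the same spirit, a
    limit law is identified by comparison with multiples s_k xi of one standard normal, which
    converge pointwise as soon as s_k does. *)

Section RealIntegrals.
Context d (T : measurableType d) (R : realType).
Variable mu : {measure set T -> \bar R}.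

Lemma Rintegral_dominated_cvg (D : set T) (f_ : (T -> R)^nat) (f g : T -> R) :
  measurable D -> (forall n, measurable_fun D (f_ n)) ->
  (forall x, D x -> f_ ^~ x @ \oo --> f x) ->
  mu.-integrable D (EFin \o g) ->
  (forall n x, D x -> `|f_ n x| <= g x) ->
  mu.-integrable D (EFin \o f) /\
  (\int[mu]_(x in D) f_ n x)%R @[n --> \oo] --> (\int[mu]_(x in D) f x)%R.
Proof.
move=> mD mf_ f_f ig f_g.
have mf : measurable_fun D f by apply: measurable_fun_cvg f_f.
have [|||||i _ c] := @dominated_convergence _ T R mu D mD
  (fun n => EFin \o f_ n) (EFin \o f) (EFin \o g).
- by move=> n; apply/measurable_EFinP.
- exact/measurable_EFinP.
- by apply/aeW => x Dx; apply: cvg_EFin; [exact: nearW|exact: f_f].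
- exact: ig.
- by apply/aeW => x n Dx; rewrite /= lee_fin f_g.
split=> //; apply: fine_cvg; rewrite fineK//.
exact: integrable_fin_num i.
Qed.

End RealIntegrals.

(** * Bounded measurable functions *)

Section BoundedMeasurable.
Context d (T : measurableType d) (R : realType).

Definition bdd_meas (f : T -> R) :=
  measurable_fun setT f /\ exists M : R, forall x, `|f x| <= M.

Lemma bdd_meas_integrable (mu : probability T R) f :
  bdd_meas f -> mu.-integrable setT (EFin \o f).
Proof.
move=> [mf [M fM]]; apply: measurable_bounded_integrable => //.
  exact: le_lt_trans (probability_le1 _ measurableT) (ltry _).
exists M; split; first exact: num_real.
by move=> x Mx y _ /=; rewrite (le_trans (fM y))// ltW.
Qed.

Lemma bdd_meas_cst c : bdd_meas (cst c).
Proof. by split=> //; exists `|c|. Qed.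

Lemma bdd_measD f g : bdd_meas f -> bdd_meas g -> bdd_meas (fun x => f x + g x).
Proof.
move=> [mf [M fM]] [mg [N gN]]; split; first exact: measurable_funD.
by exists (M + N) => x; rewrite (le_trans (ler_normD _ _))// lerD.
Qed.

Lemma bdd_measM f g : bdd_meas f -> bdd_meas g -> bdd_meas (fun x => f x * g x).
Proof.
move=> [mf [M fM]] [mg [N gN]]; split; first exact: measurable_funM.
by exists (M * N) => x; rewrite normrM ler_pM.
Qed.

Lemma bdd_meas_cos f : measurable_fun setT f -> bdd_meas (fun x => cos (f x)).
Proof.
move=> mf; split; first exact: measurableT_comp (continuous_measurable_fun (@continuous_cos R)) mf.
by exists 1 => x; rewrite ler_norml cos_geN1 cos_le1.
Qed.

Lemma bdd_meas_lim (u_ : (T -> R)^nat) u M :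
  (forall n, bdd_meas (u_ n)) -> (forall n x, `|u_ n x| <= M) ->
  (forall x, u_ ^~ x @ \oo --> u x) -> bdd_meas u.
Proof.
move=> mu_ uM cu; split.
  apply: (@measurable_fun_cvg _ _ _ _ u_); last by move=> x _; exact: cu.
  by move=> n; have [] := mu_ n.
exists M => x; rewrite ler_norml.
have cx := cu x; have cv : cvgn (u_ ^~ x) by apply/cvg_ex; exists (u x).
have ux : limn (u_ ^~ x) = u x by apply/cvg_lim.
by rewrite -ux limr_ge//= ?limr_le//; apply: nearW => n;
  have := uM n x; rewrite ler_norml => /andP[].
Qed.

End BoundedMeasurable.

(** * Laws determined by their cosine integrals *)

Section StepFunctions.
Context {R : realType}.

Lemma bernoulli (x : R) n : -1 <= x -> 1 + n%:R * x <= (1 + x) ^+ n.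
Proof.
move=> x1; elim: n => [|n IH]; first by rewrite mul0r addr0 expr0.
rewrite exprS; apply: (@le_trans _ _ ((1 + x) * (1 + n%:R * x))); last first.
  by rewrite ler_wpM2l//; lra.
have n0 : 0 <= n%:R :> R by [].
rewrite -natr1; nra.
Qed.

(** [(1 - y ^+ N) ^+ (2 ^ N)] is the polynomial step function, with jump at 1/2, of elementary
    proofs of the Stone-Weierstrass theorem. Bernoulli bounds it below by [1 - (2 * y) ^+ N]. *)
Lemma cvg_step_lt (y : R) : 0 <= y -> y < 2^-1 ->
  (1 - y ^+ N) ^+ (2 ^ N) @[N --> \oo] --> (1 : R).
Proof.
move=> y0 y2.
have h : 1 - (2 * y) ^+ N @[N --> \oo] --> (1 : R).
  rewrite -[X in _ --> X]subr0; apply: cvgB; first exact: cvg_cst.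
  by apply: cvg_expr; rewrite ger0_norm; lra.
apply: (squeeze_cvgr _ h (cvg_cst _)); apply: nearW => N.
have yN1 : y ^+ N <= 1 by rewrite exprn_ile1//; lra.
have yN0 : 0 <= y ^+ N by rewrite exprn_ge0.
apply/andP; split; last by rewrite exprn_ile1//; lra.
apply: le_trans (bernoulli (2 ^ N) _); last lra.
by rewrite exprMn mulrN natrX.
Qed.

(** Since (1 - z) (1 + z) <= 1, the power is at most [(1 + y ^+ N) ^- (2 ^ N)], which Bernoulli
    bounds by the inverse of [(2 * y) ^+ N]. *)
Lemma cvg_step_gt (y : R) : 2^-1 < y -> y <= 1 ->
  (1 - y ^+ N) ^+ (2 ^ N) @[N --> \oo] --> (0 : R).
Proof.
move=> y2 y1.
have h : ((2 * y)^-1) ^+ N @[N --> \oo] --> (0 : R).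
  apply: cvg_expr; rewrite ger0_norm ?invr_ge0; last lra.
  by rewrite invf_lt1; lra.
apply: (squeeze_cvgr _ (cvg_cst _) h); apply: nearW => N.
have yN1 : y ^+ N <= 1 by rewrite exprn_ile1//; lra.
have yN0 : 0 < y ^+ N by rewrite exprn_gt0//; lra.
apply/andP; split; first by rewrite exprn_ge0//; lra.
have y20 : 0 < 2 * y by lra.
have y10 : 0 < 1 + y ^+ N by lra.
have yy0 : 0 < (2 * y) ^+ N by rewrite exprn_gt0//; lra.
rewrite exprVn.
apply: (@le_trans _ _ ((1 + y ^+ N) ^- (2 ^ N))).
  rewrite -[leRHS]mul1r ler_pdivlMr ?exprn_gt0//.
  by rewrite -exprMn exprn_ile1//; nra.
rewrite lef_pV2 ?posrE ?exprn_gt0//.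
apply: le_trans (bernoulli (2 ^ N) _); last lra.
by rewrite exprMn natrX; lra.
Qed.

Lemma cvg_neq0_indic (u : R) : `|u| <= 1 ->
  1 - (1 - u ^+ 2) ^+ N @[N --> \oo] --> ((u != 0)%:R : R).
Proof.
move=> u1; have [->|u0] := eqVneq u 0.
  rewrite [X in X @ _ --> _](_ : _ = cst 0); first exact: cvg_cst.
  by apply/funext => N /=; rewrite expr0n/= subr0 expr1n subrr.
rewrite -[X in _ --> X]subr0; apply: cvgB; first exact: cvg_cst.
apply: cvg_expr.
have : u ^+ 2 <= 1 by rewrite -[X in X <= _]ger0_norm ?sqr_ge0// normrX exprn_ile1.
have : 0 < u ^+ 2 by rewrite exprn_even_gt0.
by move=> ? ?; rewrite ger0_norm; lra.
Qed.

End StepFunctions.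

Section CharacteristicFunctions.
Context (R : realType) (n : nat).
Notation RT := (n.-tuple R).
Variables mu nu : probability RT R.

Definition dotp (a : 'I_n -> R) (x : RT) : R := \sum_(i < n) a i * tnth x i.

Lemma measurable_dotp a : measurable_fun setT (dotp a).
Proof.
apply: measurable_sum => i; apply: measurable_funM => //.
exact: measurable_tnth.
Qed.

(* [h mu] and [h nu] have the same cosine transform.  The multipliers preserving this form
   an algebra stable under bounded limits; it contains the cosines, hence every
   indicator of a measurable set. *)
Definition trig_agree (h : RT -> R) := bdd_meas h /\
  forall a b, (\int[mu]_x (h x * cos (dotp a x + b)) =
               \int[nu]_x (h x * cos (dotp a x + b)))%R.

Definition trig_mult (u : RT -> R) := bdd_meas u /\
  forall h, trig_agree h -> trig_agree (fun x => h x * u x).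

Let bcos a b : bdd_meas (fun x => cos (dotp a x + b)).
Proof.
by apply: bdd_meas_cos; apply: measurable_funD => //; exact: measurable_dotp.
Qed.

Lemma trig_multM u v :
  trig_mult u -> trig_mult v -> trig_mult (fun x => u x * v x).
Proof.
move=> [bu hu] [bv hv]; split; first exact: bdd_measM.
move=> h /hu /hv; congr trig_agree; apply/funext => x; by rewrite mulrA.
Qed.

Lemma trig_multD u v :
  trig_mult u -> trig_mult v -> trig_mult (fun x => u x + v x).
Proof.
move=> [bu hu] [bv hv]; split; first exact: bdd_measD.
move=> h Qh; have [[bhu qu] [bhv qv]] := (hu _ Qh, hv _ Qh).
split; first by apply: bdd_measM; [case: Qh|exact: bdd_measD].
move=> a b.
under eq_Rintegral do rewrite mulrDr mulrDl.
under [RHS]eq_Rintegral do rewrite mulrDr mulrDl.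
rewrite !RintegralD ?qu ?qv//; apply: bdd_meas_integrable;
  by apply: bdd_measM => //; exact: bcos.
Qed.

Lemma trig_mult_cst c : trig_mult (cst c).
Proof.
split; first exact: bdd_meas_cst.
move=> h [bh qh]; split; first exact: bdd_measM bh (bdd_meas_cst _ _).
move=> a b.
under eq_Rintegral do rewrite /= -mulrA mulrCA.
under [RHS]eq_Rintegral do rewrite /= -mulrA mulrCA.
by rewrite !RintegralZl ?qh//; apply: bdd_meas_integrable;
  apply: bdd_measM => //; exact: bcos.
Qed.

Lemma trig_multB u v :
  trig_mult u -> trig_mult v -> trig_mult (fun x => u x - v x).
Proof.
move=> hu hv; have := trig_multD hu (trig_multM (trig_mult_cst (-1)) hv).
by congr trig_mult; apply/funext => x /=; rewrite mulN1r.
Qed.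

Lemma trig_multX u k : trig_mult u -> trig_mult (fun x => u x ^+ k).
Proof.
move=> hu; elim: k => [|k IH].
  by have := trig_mult_cst 1; congr trig_mult; apply/funext => x; rewrite expr0.
by have := trig_multM hu IH; congr trig_mult; apply/funext => x; rewrite exprS.
Qed.

(** Product-to-sum formula: multiplying by a cosine only changes frequency and phase, over which
    [trig_agree] quantifies. *)
Lemma trig_mult_cos a b : trig_mult (fun x => cos (dotp a x + b)).
Proof.
split; first exact: bcos.
move=> h [bh qh]; split; first exact: bdd_measM (bcos _ _).
move=> a' b'.
have E x : h x * cos (dotp a x + b) * cos (dotp a' x + b') =
    2^-1 * (h x * cos (dotp (fun i => a i + a' i) x + (b + b'))) +
    2^-1 * (h x * cos (dotp (fun i => a i - a' i) x + (b - b'))).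
  have -> : dotp (fun i => a i + a' i) x = dotp a x + dotp a' x.
    by rewrite /dotp -big_split/=; apply: eq_bigr => i _; rewrite mulrDl.
  have -> : dotp (fun i => a i - a' i) x = dotp a x - dotp a' x.
    by rewrite /dotp -sumrB/=; apply: eq_bigr => i _; rewrite mulrBl.
  have -> : dotp a x + dotp a' x + (b + b') =
      (dotp a x + b) + (dotp a' x + b') by ring.
  have -> : dotp a x - dotp a' x + (b - b') =
      (dotp a x + b) - (dotp a' x + b') by ring.
  move: (dotp a x + b) (dotp a' x + b') => p q; by rewrite cosD cosB; field.
under eq_Rintegral do rewrite E.
under [RHS]eq_Rintegral do rewrite E.
have bh' := bdd_measM bh (bcos _ _).
have bh2 a b := bdd_measM (bdd_meas_cst RT 2^-1) (bh' a b).
by rewrite !RintegralD ?RintegralZl ?qh//; apply: bdd_meas_integrable => //;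
  exact: bh2.
Qed.

Lemma trig_mult_lim (u_ : (RT -> R)^nat) u M :
  (forall k, trig_mult (u_ k)) -> (forall k x, `|u_ k x| <= M) ->
  (forall x, u_ ^~ x @ \oo --> u x) -> trig_mult u.
Proof.
move=> hu uM cu; have bu : bdd_meas u.
  by apply: bdd_meas_lim uM cu => k; case: (hu k).
split=> // h [bh qh]; split; first exact: bdd_measM.
move=> a b; have [mh [K hK]] := bh.
have key (m : probability RT R) :
    (\int[m]_x (h x * u_ k x * cos (dotp a x + b)))%R @[k --> \oo] -->
    (\int[m]_x (h x * u x * cos (dotp a x + b)))%R.
  have [|||||_ //] := @Rintegral_dominated_cvg _ RT R m setT
    (fun k x => h x * u_ k x * cos (dotp a x + b))
    (fun x => h x * u x * cos (dotp a x + b)) (cst (K * M)).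
  - exact: measurableT.
  - move=> k; have [[+ _] _] := hu k => muk.
    apply: measurable_funM; first exact: measurable_funM.
    by have [] := bcos a b.
  - move=> x _; apply: cvgMl; apply: cvgMr; exact: cu.
  - exact: bdd_meas_integrable (bdd_meas_cst _ _).
  - move=> k x _; rewrite !normrM /= -[leRHS]mulr1 ler_pM ?ler_pM//.
    by rewrite ler_norml cos_geN1 cos_le1.
have E k : (\int[mu]_x (h x * u_ k x * cos (dotp a x + b)))%R =
    (\int[nu]_x (h x * u_ k x * cos (dotp a x + b)))%R.
  by have [_ /(_ h (conj bh qh))[_ ->]] := hu k.
have := key mu; under eq_fun do rewrite E.
by move=> kmu; exact: cvg_unique kmu (key nu).
Qed.

(** The step polynomials are applied to [2^-1 * (1 - u x)], which is below 1/2 exactly when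
    [0 < u x]. At [u x = 0] this argument sits on the jump, where neither step lemma applies; the
    factor [u x != 0] takes care of that case. *)
Lemma trig_mult_pos u : trig_mult u -> (forall x, `|u x| <= 1) ->
  trig_mult (fun x => (0 < u x)%R%:R).
Proof.
move=> hu u1.
have h0 : trig_mult (fun x => (u x != 0)%R%:R).
  apply: (@trig_mult_lim (fun N x => 1 - (1 - u x ^+ 2) ^+ N) _ 1).
  - move=> k; apply: trig_multB; first exact: trig_mult_cst.
    apply: trig_multX; apply: trig_multB; first exact: trig_mult_cst.
    exact: trig_multX.
  - move=> k x; have : u x ^+ 2 <= 1.
      by rewrite -[X in X <= _]ger0_norm ?sqr_ge0// normrX exprn_ile1.
    have := sqr_ge0 (u x) => u0 u2.
    have : (1 - u x ^+ 2) ^+ k <= 1 by rewrite exprn_ile1; lra.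
    have : 0 <= (1 - u x ^+ 2) ^+ k by rewrite exprn_ge0; lra.
    by move=> ? ?; rewrite ger0_norm; lra.
  - by move=> x; exact: cvg_neq0_indic.
apply: (@trig_mult_lim (fun N x =>
  (u x != 0)%R%:R * (1 - (2^-1 * (1 - u x)) ^+ N) ^+ (2 ^ N)) _ 1).
- move=> k; apply: trig_multM => //; apply: trig_multX; apply: trig_multB.
    exact: trig_mult_cst.
  apply: trig_multX; apply: trig_multM; first exact: trig_mult_cst.
  by apply: trig_multB => //; exact: trig_mult_cst.
- move=> k x; have := u1 x; rewrite ler_norml => /andP[ul uu].
  have : (2^-1 * (1 - u x)) ^+ k <= 1 by rewrite exprn_ile1//; lra.
  have : 0 <= (2^-1 * (1 - u x)) ^+ k by rewrite exprn_ge0//; lra.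
  move=> h1 h2; rewrite normrM normrX -[leRHS]mulr1 ler_pM//.
    by case: (u x != 0); rewrite ?normr1 ?normr0.
  by rewrite exprn_ile1//; rewrite ger0_norm; lra.
- move=> x; have := u1 x; rewrite ler_norml => /andP[ul uu].
  have [ux|ux|<-] := ltgtP 0 (u x); last first.
  + under eq_fun do rewrite /= mul0r; exact: cvg_cst.
  + under eq_fun do rewrite mul1r; apply: cvg_step_gt; lra.
  + under eq_fun do rewrite mul1r; apply: cvg_step_lt; lra.
Qed.

(** The sine of [(tnth x k - c) / j.+1] has the sign of [tnth x k - c] as soon as its argument is
    smaller than pi in absolute value. *)
Lemma trig_mult_ray k c : trig_mult (fun x => (c < tnth x k)%R%:R).
Proof.
pose a j i : R := if i == k then j.+1%:R^-1 else 0.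
have aE j x : dotp (a j) x = j.+1%:R^-1 * tnth x k.
  rewrite /dotp (bigD1 k)//= /a eqxx big1 ?addr0// => i /negbTE ->.
  by rewrite mul0r.
pose s j x := cos (dotp (a j) x + (- (j.+1%:R^-1 * c) - pi / 2)).
have sE j x : s j x = sin (j.+1%:R^-1 * (tnth x k - c)).
  by rewrite /s aE mulrBr addrA -cosBpihalf.
apply: (@trig_mult_lim (fun j x => (0 < s j x)%R%:R) _ 1).
- move=> j; apply: trig_mult_pos; first exact: trig_mult_cos.
  by move=> x; rewrite ler_norml cos_geN1 cos_le1.
- by move=> j x; case: (0 < s j x); rewrite ?normr1 ?normr0.
- move=> x; apply: cvg_near_cst.
  near=> j; rewrite sE.
  set t := tnth x k - c.
  have jt : j.+1%:R^-1 * `|t| < pi.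
    rewrite mulrC ltr_pdivrMr// mulrC -ltr_pdivrMr ?pi_gt0//.
    near: j; apply: filterS (nbhs_infty_gtr (`|t| / pi)) => j /lt_trans; apply.
    by rewrite ltr_nat.
  have j0 : 0 < j.+1%:R^-1 :> R by rewrite invr_gt0.
  rewrite -[in RHS]subr_gt0 -/t; have [t0|t0|<-] := ltgtP 0 t.
  + rewrite sin_gt0_pi//; apply/andP; split; first exact: mulr_gt0.
    by rewrite -(gtr0_norm t0).
  + rewrite ltNge -[X in sin X]opprK sinN oppr_le0 ltW// sin_gt0_pi//.
    rewrite -mulrN; apply/andP; split; first by rewrite mulr_gt0// oppr_gt0.
    by rewrite -(ltr0_norm t0).
  + by rewrite mulr0 sin0 ltxx.
Unshelve. all: end_near. Qed.

Definition trig_sets : set (set RT) := [set A | trig_mult \1_A].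

(** Multipliers are stable under products, so the class is stable under intersections and is a
    sigma-algebra outright, without a Dynkin-system argument. *)
Lemma trig_sets_sigma : sigma_algebra setT trig_sets.
Proof.
have hC A : trig_sets A -> trig_sets (~` A).
  rewrite /trig_sets /= => hA; have := trig_multB (trig_mult_cst 1) hA.
  by congr trig_mult; apply/funext => x /=; rewrite !indicE in_setC;
    case: (x \in A); rewrite /= ?subrr ?subr0.
have hI A B : trig_sets A -> trig_sets B -> trig_sets (A `&` B).
  rewrite /trig_sets /= => hA hB; have := trig_multM hA hB.
  by congr trig_mult; apply/funext => x; rewrite indicI.
have h0 : trig_sets set0.
  rewrite /trig_sets /=; have := trig_mult_cst 0; congr trig_mult.
  by apply/funext => x; rewrite indic0.
split=> //.
  by move=> A /hC; rewrite setTD.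
move=> F hF.
have hU A B : trig_sets A -> trig_sets B -> trig_sets (A `|` B).
  by move=> hA hB; rewrite -[_ `|` _]setCK setCU; apply/hC/hI; exact: hC.
have hk k : trig_sets (\big[setU/set0]_(i < k) F i).
  by elim/big_ind : _ => // i _; exact: hF.
apply: (@trig_mult_lim (fun k => \1_(\big[setU/set0]_(i < k) F i)) _ 1).
- exact: hk.
- by move=> k x; rewrite indicE; case: (_ \in _); rewrite ?normr1 ?normr0.
- move=> x; apply: cvg_near_cst.
  rewrite !indicE; have [|] := boolP (x \in \bigcup_k F k).
    rewrite inE => -[N _ FN]; exists N.+1 => // k /= Nk.
    rewrite indicE mem_set//= -bigcup_mkord; by exists N.
  move=> xF; apply: nearW => k; rewrite indicE memNset// -bigcup_mkord => -[i _ Fi].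
  by move/negP : xF; apply; rewrite inE; exists i.
Qed.

Lemma trig_sets_measurable A : measurable A -> trig_sets A.
Proof.
apply: smallest_sub; first exact: trig_sets_sigma.
elim/big_ind : _ => //.
  by move=> U V hU hV; rewrite subUset.
move=> k _ B [C mC <-]; rewrite setTI.
suff : [set C : set R | trig_sets ((fun x : RT => tnth x k) @^-1` C)] C by [].
move: C mC; change ((@ocitv R).-sigma.-measurable `<=`
  [set C : set R | trig_sets ((fun x : RT => tnth x k) @^-1` C)]).
rewrite RGenOInfty.measurableE; apply: smallest_sub.
  have [s0 sC sU] := trig_sets_sigma; split.
  - by rewrite /= preimage_set0.
  - move=> C /= /sC; by rewrite !setTD preimage_setC.
  - by move=> F hF; rewrite /= preimage_bigcup; exact: sU.
move=> _ [c ->] /=; have := trig_mult_ray k c; congr trig_mult.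
apply/funext => x; rewrite indicE; congr (_%:R).
have [xk|xk] := ltP c (tnth x k); first by rewrite mem_set//= in_itv/= xk.
by rewrite memNset//= in_itv/= andbT; apply/negP; rewrite -leNgt.
Qed.

Theorem charfun_unique :
  (forall a b, (\int[mu]_x cos (dotp a x + b) =
                \int[nu]_x cos (dotp a x + b))%R) ->
  forall A, measurable A -> mu A = nu A.
Proof.
move=> munu A mA.
have Q1 : trig_agree (cst 1).
  split; first exact: bdd_meas_cst.
  move=> a b; under eq_Rintegral do rewrite /= mul1r.
  by under [RHS]eq_Rintegral do rewrite /= mul1r.
have [bA /(_ _ Q1)[_ /(_ (fun=> 0) 0)]] := trig_sets_measurable mA.
have E (m : probability RT R) :
  (\int[m]_x (cst 1 x * \1_A x * cos (dotp (fun=> 0%R) x + 0)))%R = fine (m A).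
  rewrite /Rintegral -[A in RHS]setIT -integral_indic//; congr fine.
  apply: eq_integral => x _; rewrite /= mul1r /dotp big1 ?addr0 ?cos0 ?mulr1//.
  by move=> i _; rewrite mul0r.
rewrite !E => H; have := congr1 EFin H; rewrite !fineK//; exact: fin_num_measure.
Qed.

End CharacteristicFunctions.

(** * Moments of normal laws *)

Section NormalMoments.
Context {R : realType}.
Notation mu := (@lebesgue_measure R).

(** [normal_prob] is integrated through its Radon-Nikodym derivative, which agrees almost everywhere
    with [normal_pdf] because both have the same integral over every measurable set. *)
Lemma ge0_integral_normal_prob (m s : R) (f : R -> R) : s != 0 ->
  measurable_fun setT f -> (forall x, 0 <= f x) ->
  (\int[normal_prob m s]_x (f x)%:E = \int[mu]_x (f x * normal_pdf m s x)%:E)%E.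
Proof.
move=> s0 mf f0.
have dom := normal_prob_dominates m s.
have mp := measurable_normal_pdf m s.
rewrite -(Radon_Nikodym_SigmaFinite.change_of_variables dom)//=; last exact/measurable_EFinP.
set g := Radon_Nikodym_SigmaFinite.f _ _.
have ig : mu.-integrable setT g by exact: Radon_Nikodym_SigmaFinite.f_integrable.
under [RHS]eq_integral do rewrite EFinM.
apply: ae_eq_integral => //.
- apply: emeasurable_funM; first exact/measurable_EFinP.
  exact: measurable_int ig.
- by apply: emeasurable_funM; exact/measurable_EFinP.
- apply: ae_eqe_mul2l; apply: integral_ae_eq => //.
  + exact/measurable_EFinP.
  + by move=> E _ mE; rewrite -Radon_Nikodym_SigmaFinite.f_integral.
Qed.

Lemma is_derive_normal_pdf (m s x : R) : s != 0 ->
  is_derive x (1 : R) (normal_pdf m s) (- (x - m) / s ^+ 2 * normal_pdf m s x).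
Proof.
move=> s0; rewrite normal_pdfE// /normal_fun.
apply: is_derive_eq.
rewrite /GRing.scale/=.
by field.
Qed.

(** Domination by [8 * s ^+ 2] times the density of deviation [2 * s]: with a = (x - m)^2 / (2 s^2),
    what is needed is a e^(-3a/4) <= 2, and e^x >= 1 + x gives even 4/3. *)
Lemma integrable_sqr_normal_pdf (m s : R) : s != 0 ->
  mu.-integrable setT (fun x => ((x - m) ^+ 2 * normal_pdf m s x)%:E).
Proof.
move=> s0.
have s20 : 2 * s != 0 by rewrite mulf_neq0.
have ip := integrable_normal_pdf m (2 * s).
have := integrableZl measurableT (8 * s ^+ 2) ip.
apply: le_integrable => //.
  apply/measurable_EFinP; apply: measurable_funM; last exact: measurable_normal_pdf.
  by apply: measurable_funX; exact: measurable_funB.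
move=> x _.
rewrite /= lee_fin !ger0_norm; last 2 first.
- by rewrite mulr_ge0 ?normal_pdf_ge0// mulr_ge0 ?sqr_ge0.
- by rewrite mulr_ge0 ?sqr_ge0 ?normal_pdf_ge0.
rewrite !normal_pdfE// /normal_fun /normal_peak.
have ss : 0 < s ^+ 2 by rewrite exprn_even_gt0.
have -> : Num.sqrt ((2 * s) ^+ 2 * pi *+ 2) = 2 * Num.sqrt (s ^+ 2 * pi *+ 2).
  rewrite exprMn -mulrA -mulrnAr sqrtrM ?sqr_ge0//.
  by rewrite sqrtr_sqr ger0_norm.
set p := Num.sqrt _; have p0 : 0 < p by rewrite sqrtr_gt0 mulrn_wgt0// mulr_gt0 ?pi_gt0.
set a := (x - m) ^+ 2 / (s ^+ 2 *+ 2).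
have -> : (x - m) ^+ 2 = 2 * s ^+ 2 * a by rewrite /a mulr2n; field.
have -> : - (2 * s ^+ 2 * a) / (s ^+ 2 *+ 2) = - (a / 4) + - (3 * a / 4).
  by rewrite mulr2n; field.
have -> : - (2 * s ^+ 2 * a) / ((2 * s) ^+ 2 *+ 2) = - (a / 4).
  by rewrite mulr2n; field.
rewrite expRD.
have := expR_ge1Dx (3 * a / 4).
have e0 := expR_gt0 (- (3 * a / 4)).
have : expR (- (3 * a / 4)) * expR (3 * a / 4) = 1 by rewrite mulrC expRxMexpNx_1.
move: (expR (- (3 * a / 4))) (expR (3 * a / 4)) e0 => u v u0 uv va.
have ua : a * u <= 4 / 3 by nra.
rewrite invfM.
have := expR_gt0 (- (a / 4)); move: (expR _) => w w0.
have pw : 0 < p^-1 * w by rewrite mulr_gt0 ?invr_gt0.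
have -> : 2 * s ^+ 2 * a * (p^-1 * (w * u)) = (2 * s ^+ 2 * (a * u)) * (p^-1 * w) by ring.
have -> : 8 * s ^+ 2 * (2^-1 * p^-1 * w) = (4 * s ^+ 2) * (p^-1 * w) by field; rewrite gt_eqF.
rewrite ler_pM2r//; nra.
Qed.

Lemma integrable_abs_normal_pdf (m s : R) : s != 0 ->
  mu.-integrable setT (fun x => ((x - m) * normal_pdf m s x)%:E).
Proof.
move=> s0.
have ip := integrable_normal_pdf m s.
have := integrableD measurableT ip (integrable_sqr_normal_pdf m s0).
apply: le_integrable => //.
  apply/measurable_EFinP; apply: measurable_funM; last exact: measurable_normal_pdf.
  exact: measurable_funB.
move=> x _; rewrite /= lee_fin.
have p0 := normal_pdf_ge0 m s x.
rewrite normrM (ger0_norm p0) [leRHS]ger0_norm; last first.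
  by rewrite addr_ge0// mulr_ge0// sqr_ge0.
rewrite -real_normK ?num_real//; have := normr_ge0 (x - m).
move: `|x - m| => t t0.
have : 0 <= normal_pdf m s x * (t - 2^-1) ^+ 2 by rewrite mulr_ge0// sqr_ge0.
nra.
Qed.

Lemma cvg_Rintegral_growing (m : R) (f : R -> R) :
  mu.-integrable setT (EFin \o f) ->
  (\int[mu]_(x in `[(m - n.+1%:R)%R, (m + n.+1%:R)%R]) f x)%R @[n --> \oo] -->
  (\int[mu]_x f x)%R.
Proof.
move=> fi.
under eq_fun do rewrite Rintegral_mkcond.
have mf : measurable_fun setT f by case/integrableP: fi => /measurable_EFinP.
have [|||||_ //] := @Rintegral_dominated_cvg _ _ R mu setT
  (fun n => f \_ `[(m - n.+1%:R)%R, (m + n.+1%:R)%R]) f (fun x => `|f x|).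
- exact: measurableT.
- move=> n; exact/(measurable_restrictT _ _).1/measurable_funTS.
- move=> x _; apply: cvg_near_cst; near=> n.
  rewrite patchE mem_set//= in_itv/=.
  have : `|x - m| < n.+1%:R.
    by near: n; apply: filterS (nbhs_infty_gtr `|x - m|) => n /lt_trans; apply;
      rewrite ltr_nat.
  by rewrite ltr_norml => /andP[? ?]; apply/andP; split; lra.
- exact: integrable_abse fi.
- by move=> n x _; rewrite patchE; case: ifP => // _; rewrite normr0.
Unshelve. all: end_near. Qed.

Let cvg_within (F : R -> R) (x : R) (D : set R) : {for x, continuous F} ->
  F @ within D (nbhs x) --> F x.
Proof. by move=> cF; apply: cvg_trans cF; apply: cvg_app; exact: cvg_within. Qed.

Lemma Rintegral_derive (f F : R -> R) (a b : R) : a < b ->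
  continuous f -> (forall x, is_derive x (1 : R) F (f x)) ->
  (\int[mu]_(x in `[a, b]) f x)%R = F b - F a.
Proof.
move=> ab cf dF.
have cF x : {for x, continuous F}.
  by apply: differentiable_continuous; apply/derivable1_diffP; case: (dF x).
rewrite /Rintegral (@continuous_FTC2 _ f F)//.
- by apply: continuous_subspaceT.
- split; first by move=> x _; case: (dF x).
  + exact: cvg_within.
  + exact: cvg_within.
- by move=> x _; rewrite derive1E; case: (dF x).
Qed.

(** On an interval centered at [m], the antiderivative [- s ^+ 2 * normal_pdf m s x] takes equal
    values at both ends. *)
Lemma Rintegral_normal_pdf_mean (m s : R) : s != 0 ->
  (\int[mu]_x ((x - m) * normal_pdf m s x))%R = 0.
Proof.
move=> s0.
have c := @cvg_Rintegral_growing m _ (integrable_abs_normal_pdf m s0).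
suff E n : (\int[mu]_(x in `[(m - n.+1%:R)%R, (m + n.+1%:R)%R])
    ((x - m) * normal_pdf m s x))%R = 0.
  suff c0 : (\int[mu]_(x in `[(m - k.+1%:R)%R, (m + k.+1%:R)%R])
      ((x - m) * normal_pdf m s x))%R @[k --> \oo] --> (0 : R).
    exact: (cvg_unique _ c c0).
  by under eq_fun do rewrite E; exact: cvg_cst.
have dF (x : R) : is_derive x (1 : R) (fun x => - s ^+ 2 * normal_pdf m s x)
    ((x - m) * normal_pdf m s x).
  have dp := is_derive_normal_pdf m x s0.
  apply: is_derive_eq; rewrite /GRing.scale/=; by field.
rewrite (Rintegral_derive _ _ dF).
- rewrite !normal_pdfE// /normal_fun.
  have -> : m - n.+1%:R - m = - (m + n.+1%:R - m) :> R by ring.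
  by rewrite sqrrN subrr.
- have : 0 < n.+1%:R :> R by []. lra.
- move=> x; apply: cvgM; last exact: continuous_normal_pdf.
  by apply: cvgB; [exact: cvg_id|exact: cvg_cst].
Qed.

(** Integration by parts: [(x - m) ^+ 2 - s ^+ 2] times the density is the derivative of
    [- s ^+ 2 * (x - m)] times the density, and the boundary terms vanish in the limit. *)
Lemma Rintegral_normal_pdf_var (m s : R) : s != 0 ->
  (\int[mu]_x ((x - m) ^+ 2 * normal_pdf m s x))%R = s ^+ 2.
Proof.
move=> s0.
have i2 := integrable_sqr_normal_pdf m s0.
have ip := integrable_normal_pdf m s.
have isp := integrableZl measurableT (s ^+ 2) ip.
have intp : (\int[mu]_x (s ^+ 2 * normal_pdf m s x))%R = s ^+ 2.
  rewrite RintegralZl//.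
  by rewrite /Rintegral integral_normal_pdf/= mulr1.
rewrite -[RHS]intp; apply/eqP; rewrite -subr_eq0 -RintegralB//.
apply/eqP.
have c := @cvg_Rintegral_growing m _ (integrableB measurableT i2 isp).
have E n : (\int[mu]_(x in `[(m - n.+1%:R)%R, (m + n.+1%:R)%R])
    ((x - m) ^+ 2 * normal_pdf m s x - s ^+ 2 * normal_pdf m s x))%R
    = - 2 * s ^+ 2 * (n.+1%:R * normal_pdf m s (m + n.+1%:R)).
  have dF (x : R) : is_derive x (1 : R) (fun x => - s ^+ 2 * ((x - m) * normal_pdf m s x))
      ((x - m) ^+ 2 * normal_pdf m s x - s ^+ 2 * normal_pdf m s x).
    have dp := is_derive_normal_pdf m x s0.
    apply: is_derive_eq; rewrite /GRing.scale/=; by field.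
  rewrite (Rintegral_derive _ _ dF).
  - have -> : normal_pdf m s (m - n.+1%:R) = normal_pdf m s (m + n.+1%:R).
      rewrite !normal_pdfE// /normal_fun.
      have -> : m - n.+1%:R - m = - (m + n.+1%:R - m) :> R by ring.
      by rewrite sqrrN.
    by ring.
  - have : 0 < n.+1%:R :> R by []. lra.
  - move=> x; apply: cvgB; apply: cvgM; try exact: continuous_normal_pdf.
      apply: (@continuous_comp _ _ _ (fun x : R => x - m) (fun x => x ^+ 2)).
        by apply: cvgB; [exact: cvg_id|exact: cvg_cst].
      exact: sqr_continuous.
    exact: cvg_cst.
suff : (\int[mu]_(x in `[(m - n.+1%:R)%R, (m + n.+1%:R)%R])
    ((x - m) ^+ 2 * normal_pdf m s x - s ^+ 2 * normal_pdf m s x))%R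
    @[n --> \oo] --> (0 : R).
  by move=> c0; exact: (cvg_unique _ c c0).
under eq_fun do rewrite E.
suff c0 : - 2 * s ^+ 2 * (n.+1%:R * normal_pdf m s (m + n.+1%:R)) @[n --> \oo] --> (0 : R).
  exact: c0.
rewrite -[X in _ --> X](mulr0 (- 2 * s ^+ 2)); apply: cvgMr.
have h0 : (2 * s ^+ 2 * normal_peak s) * (n.+1%:R)^-1 @[n --> \oo] --> (0 : R).
  rewrite -[X in _ --> X](mulr0 (2 * s ^+ 2 * normal_peak s)); apply: cvgMr.
  exact: cvg_harmonic.
apply: (squeeze_cvgr _ (cvg_cst _) h0); apply: nearW => n.
rewrite normal_pdfE// /normal_fun.
have -> : m + n.+1%:R - m = n.+1%:R :> R by ring.
set N : R := n.+1%:R; have N0 : 0 < N by [].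
set p := normal_peak s; have p0 : 0 < p := normal_peak_gt0 s0.
have ss : 0 < s ^+ 2 by rewrite exprn_even_gt0.
apply/andP; split; first by rewrite !mulr_ge0 ?expR_ge0// ltW.
have key : N ^+ 2 * expR (- N ^+ 2 / (s ^+ 2 *+ 2)) <= 2 * s ^+ 2.
  rewrite mulNr expRN ler_pdivrMr ?expR_gt0//.
  have := expR_ge1Dx (N ^+ 2 / (s ^+ 2 *+ 2)).
  move: (expR _) => e; rewrite mulr2n.
  have -> : N ^+ 2 / (s ^+ 2 + s ^+ 2) = N ^+ 2 / (2 * s ^+ 2) by congr (_ / _); ring.
  set q := N ^+ 2 / _ => qe.
  have -> : N ^+ 2 = 2 * s ^+ 2 * q by rewrite /q; field.
  nra.
move: key; move: (expR _) => e key.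
have -> : N * (p * e) = p * (N ^+ 2 * e) / N by field; rewrite gt_eqF.
have -> : 2 * s ^+ 2 * p / N = p * (2 * s ^+ 2) / N by ring.
by rewrite ler_pM2r ?invr_gt0// ler_pM2l.
Qed.

Lemma integrable_normal_prob (m s : R) (f : R -> R) : s != 0 ->
  measurable_fun setT f ->
  mu.-integrable setT (fun x => (f x * normal_pdf m s x)%:E) ->
  (normal_prob m s).-integrable setT (EFin \o f) /\
  (\int[normal_prob m s]_x f x = \int[mu]_x (f x * normal_pdf m s x))%R.
Proof.
move=> s0 mf /integrableP[_ fp].
have absE : (\int[normal_prob m s]_x `|f x|%:E =
    \int[mu]_x `|(f x * normal_pdf m s x)%:E|)%E.
  rewrite ge0_integral_normal_prob//; last exact: measurableT_comp.
  by apply: eq_integral => x _; rewrite /= normrM (ger0_norm (normal_pdf_ge0 _ _ _)).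
have fi : (normal_prob m s).-integrable setT (EFin \o f).
  apply/integrableP; split; first exact/measurable_EFinP.
  by rewrite /comp; under eq_integral do rewrite abse_EFin; rewrite absE.
split=> //; rewrite /Rintegral; congr fine.
have dom := normal_prob_dominates m s.
have mp := measurable_normal_pdf m s.
rewrite -(Radon_Nikodym_change_of_variables dom)//=.
under [RHS]eq_integral do rewrite EFinM.
apply: ae_eq_integral => //.
- apply: emeasurable_funM; first exact/measurable_EFinP.
  apply: measurable_int; apply: Radon_Nikodym_integrable; exact: dom.
- by apply: emeasurable_funM; exact/measurable_EFinP.
- apply: ae_eqe_mul2l; rewrite Radon_NikodymE//=.
  case: cid => /= h [h1 h2 h3].
  apply: integral_ae_eq => //.
  + exact/measurable_EFinP.
  + by move=> E _ mE; rewrite -h3.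
Qed.

Lemma normal_prob_moments (m s : R) : s != 0 ->
  [/\ (normal_prob m s).-integrable setT (fun x : R => (x ^+ 2)%:E),
      (\int[normal_prob m s]_x x = m)%R &
      (\int[normal_prob m s]_x (x ^+ 2) = m ^+ 2 + s ^+ 2)%R].
Proof.
move=> s0.
have i0 := integrable_normal_pdf m s.
have i1 := integrable_abs_normal_pdf m s0.
have i2 := integrable_sqr_normal_pdf m s0.
have j0 := integrableZl measurableT m i0.
have j1 := integrableZl measurableT (2 * m) i1.
have j2 := integrableZl measurableT (m ^+ 2) i0.
have e1 x : x * normal_pdf m s x = (x - m) * normal_pdf m s x + m * normal_pdf m s x by ring.
have e2 x : x ^+ 2 * normal_pdf m s x = ((x - m) ^+ 2 * normal_pdf m s x
   + 2 * m * ((x - m) * normal_pdf m s x)) + m ^+ 2 * normal_pdf m s x by ring.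
have p1 : (\int[mu]_x (normal_pdf m s x))%R = 1.
  by rewrite /Rintegral integral_normal_pdf.
have j12 := integrableD measurableT i2 j1.
have [||_ E1] := @integrable_normal_prob m s id s0.
- exact: measurable_id.
- under eq_fun do rewrite e1; exact: (integrableD measurableT i1 j0).
have [||I2 E2] := @integrable_normal_prob m s (fun x => x ^+ 2) s0.
- exact: measurable_funX.
- under eq_fun do rewrite e2; exact: (integrableD measurableT j12 j2).
split=> //.
- rewrite E1; under eq_Rintegral do rewrite e1.
  by rewrite RintegralD// Rintegral_normal_pdf_mean// add0r RintegralZl// p1 mulr1.
- rewrite E2; under eq_Rintegral do rewrite e2.
  rewrite RintegralD// RintegralD// Rintegral_normal_pdf_var// !RintegralZl//.
  by rewrite Rintegral_normal_pdf_mean// p1; ring.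
Qed.

End NormalMoments.

Section NormalRandomVariables.
Context {R : realType} d {T : measurableType d} (P : probability T R).

Lemma normal_law_moments (X : T -> R) (m s : R) : measurable_fun setT X ->
  (forall A, measurable A -> pushforward P X A = normal_law m s A) ->
  [/\ P.-integrable setT (fun x => (X x ^+ 2)%:E),
      (\int[P]_x X x = m)%R & (\int[P]_x (X x ^+ 2) = m ^+ 2 + s ^+ 2)%R].
Proof.
move=> mX lawX.
have mX' : @measurable_fun _ _ T (measurableTypeR R) setT X := mX.
pose Y : {mfun T >-> measurableTypeR R} :=
  @mfun_Sub _ _ T (measurableTypeR R) X (mem_set mX').
have lawY A : measurable A -> distribution P Y A = normal_law m s A by exact: lawX.
(* [nu] abstracts over the two cases of [normal_law], the point mass and the law with a density. *)
have key (nu : {measure set (measurableTypeR R) -> \bar R}) :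
    (forall A, measurable A -> distribution P Y A = nu A) ->
    nu.-integrable setT (fun x => (x ^+ 2)%:E) ->
    [/\ P.-integrable setT (fun x => (X x ^+ 2)%:E),
      (\int[P]_x X x = \int[nu]_x x)%R &
      (\int[P]_x (X x ^+ 2) = \int[nu]_x (x ^+ 2))%R].
  move=> nuE /integrableP[_ fin2].
  have intE f : measurable_fun setT f -> P.-integrable setT (EFin \o (f \o X)) ->
      (\int[P]_x f (X x))%R = (\int[nu]_y f y)%R.
    move=> mf fi; rewrite /Rintegral.
    transitivity (fine (\int[distribution P Y]_y (f y)%:E)).
      rewrite integral_distribution//; exact/measurable_EFinP.
    by congr fine; apply: eq_measure_integral => A mA _; exact: nuE.
  have i2 : P.-integrable setT (fun x => (X x ^+ 2)%:E).
    apply/integrableP; split; first exact/measurable_EFinP/measurable_funX.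
    apply: le_lt_trans fin2.
    rewrite -(@eq_measure_integral _ _ _ _ nu (distribution P Y)); last first.
      by move=> A mA _; exact: nuE.
    rewrite ge0_integral_distribution//=.
    by apply/measurable_EFinP; apply: measurableT_comp => //; exact: measurable_funX.
  have i1 : P.-integrable setT (fun x => (X x)%:E).
    have ione : P.-integrable setT (EFin \o cst 1).
      exact: bdd_meas_integrable (bdd_meas_cst _ _).
    have := integrableD measurableT ione i2; apply: le_integrable => //.
      exact/measurable_EFinP.
    move=> x _; rewrite /= lee_fin [leRHS]ger0_norm ?addr_ge0 ?sqr_ge0//.
    rewrite -real_normK ?num_real//; move: `|X x| => t.
    have := sqr_ge0 (t - 2^-1); nra.
  split=> //.
  - by rewrite (intE id).
  - by rewrite (intE (fun y => y ^+ 2))//; exact: measurable_funX.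
have [s0|s0] := eqVneq s 0.
  have [||i2 -> ->] := key (dirac (m : measurableTypeR R)).
  - by move=> A mA; rewrite lawY// /normal_law s0 eqxx.
  - apply/integrableP; split; first exact/measurable_EFinP/measurable_funX.
    rewrite integral_dirac//=; last first.
      by apply/measurable_EFinP; apply: measurableT_comp => //; exact: measurable_funX.
    by rewrite diracT mul1e ltry.
  split=> //; rewrite /Rintegral integral_dirac//= ?diracT ?mul1e//.
  - by rewrite indicT mul1r.
  - by rewrite indicT mul1r s0 expr0n addr0.
  - exact/measurable_EFinP/measurable_funX.
have [n2 n1 n2E] := normal_prob_moments m s0.
have [||i2 -> ->] := key (normal_prob m s) => //.
by move=> A mA; rewrite lawY// /normal_law (negbTE s0).
Qed.

Lemma normal_lawN (m s : R) A : normal_law m (- s) A = normal_law m s A.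
Proof.
rewrite /normal_law oppr_eq0; case: ifPn => // s0.
rewrite /normal_prob; apply: eq_integral => x _.
by rewrite !normal_pdfE ?oppr_eq0// /normal_fun /normal_peak sqrrN.
Qed.

(** [gaussian_process] provides an [s] of unknown sign; this allows it to be replaced by the square
    root of the variance. *)
Lemma normal_law_sqr (m s t : R) A : s ^+ 2 = t ^+ 2 ->
  normal_law m s A = normal_law m t A.
Proof.
by move=> /eqP; rewrite eqf_sqr => /orP[|] /eqP ->; rewrite ?normal_lawN.
Qed.

End NormalRandomVariables.

(** * Evaluation of the contour integrals *)

Section CircleIntegrals.
Context {R : realType}.
Notation mu := (@lebesgue_measure R).

Lemma continuous_itv_integrable (f : R -> R) (a b : R) : continuous f ->
  mu.-integrable `[a, b] (EFin \o f).
Proof.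
move=> cf; apply: continuous_compact_integrable; first exact: segment_compact.
exact: continuous_subspaceT.
Qed.

Lemma is_derive_continuous (f g : R -> R) :
  (forall x, is_derive x (1 : R) f (g x)) -> continuous f.
Proof.
move=> df x; apply: differentiable_continuous; apply/derivable1_diffP.
by case: (df x).
Qed.

(* Real parts of [e^{i c} e^z (z / rho)^a] on the circle [z = rho e^{i t}]. *)
Definition cwave (rho a c t : R) : R :=
  expR (rho * cos t) * cos (rho * sin t + a * t + c).

(** On the circle, d/dt (e^z z^a) = i (z e^z z^a + a e^z z^a), and multiplication by i is the phase
    shift [pi / 2]. *)
Lemma is_derive_cwave (rho a c t : R) : is_derive t (1 : R) (cwave rho a c)
  (rho * cwave rho (a + 1) (c + pi / 2) t + a * cwave rho a (c + pi / 2) t).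
Proof.
apply: is_derive_eq; rewrite /GRing.scale/= /cwave.
have -> : rho * sin t + (a + 1) * t + (c + pi / 2) =
  ((rho * sin t + a * t + c) + t) + pi / 2 by ring.
have -> : rho * sin t + a * t + (c + pi / 2) =
  (rho * sin t + a * t + c) + pi / 2 by ring.
rewrite !cosDpihalf (sinD _ t); ring.
Qed.

Lemma continuous_cwave (rho a c : R) : continuous (cwave rho a c).
Proof. exact: is_derive_continuous (is_derive_cwave rho a c). Qed.

Lemma cos_shift_2pi (x : R) (k : nat) : cos (x + k%:R * (2 * pi)) = cos x.
Proof.
have -> : k%:R * (2 * pi) = (pi *+ 2) *+ k :> R by rewrite -[RHS]mulr_natl -(mulr_natl pi).
exact: periodicn (@cosD2pi R) _ _.
Qed.

Lemma cwave_2pi (rho c : R) (k : nat) (b : bool) :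
  let a := if b then - k%:R else k%:R in
  cwave rho a c (2 * pi) = cwave rho a c 0.
Proof.
rewrite /cwave; have -> : 2 * pi = pi *+ 2 :> R by rewrite mulr_natl.
rewrite cos2pi sin2pi cos0 sin0 !mulr0 !mulr1 !add0r; congr (_ * _).
case: b.
  rewrite -(cos_shift_2pi _ k); congr cos; rewrite -mulr_natl; ring.
rewrite -[RHS](cos_shift_2pi _ k); congr cos; rewrite -mulr_natl; ring.
Qed.

Definition cwint (rho a c : R) : R :=
  (\int[mu]_(t in `[0%R, (2 * pi)%R]) cwave rho a c t)%R.

Lemma twopi_gt0 : 0 < 2 * pi :> R.
Proof. by rewrite mulr_gt0 ?pi_gt0. Qed.

(** The integral of a derivative over a full period vanishes. The boolean is the sign of the
    exponent [a], whose integrality makes [cwave] periodic. *)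
Lemma cwint_rec (rho c : R) (k : nat) (b : bool) :
  let a := if b then - k%:R else k%:R in
  rho * cwint rho (a + 1) c + a * cwint rho a c = 0.
Proof.
move=> a; have dH := is_derive_cwave rho a (c - pi / 2).
have cH a' : continuous (cwave rho a' c) by exact: continuous_cwave.
have E t : rho * cwave rho (a + 1) c t + a * cwave rho a c t =
  rho * cwave rho (a + 1) (c - pi / 2 + pi / 2) t + a * cwave rho a (c - pi / 2 + pi / 2) t.
  by rewrite subrK.
rewrite -[RHS](subrr (cwave rho a (c - pi / 2) 0)).
rewrite -[X in _ = X - _](@cwave_2pi rho _ k b).
rewrite -(Rintegral_derive twopi_gt0 _ dH); last first.
  move=> x; rewrite subrK.
  by apply: cvgD; apply: cvgMr; exact: continuous_cwave.
under [RHS]eq_Rintegral do rewrite -E.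
have i1 := continuous_itv_integrable 0 (2 * pi) (cH (a + 1)).
have i2 := continuous_itv_integrable 0 (2 * pi) (cH a).
rewrite RintegralD//; last 2 first.
- by apply: continuous_itv_integrable => x; apply: cvgMr; exact: cH.
- by apply: continuous_itv_integrable => x; apply: cvgMr; exact: cH.
by rewrite !RintegralZl.
Qed.

Lemma cwint_pos (rho c : R) k : 0 < rho -> cwint rho k.+1%:R c = 0.
Proof.
move=> r0; elim: k => [|k IH].
  have := cwint_rec rho c 0 false; rewrite /= mul0r addr0 add0r => /eqP.
  by rewrite mulf_eq0 gt_eqF//= => /eqP.
have := cwint_rec rho c k.+1 false; rewrite /= IH mulr0 addr0 natr1 => /eqP.
by rewrite mulf_eq0 gt_eqF//= => /eqP.
Qed.

Lemma is_derive_cwave_radius (t c rho : R) :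
  is_derive rho (1 : R) (fun rho => cwave rho 0 c t) (cwave rho 1 c t).
Proof.
apply: is_derive_eq; rewrite /GRing.scale/= /cwave.
have -> : rho * sin t + 1 * t + c = (rho * sin t + 0 * t + c) + t by ring.
rewrite (cosD _ t); ring.
Qed.

Lemma cwint1 (rho c : R) : cwint rho 1 c = 0.
Proof.
have [->|r0] := eqVneq rho 0.
  by have := cwint_rec 0 c 1 false; rewrite /= mul0r add0r mul1r.
have := cwint_rec rho c 0 false; rewrite /= mul0r addr0 add0r => /eqP.
by rewrite mulf_eq0 (negbTE r0) => /eqP.
Qed.

(** At [a = 0] the recursion yields [cwint rho 1 c] but says nothing about [cwint rho 0 c]. The
    latter is found by varying the radius: its derivative in [rho] is [cwint rho 1 c = 0], and at
    [rho = 0] the integrand is constant. *)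
Lemma is_derive_cwint0 (c rho : R) :
  is_derive rho (1 : R) (fun r => cwint r 0 c) 0.
Proof.
have ep : (partial1of2 (fun r t => cwave r 0 c t)) = fun r t => cwave r 1 c t.
  apply/funext => r; apply/funext => t; rewrite partial1of2E.
  by have [] := is_derive_cwave_radius t c r.
pose u := rho - 1; pose v := rho + 1; pose G (t : R) := expR (`|rho| + 1).
have rI : `]u, v[%classic rho by rewrite /= in_itv/= /u /v; apply/andP; split; lra.
have intf x : `]u, v[%classic x -> mu.-integrable `[0%R, (2 * pi)%R] (EFin \o cwave x 0 c).
  by move=> _; apply: continuous_itv_integrable; exact: continuous_cwave.
have df x t : `]u, v[%classic x -> `[0%R, (2 * pi)%R]%classic t ->
    derivable ((fun r t => cwave r 0 c t) ^~ t) x 1.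
  by move=> _ _; case: (is_derive_cwave_radius t c x).
have G0 t : 0 <= G t by exact: expR_ge0.
have Gi : mu.-integrable `[0%R, (2 * pi)%R] (EFin \o G).
  by apply: continuous_itv_integrable => x; exact: cvg_cst.
have Gub x t : `]u, v[%classic x -> `[0%R, (2 * pi)%R]%classic t ->
    `|partial1of2 (fun r t => cwave r 0 c t) x t| <= G t.
  move=> /=; rewrite in_itv/= /u /v => /andP[x0 xv] _; rewrite ep /cwave normrM.
  rewrite ger0_norm ?expR_ge0// -[leRHS]mulr1 ler_pM ?expR_ge0//; last exact: cos_max.
  rewrite ler_expR (le_trans (ler_norm _))// normrM -[leRHS]mulr1 ler_pM//; last exact: cos_max.
  have := ler_norm rho; have := ler_normr (- rho) rho; rewrite lexx orbT => hr hr2.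
  by rewrite ler_norml; apply/andP; split; have := ler_norm (- rho); rewrite normrN; lra.
have [D1 D2] : derivable (fun r => cwint r 0 c) rho 1 /\
    ((fun r => cwint r 0 c)^`()%classic rho = 0).
  split.
    exact: (@derivable_under_integral _ _ _ mu (fun r t => cwave r 0 c t) _
      (measurable_itv _) rho u v rI intf df G G0 Gi Gub).
  rewrite (@differentiation_under_integral _ _ _ mu (fun r t => cwave r 0 c t) _
    (measurable_itv _) rho u v rI intf df G G0 Gi Gub) ep.
  exact: cwint1.
by split=> //; rewrite -derive1E.
Qed.

Lemma cwint0 (c rho : R) : cwint rho 0 c = 2 * pi * cos c.
Proof.
rewrite (is_derive_0_is_cst (f := fun r => cwint r 0 c) rho 0 (is_derive_cwint0 c)) /cwint /cwave.
under eq_Rintegral do rewrite !mul0r expR0 add0r add0r mul1r.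
have E : mu `[0%R, (2 * pi)%R]%classic = (2 * pi)%:E.
  by rewrite lebesgue_measure_itv/= lte_fin twopi_gt0 oppr0 addr0.
rewrite Rintegral_cst/=; last exact: measurable_itv.
by rewrite [X in fine X]E mulrC.
Qed.

Lemma cwint_neg (rho c : R) k : 0 < rho ->
  cwint rho (- k%:R) c = 2 * pi * cos c * rho ^+ k / k`!%:R.
Proof.
move=> r0; elim: k => [|k IH].
  by rewrite oppr0 cwint0 expr0 fact0 divr1 mulr1.
have := cwint_rec rho c k.+1 true; rewrite /=.
have -> : - k.+1%:R + 1 = - k%:R :> R by rewrite -natr1; ring.
rewrite IH => /eqP; rewrite mulNr subr_eq0 => /eqP H.
have k0 : k.+1%:R != 0 :> R by rewrite pnatr_eq0.
have f0 : k`!%:R != 0 :> R by rewrite pnatr_eq0 -lt0n fact_gt0.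
apply: (mulfI k0); rewrite -H factS natrM exprS; field.
by rewrite f0 nat1r k0.
Qed.


(** * Complex integrals over a period, and Laurent monomials *)

Notation itv02 := (`[(0:R), (2 * pi)%R]%classic).
Import ComplexField.Normc.
Notation cRe := complex.Re.
Notation cIm := complex.Im.

Lemma normr_Re_le (z : R[i]) : `|cRe z| <= normc z.
Proof.
case: z => a b /=; rewrite -sqrtr_sqr ler_wsqrtr// lerDl sqr_ge0//.
Qed.

Lemma normr_Im_le (z : R[i]) : `|cIm z| <= normc z.
Proof.
case: z => a b /=; rewrite -sqrtr_sqr ler_wsqrtr// lerDr sqr_ge0//.
Qed.

Lemma normc_ge0 (z : R[i]) : 0 <= normc z.
Proof. exact: le_trans (normr_ge0 _) (normr_Re_le z). Qed.

Lemma normc_le_ReIm (z : R[i]) : normc z <= `|cRe z| + `|cIm z|.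
Proof.
case: z => a b /=; rewrite -[leRHS]ger0_norm ?addr_ge0// -sqrtr_sqr ler_wsqrtr//.
rewrite sqrrD !real_normK ?num_real//.
by have := mulr_ge0 (normr_ge0 a) (normr_ge0 b); rewrite mulr2n; lra.
Qed.

Lemma normcX (z : R[i]) n : normc (z ^+ n) = normc z ^+ n.
Proof.
elim: n => [|n IH]; first by rewrite !expr0 normc1.
by rewrite !exprS normcM IH.
Qed.

Definition cintegrable (f : R -> R[i]) :=
  mu.-integrable itv02 (fun t => (cRe (f t))%:E) /\
  mu.-integrable itv02 (fun t => (cIm (f t))%:E).

Notation cint := (cintegral 0 (2 * pi)).

Lemma cintegrable_lim (f_ : (R -> R[i])^nat) (f : R -> R[i]) (K : R) :
  (forall n, cintegrable (f_ n)) -> (forall n t, normc (f_ n t) <= K) ->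
  (forall t, normc (f_ n t - f t) @[n --> \oo] --> (0 : R)) ->
  cintegrable f /\ normc (cint (f_ n) - cint f) @[n --> \oo] --> (0 : R).
Proof.
move=> fi fK cf.
have Ki : mu.-integrable itv02 (EFin \o cst K).
  by apply: continuous_itv_integrable => x; exact: cvg_cst.
have squeeze (p : R[i] -> R) t :
    (forall x y, p (x - y) = p x - p y) -> (forall z, `|p z| <= normc z) ->
    p (f_ n t) @[n --> \oo] --> p (f t).
  move=> pB pn; apply/subr_cvg0/norm_cvg0P.
  apply: (squeeze_cvgr _ (cvg_cst _) (cf t)); apply: nearW => n.
  by rewrite normr_ge0 /= -pB pn.
have [|||||iRe cvRe] := @Rintegral_dominated_cvg _ _ R mu itv02
  (fun n t => cRe (f_ n t)) (fun t => cRe (f t)) (cst K).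
- exact: measurable_itv.
- by move=> n; have [/measurable_int/measurable_EFinP] := fi n.
- by move=> t _; apply: squeeze; [case=> ? ? [? ?]|exact: normr_Re_le].
- exact: Ki.
- by move=> n t _; apply: le_trans (fK n t); exact: normr_Re_le.
have [|||||iIm cvIm] := @Rintegral_dominated_cvg _ _ R mu itv02
  (fun n t => cIm (f_ n t)) (fun t => cIm (f t)) (cst K).
- exact: measurable_itv.
- by move=> n; have [_ /measurable_int/measurable_EFinP] := fi n.
- by move=> t _; apply: squeeze; [case=> ? ? [? ?]|exact: normr_Im_le].
- exact: Ki.
- by move=> n t _; apply: le_trans (fK n t); exact: normr_Im_le.
split=> //.
have c0 : `|cRe (cint (f_ n) - cint f)| + `|cIm (cint (f_ n) - cint f)|
    @[n --> \oo] --> (0 : R).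
  rewrite -[X in _ --> X](addr0 (0 : R)); apply: cvgD; apply/norm_cvg0P.
    by apply/subr_cvg0; exact: cvRe.
  by apply/subr_cvg0; exact: cvIm.
apply: (squeeze_cvgr _ (cvg_cst _) c0); apply: nearW => n.
by rewrite normc_ge0 normc_le_ReIm.
Qed.

Lemma cintegrableD f g : cintegrable f -> cintegrable g ->
  cintegrable (fun t => f t + g t) /\
  cint (fun t => f t + g t) = cint f + cint g.
Proof.
have ReD (x y : R[i]) : cRe (x + y) = cRe x + cRe y by case: x y => ? ? [].
have ImD (x y : R[i]) : cIm (x + y) = cIm x + cIm y by case: x y => ? ? [].
move=> [f1 f2] [g1 g2].
have mI : measurable (itv02 : set (measurableTypeR R)) by exact: measurable_itv.
split.
  split.
    rewrite (_ : (fun t => _) = ((fun t => (cRe (f t))%:E) \+ (fun t => (cRe (g t))%:E))%E).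
      exact: integrableD.
    by apply/funext => t; rewrite ReD EFinD.
  rewrite (_ : (fun t => _) = ((fun t => (cIm (f t))%:E) \+ (fun t => (cIm (g t))%:E))%E).
    exact: integrableD.
  by apply/funext => t; rewrite ImD EFinD.
apply/eqP; rewrite eq_complex /=; apply/andP; split; apply/eqP.
  under eq_Rintegral do rewrite ReD.
  by rewrite RintegralD.
under eq_Rintegral do rewrite ImD.
by rewrite RintegralD.
Qed.

Lemma cintegrableZ (c : R[i]) f : cintegrable f ->
  cintegrable (fun t => c * f t) /\ cint (fun t => c * f t) = c * cint f.
Proof.
have ReM (x y : R[i]) : cRe (x * y) = cRe x * cRe y - cIm x * cIm y
  by case: x y => ? ? [].
have ImM (x y : R[i]) : cIm (x * y) = cRe x * cIm y + cIm x * cRe y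
  by case: x y => ? ? [].
move=> [f1 f2].
have mI : measurable (itv02 : set (measurableTypeR R)) by exact: measurable_itv.
have Z1 a : mu.-integrable itv02 (fun t => (a * cRe (f t))%:E).
  exact: (integrableZl mI a f1).
have Z2 a : mu.-integrable itv02 (fun t => (a * cIm (f t))%:E).
  exact: (integrableZl mI a f2).
split.
  split.
    rewrite (_ : (fun t => _) = ((fun t => (cRe c * cRe (f t))%:E) \-
        (fun t => (cIm c * cIm (f t))%:E))%E); first exact: integrableB.
    by apply/funext => t; rewrite ReM EFinB.
  rewrite (_ : (fun t => _) = ((fun t => (cRe c * cIm (f t))%:E) \+
      (fun t => (cIm c * cRe (f t))%:E))%E); first exact: integrableD.
  by apply/funext => t; rewrite ImM EFinD.
apply/eqP; rewrite eq_complex ReM ImM /=; apply/andP; split; apply/eqP.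
  under eq_Rintegral do rewrite ReM.
  rewrite (@RintegralB _ _ _ mu itv02 (fun t => cRe c * cRe (f t))
    (fun t => cIm c * cIm (f t)) mI (Z1 _) (Z2 _)).
  by rewrite (@RintegralZl _ _ _ mu itv02 (fun t => cRe (f t)) (cRe c) mI f1)
    (@RintegralZl _ _ _ mu itv02 (fun t => cIm (f t)) (cIm c) mI f2).
under eq_Rintegral do rewrite ImM.
rewrite (@RintegralD _ _ _ mu itv02 (fun t => cRe c * cIm (f t))
  (fun t => cIm c * cRe (f t)) mI (Z2 _) (Z1 _)).
by rewrite (@RintegralZl _ _ _ mu itv02 (fun t => cIm (f t)) (cRe c) mI f2)
  (@RintegralZl _ _ _ mu itv02 (fun t => cRe (f t)) (cIm c) mI f1).
Qed.

Lemma cintegrable_sum (c : nat -> R[i]) (g : nat -> R -> R[i]) M :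
  (forall m, cintegrable (g m)) ->
  cintegrable (fun t => \sum_(m < M) c m * g m t) /\
  cint (fun t => \sum_(m < M) c m * g m t) = \sum_(m < M) c m * cint (g m).
Proof.
move=> gi; elim: M => [|M [IH1 IH2]].
  rewrite big_ord0; under eq_fun do rewrite big_ord0.
  split.
    split; apply: (@continuous_itv_integrable (cst 0)) => x; exact: cvg_cst.
  apply/eqP; rewrite eq_complex /= !Rintegral_cst ?mul0r ?eqxx//;
    exact: measurable_itv.
under eq_fun do rewrite big_ord_recr.
have [h1 h2] := cintegrableZ (c M) (gi M).
have [k1 k2] := cintegrableD IH1 h1.
by split=> //; rewrite big_ord_recr /= k2 IH2 h2.
Qed.

(** The real and imaginary parts are bounded separately, hence [4 * pi] and not [2 * pi]. *)
Lemma normc_cint_le (f : R -> R[i]) (K : R) : cintegrable f ->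
  (forall t, normc (f t) <= K) -> normc (cint f) <= 4 * pi * K.
Proof.
move=> [f1 f2] fK.
have mI : measurable (itv02 : set (measurableTypeR R)) by exact: measurable_itv.
have Ki : mu.-integrable itv02 (EFin \o cst K).
  by apply: continuous_itv_integrable => x; exact: cvg_cst.
have E : mu itv02 = (2 * pi)%:E.
  by rewrite lebesgue_measure_itv/= lte_fin twopi_gt0 oppr0 addr0.
have EK : (\int[mu]_(t in itv02) cst K t)%R = 2 * pi * K.
  by rewrite Rintegral_cst//= [X in fine X]E mulrC.
have bd (p : R -> R) : mu.-integrable itv02 (EFin \o p) ->
    (forall t, `|p t| <= K) -> `|\int[mu]_(t in itv02) p t|%R <= 2 * pi * K.
  move=> ip pK; rewrite (le_trans (le_normr_Rintegral _ _))// -EK.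
  apply: le_Rintegral => //.
  exact: (integrable_abse ip).
apply: le_trans (normc_le_ReIm _) _.
have -> : 4 * pi * K = 2 * pi * K + 2 * pi * K by ring.
apply: lerD; apply: bd => // t; apply: le_trans (fK t).
  exact: normr_Re_le.
exact: normr_Im_le.
Qed.

Lemma circleM (a b s t : R) : circle a s * circle b t = circle (a * b) (s + t).
Proof.
by apply/eqP; rewrite eq_complex /= cosD sinD; apply/andP; split; apply/eqP; ring.
Qed.

Lemma circle10 : circle 1 0 = 1 :> R[i].
Proof. by rewrite /circle cos0 sin0 mulr1 mulr0. Qed.

Lemma circleX (rho t : R) n : circle rho t ^+ n = circle (rho ^+ n) (n%:R * t).
Proof.
elim: n => [|n IH]; first by rewrite !expr0 mul0r circle10.
by rewrite !exprS IH circleM; congr circle; rewrite -natr1; ring.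
Qed.

Lemma circleV (rho t : R) : rho != 0 -> (circle rho t)^-1 = circle rho^-1 (- t).
Proof.
move=> r0; have E : circle rho^-1 (- t) * circle rho t = 1.
  by rewrite circleM mulVf// addNr circle10.
have c0 : circle rho t != 0.
  by apply/eqP => c0; move/eqP: E; rewrite c0 mulr0 eq_sym oner_eq0.
by rewrite -[LHS]mul1r -E mulfK.
Qed.

Lemma normc_circle (rho t : R) : 0 <= rho -> normc (circle rho t) = rho.
Proof.
move=> r0; rewrite /circle /= !exprMn -mulrDr cos2Dsin2 mulr1 sqrtr_sqr ger0_norm//.
Qed.

Lemma circle_neq0 (rho t : R) : 0 < rho -> circle rho t != 0.
Proof.
move=> r0; apply/eqP => /(congr1 (@normc R)); rewrite normc_circle ?ltW// normc0.
by move=> e; rewrite e ltxx in r0.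
Qed.

Lemma circleZ (rho t : R) (k : int) : rho != 0 ->
  circle rho t ^ k = circle (rho ^ k) (k%:~R * t).
Proof.
move=> r0; case: k => n; first exact: circleX.
rewrite -[circle rho t ^ _]/(circle rho t ^- n.+1) -[rho ^ _]/(rho ^- n.+1).
by rewrite NegzE mulrNz -exprVn circleV// circleX exprVn mulrN mulNr.
Qed.

Lemma cexpD (z w : R[i]) : cexp (z + w) = cexp z * cexp w.
Proof.
case: z w => a b [c e]; apply/eqP; rewrite eq_complex /= expRD cosD sinD.
by apply/andP; split; apply/eqP; ring.
Qed.

Lemma normc_cexp (z : R[i]) : normc (cexp z) = expR (cRe z).
Proof.
by rewrite /cexp /= !exprMn -mulrDr cos2Dsin2 mulr1 sqrtr_sqr ger0_norm ?expR_ge0.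
Qed.

Definition cmono (rho : R) (k : int) (t : R) : R[i] :=
  circle rho t ^ k * cexp (circle rho t).

Lemma cmonoE (rho : R) k t : rho != 0 -> cmono rho k t =
  Complex (rho ^ k * cwave rho k%:~R 0 t) (rho ^ k * cwave rho k%:~R (- (pi / 2)) t).
Proof.
move=> r0; rewrite /cmono circleZ//; apply/eqP; rewrite eq_complex /= /cwave.
rewrite cosBpihalf addr0 cosD sinD.
by apply/andP; split; apply/eqP; ring.
Qed.

(** 2 pi times the coefficient of z^(-k) in the expansion of e^z; [Negz n] is -(n + 1). *)
Definition cmono_int (k : int) : R :=
  match k with Posz 0 => 2 * pi | Posz _.+1 => 0 | Negz n => 2 * pi / n.+1`!%:R end.

Lemma cint_cmono (rho : R) k : 0 < rho -> cintegrable (cmono rho k) /\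
  cint (cmono rho k) = (cmono_int k)%:C%C.
Proof.
move=> r0; have rn0 : rho != 0 by rewrite gt_eqF.
have ci c : mu.-integrable itv02 (EFin \o cwave rho k%:~R c).
  by apply: continuous_itv_integrable; exact: continuous_cwave.
have E c : (\int[mu]_(t in itv02) (rho ^ k * cwave rho k%:~R c t))%R = cmono_int k * cos c.
  rewrite RintegralZl//.
  change (rho ^ k * cwint rho k%:~R c = cmono_int k * cos c).
  case: k {ci} => [[|n]|n].
  - by rewrite cwint0 expr0z mul1r.
  - by rewrite cwint_pos// mulr0 mul0r.
  - rewrite -[rho ^ _]/(rho ^- n.+1) -[cmono_int _]/(2 * pi / n.+1`!%:R) NegzE mulrNz cwint_neg//.
    have rn : rho ^+ n.+1 != 0 by rewrite expf_neq0.
    have f0 : n.+1`!%:R != 0 :> R by rewrite pnatr_eq0 -lt0n fact_gt0.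
    field; by rewrite f0.
split.
  have i c : mu.-integrable itv02 (EFin \o (fun t => rho ^ k * cwave rho k%:~R c t)).
    by apply: continuous_itv_integrable => x; apply: cvgMr; exact: continuous_cwave.
  split.
    rewrite (_ : (fun t => _) = EFin \o (fun t => rho ^ k * cwave rho k%:~R 0 t))//.
    by apply/funext => t; rewrite cmonoE.
  rewrite (_ : (fun t => _) = EFin \o (fun t => rho ^ k * cwave rho k%:~R (- (pi / 2)) t))//.
  by apply/funext => t; rewrite cmonoE.
apply/eqP; rewrite eq_complex /=; apply/andP; split; apply/eqP.
  by under eq_Rintegral do rewrite cmonoE//=; rewrite E cos0 mulr1.
by under eq_Rintegral do rewrite cmonoE//=; rewrite E cosN cos_pihalf mulr0.
Qed.


(** Value of the double contour integral: with w / (z - w) expanded as the sum of the (w / z)^(m +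
    1), each term factors into a z-integral and a w-integral, and the latter is zero from m = s
    on. *)
Definition kcov (r s : nat) : R := \sum_(m < s) m.+1%:R ^+ 2 / (r%:R * s%:R) *
  (r`!%:R * s`!%:R / ((r + m.+1)`!%:R * (s - m.+1)`!%:R)).

Let i_unit : R[i] := Complex 0 1.

Lemma circle'E (rho t : R) : circle' rho t = i_unit * circle rho t.
Proof. by apply/eqP; rewrite eq_complex /= !mul0r !mul1r sub0r add0r !eqxx. Qed.

Let sqr_i_unit : i_unit * i_unit = -1.
Proof.
by apply/eqP; rewrite eq_complex /=; apply/andP; split; apply/eqP; ring.
Qed.

(** * Evaluation of the double contour integral *)

Section Residues.
Variables (r s : nat) (rw rz : R).
Hypotheses (rw0 : 0 < rw) (rwz : rw < rz) (r0 : (0 < r)%N) (s0 : (0 < s)%N).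

Let rz0 : 0 < rz. Proof. exact: lt_trans rwz. Qed.

(** Up to a factor i, from dz / z = i dt, this is the z-part of the m-th term of the expansion,
    z^(-m-1-r) e^z (1 - z / r). In the same way [wterm] is its w-part, w^(m+1-s) e^w (1 - w / s). *)
Definition zterm (m : nat) (t : R) : R[i] :=
  cmono rz (- (m.+1 + r)%:Z) t - (r%:R)^-1 * cmono rz (- (m + r)%:Z) t.

Definition wterm (m : nat) (u : R) : R[i] :=
  cmono rw (m.+1%:Z - s%:Z) u - (s%:R)^-1 * cmono rw (m.+2%:Z - s%:Z) u.

Let r_neq0 : r%:R != 0 :> R[i]. Proof. by rewrite pnatr_eq0 -lt0n. Qed.
Let s_neq0 : s%:R != 0 :> R[i]. Proof. by rewrite pnatr_eq0 -lt0n. Qed.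

Let natC (n : nat) : n%:R = (n%:R : R)%:C%C.
Proof. by rewrite rmorph_nat. Qed.

Lemma cint_zterm m : cintegrable (zterm m) /\ cint (zterm m) =
  (- (2 * pi * (m.+1%:R / r%:R) / (m.+1 + r)`!%:R))%:C%C.
Proof.
have [i1 e1] := cint_cmono (- (m.+1 + r)%:Z) rz0.
have [i2 e2] := cint_cmono (- (m + r)%:Z) rz0.
have [i3 e3] := cintegrableZ (- (r%:R)^-1) i2.
have [i4 e4] := cintegrableD i1 i3.
have E : zterm m = fun t => cmono rz (- (m.+1 + r)%:Z) t + - (r%:R)^-1 * cmono rz (- (m + r)%:Z) t.
  by apply/funext => t; rewrite /zterm mulNr.
rewrite E; split=> //; rewrite e4 e3 e1 e2 natC.
have f1 : cmono_int (- (m.+1 + r)%:Z) = 2 * pi / (m.+1 + r)`!%:R by [].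
have f2 : cmono_int (- (m + r)%:Z) = 2 * pi / (m + r)`!%:R.
  by move: r0; case: (r) => // k _; rewrite addnS.
rewrite f1 f2 -fmorphV -rmorphN -rmorphM -rmorphD; congr (_%:C%C).
rewrite addSn factS natrM.
have k0 : (m + r)`!%:R != 0 :> R by rewrite pnatr_eq0 -lt0n fact_gt0.
have k1 : (m + r).+1%:R != 0 :> R by rewrite pnatr_eq0.
have k2 : r%:R != 0 :> R by rewrite pnatr_eq0 -lt0n.
have k3 : (m + r).+1%:R = m.+1%:R + r%:R :> R by rewrite -natrD addSn.
move: k1 k3; move: ((m + r).+1%:R) => A k1 k3.
have -> : m.+1%:R = A - r%:R by rewrite k3 addrK.
by field; rewrite k0 k1 k2.
Qed.

Lemma cint_wterm m : cintegrable (wterm m) /\ cint (wterm m) =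
  (if (m < s)%N then 2 * pi * (m.+1%:R / s%:R) / (s - m.+1)`!%:R else 0)%:C%C.
Proof.
have [i1 e1] := cint_cmono (m.+1%:Z - s%:Z) rw0.
have [i2 e2] := cint_cmono (m.+2%:Z - s%:Z) rw0.
have [i3 e3] := cintegrableZ (- (s%:R)^-1) i2.
have [i4 e4] := cintegrableD i1 i3.
have E : wterm m = fun t => cmono rw (m.+1%:Z - s%:Z) t + - (s%:R)^-1 * cmono rw (m.+2%:Z - s%:Z) t.
  by apply/funext => t; rewrite /wterm mulNr.
rewrite E; split=> //; rewrite e4 e3 e1 e2 natC.
have k2 : s%:R != 0 :> R by rewrite pnatr_eq0 -lt0n.
rewrite -fmorphV -rmorphN -rmorphM -rmorphD; congr (_%:C%C).
case: ltngtP => [ms|ms|ms].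
- have [k sk] : exists k, s = (m.+1 + k)%N by exists (s - m.+1)%N; rewrite subnKC.
  have -> : (s - m.+1)%N = k by rewrite sk addKn.
  have -> : m.+1%:Z - s%:Z = - k%:Z by rewrite sk PoszD opprD addNKr.
  have -> : m.+2%:Z - s%:Z = 1 - k%:Z.
    by rewrite sk PoszD -[m.+2]addn1 PoszD; ring.
  have -> : m.+1%:R = s%:R - k%:R :> R by rewrite sk natrD addrK.
  case: k {sk} => [|k].
    by rewrite subr0 /= fact0 subr0; field.
  have -> : 1 - k.+1%:Z = - k%:Z by rewrite -[k.+1]addn1 PoszD; ring.
  have -> : cmono_int (- k.+1%:Z) = 2 * pi / k.+1`!%:R by [].
  have -> : cmono_int (- k%:Z) = 2 * pi / k`!%:R.
    by case: k => //=; rewrite fact0 divr1.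
  rewrite factS natrM.
  have k0 : k`!%:R != 0 :> R by rewrite pnatr_eq0 -lt0n fact_gt0.
  have k1 : k.+1%:R != 0 :> R by rewrite pnatr_eq0.
  move: k1; move: (k.+1%:R) => A k1.
  by field; rewrite k0 k1 k2.
- have -> : m.+1%:Z - s%:Z = (m - s).+1%:Z by lia.
  have -> : m.+2%:Z - s%:Z = (m - s).+2%:Z by lia.
  by rewrite /= mulr0 addr0.
- have -> : m.+1%:Z - s%:Z = 1 by rewrite ms -addn1 PoszD; ring.
  have -> : m.+2%:Z - s%:Z = 2 by rewrite ms -addn2 PoszD; ring.
  by rewrite /= mulr0 addr0.
Qed.

Let zc t : R[i] := circle rz t.
Let wc u : R[i] := circle rw u.
Let F (w z : R[i]) : R[i] := w / (z - w) * (r`!%:R * s`!%:R / (z ^+ r * w ^+ s)) *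
  cexp (z + w) * (1 - z / r%:R) * (1 - w / s%:R) / z / w.
Let Q (w : R[i]) : R[i] := r`!%:R * s`!%:R / w ^+ s.+1 * cexp w * (1 - w / s%:R).
Let X (z : R[i]) : R[i] := i_unit * (z ^+ r)^-1 * cexp z * (1 - z / r%:R).
Let q := rw / rz.

Let q0 : 0 <= q. Proof. by rewrite divr_ge0// ltW. Qed.
Let q1 : q < 1. Proof. by rewrite ltr_pdivrMr// mul1r. Qed.

Let z_neq0 t : zc t != 0. Proof. exact: circle_neq0. Qed.
Let w_neq0 t : wc t != 0. Proof. exact: circle_neq0. Qed.
Let zw_neq0 u t : zc t - wc u != 0.
Proof.
rewrite subr_eq0; apply/eqP => /(congr1 (@normc R)).
by rewrite !normc_circle ?ltW// => e; move: rwz; rewrite e ltxx.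
Qed.

Let fullE u t : F (wc u) (zc t) * circle' rz t =
  wc u / (zc t - wc u) * Q (wc u) * X (zc t).
Proof.
rewrite circle'E -/(zc t) /F /Q /X cexpD !exprS.
have w0 := w_neq0 u; have z0 := z_neq0 t; have zw0 := zw_neq0 u t.
have wS0 : wc u ^+ s != 0 by rewrite expf_neq0.
have zS0 : zc t ^+ r != 0 by rewrite expf_neq0.
move: (cexp (zc t)) (cexp (wc u)) (wc u ^+ s) (zc t ^+ r) wS0 zS0 => ez ew ws zr ws0 zr0.
move: (zc t) (wc u) z0 w0 zw0 => z w z0 w0 zw0.
by field; rewrite ws0 zr0 z0 w0 zw0 r_neq0 s_neq0.
Qed.

Let partial M u t : R[i] :=
  \sum_(m < M) (Q (wc u) * wc u ^+ m.+1 * i_unit) * zterm m t.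

Let ztermE m t : i_unit * zterm m t = (zc t)^-1 ^+ m.+1 * X (zc t).
Proof.
rewrite /zterm /cmono -/(zc t) -!exprnN addSn exprS exprD /X exprS.
have z0 := z_neq0 t.
have zS0 : zc t ^+ r != 0 by rewrite expf_neq0.
have zm0 : zc t ^+ m != 0 by rewrite expf_neq0.
rewrite exprVn.
move: (zc t ^+ r) (zc t ^+ m) (cexp (zc t)) zS0 zm0 => zr zm ez zr0 zm0.
move: (zc t) z0 => z z0.
by field; rewrite zr0 zm0 z0 r_neq0.
Qed.

(** The truncation error is exactly (w / z)^M times the integrand. As |w / z| = [q] < 1 on the
    contours, this gives both the uniform bound and the pointwise limit that dominated convergence
    asks for. *)
Let partialE M u t : F (wc u) (zc t) * circle' rz t - partial M u t =
  (wc u / zc t) ^+ M * (F (wc u) (zc t) * circle' rz t).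
Proof.
have -> : partial M u t = (\sum_(m < M) (wc u / zc t) ^+ m) *
    (wc u / zc t * Q (wc u) * X (zc t)).
  rewrite mulr_suml; apply: eq_bigr => m _.
  rewrite -mulrA ztermE exprMn !exprS; ring.
rewrite fullE.
have z0 := z_neq0 t; have zw0 := zw_neq0 u t.
have := subrX1 (wc u / zc t) M.
move: (\sum_(m < M) _) ((_ / _) ^+ M) => S zM SE.
have -> : zM = 1 + (wc u / zc t - 1) * S by rewrite -SE; ring.
move: (zc t) (wc u) z0 zw0 (Q _) (X _) => z w z0 zw0 Qw Xz.
by field; rewrite z0 zw0.
Qed.

Let normc1B (x : R[i]) : normc (1 - x) <= 1 + normc x.
Proof. by rewrite (le_trans (le_normcD _ _))// normc1 normcN. Qed.

Let normc_nat (n : nat) : normc (n%:R : R[i]) = n%:R.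
Proof. by rewrite natC /= expr0n addr0 sqrtr_sqr ger0_norm. Qed.

Let normc_cexp_circle (rho t : R) : 0 <= rho -> normc (cexp (circle rho t)) <= expR rho.
Proof.
by move=> h; rewrite normc_cexp ler_expR -[leRHS]mulr1 ler_wpM2l// cos_le1.
Qed.

Let normc_i : normc i_unit = 1.
Proof. by rewrite /= expr0n expr1n add0r sqrtr1. Qed.

(** The bound is the product of bounds for the factors; the nesting of the contours enters through
    |z - w| >= rz - rw. *)
Let F_bound : exists K, forall u t, normc (F (wc u) (zc t) * circle' rz t) <= K.
Proof.
exists (rw / (rz - rw) * (r`!%:R * s`!%:R / rw ^+ s.+1 * expR rw * (1 + rw / s%:R))
  * (1 / rz ^+ r * expR rz * (1 + rz / r%:R))) => u t.
have w0 := ltW rw0; have z0 := ltW rz0.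
rewrite fullE /Q /X !(normcM, normcV, normcX, normc_nat, normc_i).
rewrite (normc_circle u w0) (normc_circle t z0).
have e0 x : 0 <= expR x := expR_ge0 x.
have zw : rz - rw <= normc (zc t - wc u).
  have := le_normcD (zc t - wc u) (wc u); rewrite subrK !normc_circle//; lra.
have d0 : 0 < rz - rw by rewrite subr_gt0.
have b1 (x : R[i]) (n : nat) (rho : R) : 0 <= rho -> normc x = rho ->
    normc (1 - x / n%:R) <= 1 + rho / n%:R.
  by move=> h hx; apply: le_trans (normc1B _) _; rewrite normcM normcV normc_nat hx.
apply: ler_pM; try exact: mulr_ge0.
- by rewrite !mulr_ge0 ?normc_ge0 ?invr_ge0 ?normc_ge0 ?exprn_ge0.
- by rewrite !mulr_ge0 ?normc_ge0 ?invr_ge0 ?normc_ge0 ?exprn_ge0.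
- apply: ler_pM.
  + by rewrite mulr_ge0// invr_ge0 normc_ge0.
  + by rewrite !mulr_ge0 ?normc_ge0 ?invr_ge0 ?normc_ge0 ?exprn_ge0.
  + by rewrite ler_wpM2l// lef_pV2// posrE; apply: lt_le_trans zw.
  + apply: ler_pM.
    * by rewrite !mulr_ge0 ?normc_ge0 ?invr_ge0 ?normc_ge0 ?exprn_ge0.
    * exact: normc_ge0.
    * by rewrite ler_wpM2l ?normc_cexp_circle// !mulr_ge0// invr_ge0 exprn_ge0.
    * by apply: b1 => //; rewrite normc_circle.
- apply: ler_pM.
  + by rewrite !mulr_ge0 ?normc_ge0 ?invr_ge0 ?normc_ge0 ?exprn_ge0.
  + exact: normc_ge0.
  + by rewrite ler_wpM2l ?normc_cexp_circle// div1r invr_ge0 exprn_ge0.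
  + by apply: b1 => //; rewrite normc_circle.
Qed.

Let normc_ratio u t : normc (wc u / zc t) = q.
Proof. by rewrite normcM normcV !normc_circle// ltW. Qed.

Let partial_bound K : (forall u t, normc (F (wc u) (zc t) * circle' rz t) <= K) ->
  forall M u t, normc (partial M u t) <= 2 * K.
Proof.
move=> FK M u t.
have -> : partial M u t = F (wc u) (zc t) * circle' rz t -
    (wc u / zc t) ^+ M * (F (wc u) (zc t) * circle' rz t).
  by rewrite -partialE; ring.
rewrite (le_trans (le_normcD _ _))// normcN mulr_natl mulr2n lerD//.
rewrite normcM normcX normc_ratio -[leRHS]mul1r ler_pM ?normc_ge0 ?exprn_ge0//.
by rewrite exprn_ile1// ltW.
Qed.

Let partial_cvg u t :
  normc (partial M u t - F (wc u) (zc t) * circle' rz t) @[M --> \oo] --> (0 : R).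
Proof.
rewrite -[X in _ --> X](mul0r (normc (F (wc u) (zc t) * circle' rz t))).
under eq_fun do rewrite -normcN opprB partialE normcM normcX normc_ratio.
by apply: cvgMl; apply: cvg_expr; rewrite ger0_norm.
Qed.

Let zint m : R := - (2 * pi * (m.+1%:R / r%:R) / (m.+1 + r)`!%:R).
Let wint m : R := if (m < s)%N then 2 * pi * (m.+1%:R / s%:R) / (s - m.+1)`!%:R else 0.

Let cint_partial M u : cintegrable (partial M u) /\
  cint (partial M u) = \sum_(m < M) (Q (wc u) * wc u ^+ m.+1 * i_unit) * (zint m)%:C%C.
Proof.
have [h1 h2] := cintegrable_sum (fun m => Q (wc u) * wc u ^+ m.+1 * i_unit) M
  (fun m => (cint_zterm m).1).
split; first exact: h1.
by rewrite h2; apply: eq_bigr => m _; rewrite (cint_zterm m).2.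
Qed.

Let outer M u : R[i] := cint (partial M u) * circle' rw u.

Let outerE M u : outer M u =
  \sum_(m < M) (- (zint m)%:C%C * (r`!%:R * s`!%:R)) * wterm m u.
Proof.
rewrite /outer (cint_partial M u).2 mulr_suml; apply: eq_bigr => m _.
rewrite circle'E -/(wc u) /wterm /cmono -/(wc u) /Q.
have w0 := w_neq0 u.
rewrite !expfzDr// -!invr_expz -!exprnP !exprS.
have wS0 : wc u ^+ s != 0 by rewrite expf_neq0.
have ii := sqr_i_unit.
have E (a b c e f : R[i]) : a * b * i_unit * c * (i_unit * e) = - c * (a * b * e).
  by transitivity (i_unit * i_unit * (a * b * c * e)); [ring|rewrite ii; ring].
rewrite E//.
move: (cexp (wc u)) (wc u ^+ s) (wc u ^+ m) wS0 (zint m)%:C%C => ew ws wm ws0 c.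
move: (wc u) w0 => w w0.
by field; rewrite ws0 w0 s_neq0.
Qed.

Let cint_outer M : cintegrable (outer M) /\ cint (outer M) =
  \sum_(m < M) (- (zint m)%:C%C * (r`!%:R * s`!%:R)) * (wint m)%:C%C.
Proof.
have [h1 h2] := cintegrable_sum (fun m => - (zint m)%:C%C * (r`!%:R * s`!%:R)) M
  (fun m => (cint_wterm m).1).
have E : outer M = fun u => \sum_(m < M) (- (zint m)%:C%C * (r`!%:R * s`!%:R)) * wterm m u.
  by apply/funext => u; exact: outerE.
rewrite E; split; first exact: h1.
by rewrite h2; apply: eq_bigr => m _; rewrite (cint_wterm m).2.
Qed.

Let outer_lim u : normc (outer M u - oint rz (F (wc u)) * circle' rw u)
  @[M --> \oo] --> (0 : R).
Proof.
have [K FK] := F_bound.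
have [_ h] := cintegrable_lim (fun M => (cint_partial M u).1)
  (fun M t => partial_bound FK M u t) (partial_cvg u).
rewrite -[X in _ --> X](mul0r (normc (circle' rw u))).
under eq_fun do rewrite /outer -mulrBl normcM.
exact: cvgMl.
Qed.

Let outer_bound : exists K, forall M u, normc (outer M u) <= K.
Proof.
have [K FK] := F_bound; exists (4 * pi * (2 * K) * rw) => M u.
rewrite /outer normcM circle'E normcM normc_i mul1r normc_circle; last exact: ltW.
rewrite ler_pM2r//; apply: normc_cint_le; first exact: (cint_partial M u).1.
by move=> t; exact: partial_bound.
Qed.

(** All terms with m >= s integrate to zero, so the truncated integrals no longer change from M = s
    on, and the limit is their common value. *)
Lemma oint_oint : oint rw (fun w => oint rz (F w)) =
  \sum_(m < s) (- (zint m)%:C%C * (r`!%:R * s`!%:R)) * (wint m)%:C%C.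
Proof.
have [K oK] := outer_bound.
have [_ h] := cintegrable_lim (fun M => (cint_outer M).1) oK outer_lim.
set V := \sum_(m < s) _.
have hV M : (s <= M)%N -> cint (outer M) = V.
  move=> sM; rewrite (cint_outer M).2 -(subnKC sM) big_split_ord /=.
  rewrite [X in _ + X]big1 ?addr0// => i _.
  by rewrite /wint ltnNge leq_addr /= mulr0.
have E : normc (V - oint rw (fun w => oint rz (F w))) = 0.
  suff h0 : normc (cint (outer M) - oint rw (fun w => oint rz (F w)))
      @[M --> \oo] --> normc (V - oint rw (fun w => oint rz (F w))).
    exact: (cvg_unique _ h0 h).
  apply: cvg_near_cst; exists s => // M sM.
  exact: (congr1 (fun x => normc (x - _)) (hV M sM)).
by apply/esym/eqP; rewrite -subr_eq0; apply/eqP; exact: eq0_normc E.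
Qed.

Lemma zeta_cov_kcov : zeta_cov rw rz r s = (kcov r s)%:C%C.
Proof.
rewrite /zeta_cov; have := oint_oint; rewrite /F => ->.
rewrite !natC -rmorphM.
under eq_bigr do rewrite -rmorphN -!rmorphM.
rewrite -rmorph_sum -rmorphXn /=.
rewrite -rmorphM -fmorphV -rmorphM; congr (_%:C%C).
rewrite /kcov mulr_sumr; apply: eq_bigr => m _.
rewrite /zint /wint ltn_ord addnC.
have p0 : pi != 0 :> R by rewrite gt_eqF// pi_gt0.
have k1 : (r + m.+1)`!%:R != 0 :> R by rewrite pnatr_eq0 -lt0n fact_gt0.
have k2 : (s - m.+1)`!%:R != 0 :> R by rewrite pnatr_eq0 -lt0n fact_gt0.
have k3 : r%:R != 0 :> R by rewrite pnatr_eq0 -lt0n.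
have k4 : s%:R != 0 :> R by rewrite pnatr_eq0 -lt0n.
move: k1 k2 => /[swap]; move: ((r + m.+1)`!%:R) ((s - m.+1)`!%:R) (m.+1%:R) => a b c k1 k2.
move: p0; move: (pi : R) => p p0.
by field; rewrite k1 k2 k3 k4 p0.
Qed.

End Residues.

End CircleIntegrals.

(** * Gram-Schmidt and Cholesky *)

Section GramSchmidt.
Context {R : realType} (V : lmodType R) (ip : V -> V -> R).
Hypotheses (ipC : forall x y, ip x y = ip y x)
  (ipDl : forall x y z, ip (x + y) z = ip x z + ip y z)
  (ipZl : forall a x z, ip (a *: x) z = a * ip x z)
  (ip_ge0 : forall x, 0 <= ip x x).

Lemma ipBl x y z : ip (x - y) z = ip x z - ip y z.
Proof. by rewrite -scaleN1r ipDl ipZl mulN1r. Qed.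

Lemma ip0l z : ip 0 z = 0.
Proof. by rewrite -(scale0r 0) ipZl mul0r. Qed.

Lemma ip_suml (I : Type) (r : seq I) (Q : pred I) (F : I -> V) z :
  ip (\sum_(i <- r | Q i) F i) z = \sum_(i <- r | Q i) ip (F i) z.
Proof.
by elim/big_rec2 : _ => [|i y x _ <-]; rewrite ?ip0l ?ipDl.
Qed.

Lemma ip_null x y : ip x x = 0 -> ip x y = 0.
Proof.
move=> x0; apply/eqP; apply: contraT => xy.
(* With this [t], the form at [t *: x + y] would equal -1. *)
pose t := - (ip y y + 1) / (2 * ip x y).
have := ip_ge0 (t *: x + y).
rewrite ipDl ipZl ![ip _ (_ + _)]ipC !ipDl !ipZl x0 mulr0 add0r [ip y x]ipC.
have -> : t * ip x y = - (ip y y + 1) / 2 by rewrite /t; field.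
by have := ip_ge0 y; lra.
Qed.

Variable e : nat -> V.

(** A growing list, since each vector is built from all its predecessors. Null predecessors do no
    harm: division by zero gives them coefficient 0, and by [ip_null] they are orthogonal to
    everything. *)
Fixpoint gs_seq (n : nat) : seq V :=
  if n is k.+1 then
    rcons (gs_seq k) (e k - \sum_(v <- gs_seq k) (ip (e k) v / ip v v) *: v)
  else [::].

Definition gs (n : nat) : V := nth 0 (gs_seq n.+1) n.

Lemma size_gs_seq n : size (gs_seq n) = n.
Proof. by elim: n => //= n IH; rewrite size_rcons IH. Qed.

Lemma nth_gs_seq n k : (k < n)%N -> nth 0 (gs_seq n) k = gs k.
Proof.
elim: n => // n IH; rewrite ltnS leq_eqVlt => /orP[/eqP ->//|kn].
by rewrite /= nth_rcons size_gs_seq kn IH.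
Qed.

Lemma gsE n : gs n = e n - \sum_(k < n) (ip (e n) (gs k) / ip (gs k) (gs k)) *: gs k.
Proof.
rewrite {1}/gs /= nth_rcons size_gs_seq ltnn eqxx; congr (_ - _).
rewrite (big_nth 0) size_gs_seq big_mkord.
by apply: eq_bigr => k _; rewrite nth_gs_seq.
Qed.

Lemma gs_orth n k : (k < n)%N -> ip (gs n) (gs k) = 0.
Proof.
elim/ltn_ind : n k => n IH k kn.
rewrite gsE ipBl ip_suml (bigD1 (Ordinal kn))//= big1 ?addr0; last first.
  move=> i /negP ik; rewrite ipZl.
  have : (i != k :> nat) by apply: contra_notN ik => /eqP ik; apply/eqP/val_inj.
  rewrite neq_ltn => /orP[ik'|ki]; last first.
    by rewrite (IH i (ltn_ord i) k ki) mulr0.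
  by rewrite [ip (gs i) (gs k)]ipC (IH k kn i ik') mulr0.
rewrite ipZl; have [g0|g0] := eqVneq (ip (gs k) (gs k)) 0.
  by rewrite g0 mulr0 subr0 ipC ip_null.
by rewrite divfK// subrr.
Qed.

Lemma gs_orthogonal n k : n != k -> ip (gs n) (gs k) = 0.
Proof.
rewrite neq_ltn => /orP[nk|kn]; last exact: gs_orth.
by rewrite ipC gs_orth.
Qed.

(* Cholesky factor; when [gs k] is null, Rocq's division makes its column
   [k] zero, as it should be. *)
Definition gs_coef (n k : nat) : R :=
  if (k <= n)%N then ip (e n) (gs k) / Num.sqrt (ip (gs k) (gs k)) else 0.

(** If [gs n] is null for the form, its coefficient 0 / 0 is 0 although [gs n] may be a nonzero
    vector; the last summand restores it. *)
Lemma gs_expand n : e n = \sum_(k < n.+1) (ip (e n) (gs k) / ip (gs k) (gs k)) *: gs k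
  + (if ip (gs n) (gs n) == 0 then gs n else 0).
Proof.
have E : ip (e n) (gs n) = ip (gs n) (gs n).
  have eE : e n = gs n + \sum_(k < n) (ip (e n) (gs k) / ip (gs k) (gs k)) *: gs k.
    by rewrite [in RHS]gsE subrK.
  rewrite {1}eE ipDl ip_suml big1 ?addr0// => i _.
  by rewrite ipZl [ip (gs i) (gs n)]gs_orthogonal ?mulr0// neq_ltn ltn_ord.
rewrite big_ord_recr/= E -addrA.
have -> : (ip (gs n) (gs n) / ip (gs n) (gs n)) *: gs n +
   (if ip (gs n) (gs n) == 0 then gs n else 0) = gs n.
  case: eqP => [->|/eqP g0]; first by rewrite mul0r scale0r add0r.
  by rewrite divff// scale1r addr0.
by rewrite [in X in _ = _ + X]gsE addrC subrK.
Qed.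

Lemma ip_gs_coef n m N : (n < N)%N ->
  ip (e n) (e m) = \sum_(k < N) gs_coef n k * gs_coef m k.
Proof.
move=> nN; rewrite [in LHS](gs_expand n) ipDl.
have -> : ip (if ip (gs n) (gs n) == 0 then gs n else 0) (e m) = 0.
  by case: eqP => [/ip_null//|_]; exact: ip0l.
rewrite addr0 ip_suml -(subnKC nN) big_split_ord/=.
rewrite [X in _ = _ + X]big1 ?addr0; last first.
  by move=> i _; rewrite /gs_coef leqNgt leq_addr mul0r.
apply: eq_bigr => k _; rewrite ipZl /gs_coef -ltnS ltn_ord.
have [km|mk] := leqP k m.
  rewrite [ip (gs k) (e m)]ipC [RHS]mulrACA -[X in _ = _ * X]invfM -expr2 sqr_sqrtr//.
  by rewrite mulrAC.
rewrite mulr0 [ip (gs k) (e m)]ipC (gs_expand m) ipDl.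
have -> : ip (if ip (gs m) (gs m) == 0 then gs m else 0) (gs k) = 0.
  by case: eqP => [/ip_null//|_]; exact: ip0l.
rewrite addr0 ip_suml big1 ?mulr0// => i _.
rewrite ipZl [ip (gs i) (gs k)]gs_orthogonal ?mulr0// neq_ltn.
by rewrite (leq_trans (ltn_ord i) mk).
Qed.

End GramSchmidt.

(** * Bilinear forms on finitely supported sequences *)

Section FormOnPolynomials.
Context {R : realType} (C : nat -> nat -> R).

Definition pform (p q : {poly R}) : R :=
  \sum_(i < size p) \sum_(j < size q) p`_i * q`_j * C i j.

Lemma pform_widen (p q : {poly R}) M N : (size p <= M)%N -> (size q <= N)%N ->
  pform p q = \sum_(i < M) \sum_(j < N) p`_i * q`_j * C i j.
Proof.
move=> pM qN; rewrite /pform -(subnKC pM) big_split_ord/=.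
rewrite [X in _ = _ + X]big1 ?addr0; last first.
  by move=> i _; rewrite big1// => j _; rewrite nth_default ?leq_addr// !mul0r.
apply: eq_bigr => i _; rewrite -(subnKC qN) big_split_ord/=.
rewrite [X in _ = _ + X]big1 ?addr0// => j _.
by rewrite [q`__]nth_default ?leq_addr// mulr0 mul0r.
Qed.

Lemma pformDl p q r : pform (p + q) r = pform p r + pform q r.
Proof.
pose M := maxn (size p) (size q).
rewrite (@pform_widen (p + q) r M (size r)) ?size_polyD//.
rewrite (@pform_widen p r M (size r)) ?leq_maxl//.
rewrite (@pform_widen q r M (size r)) ?leq_maxr//.
rewrite -big_split/=; apply: eq_bigr => i _; rewrite -big_split/=.
by apply: eq_bigr => j _; rewrite coefD; ring.
Qed.

Lemma pformZl a p q : pform (a *: p) q = a * pform p q.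
Proof.
rewrite (@pform_widen (a *: p) q (size p) (size q)) ?size_scale_leq//.
rewrite /pform mulr_sumr; apply: eq_bigr => i _; rewrite mulr_sumr.
by apply: eq_bigr => j _; rewrite coefZ; ring.
Qed.

Lemma pform_Xn m n : pform 'X^m 'X^n = C m n.
Proof.
rewrite /pform !size_polyXn (bigD1 ord_max)//= [X in _ + X]big1 ?addr0; last first.
  move=> i im; rewrite big1// => j _; rewrite coefXn.
  have -> : (i == m :> nat) = false by exact: negbTE im.
  by rewrite !mul0r.
rewrite (bigD1 ord_max)//= [X in _ + X]big1 ?addr0; last first.
  move=> j jn; rewrite [('X^n)`__]coefXn.
  have -> : (j == n :> nat) = false by exact: negbTE jn.
  by rewrite mulr0 mul0r.
by rewrite !coefXn !eqxx !mul1r.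
Qed.

Lemma pformC p q : (forall i j, C i j = C j i) -> pform p q = pform q p.
Proof.
move=> CC; rewrite /pform exchange_big/=; apply: eq_bigr => i _.
by apply: eq_bigr => j _; rewrite CC; ring.
Qed.

End FormOnPolynomials.

Section Cholesky.
Context {R : realType} (C : nat -> nat -> R).
Hypothesis CC : forall i j, C i j = C j i.

(** Semidefinite forms are allowed on purpose: time points may repeat, which makes the matrices to
    be factored degenerate. *)
Lemma cholesky : (forall p, 0 <= pform C p p) ->
  exists A : nat -> nat -> R, (forall n k, (n < k)%N -> A n k = 0) /\
    forall n m N, (n < N)%N -> C n m = \sum_(k < N) A n k * A m k.
Proof.
move=> C0; exists (gs_coef (pform C) (fun n => 'X^n)); split.
  by move=> n k nk; rewrite /gs_coef leqNgt nk.
move=> n m N nN.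
rewrite -(@ip_gs_coef R {poly R} (pform C) _ _ _ _ (fun n => 'X^n) n m N nN) ?pform_Xn//.
- by move=> x y; exact: pformC.
- exact: pformDl.
- exact: pformZl.
Qed.

Lemma orthonormalization :
  (forall p, 0 <= pform C p p) -> (forall p, pform C p p = 0 -> p = 0) ->
  exists B : nat -> {poly R}, forall m n, pform C (B m) (B n) = (m == n)%:R.
Proof.
move=> C0 Cdef.
have [g gE gn0] : exists2 g : nat -> {poly R}, (forall n k, n != k -> pform C (g n) (g k) = 0)
    & forall n, g n != 0.
  pose g := gs (pform C) (fun n => 'X^n : {poly R}).
  have pC x y : pform C x y = pform C y x by exact: pformC.
  exists g => [n k nk|n]; first exact: (gs_orthogonal pC (@pformDl _ C) (@pformZl _ C)).
  (* [g n] differs from ['X^n] by terms of lower degree only, so it is nonzero, and definiteness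
     then permits its normalization. *)
  have : g n - 'X^n \in [pred p : {poly R} | (size p <= n)%N] /\ (size (g n) <= n.+1)%N.
    elim/ltn_ind : n => n IH.
    have sz : (size (\sum_(k < n) (pform C 'X^n (g k) / pform C (g k) (g k)) *: g k)%R <= n)%N.
      apply: (leq_trans (size_sum _ _ _)); apply/bigmax_leqP => k _.
      rewrite (leq_trans (size_scale_leq _ _))//.
      by have [_ /leq_trans] := IH k (ltn_ord k); apply; exact: ltn_ord.
    rewrite inE {1 2}/g gsE -/g; split.
      by rewrite addrAC subrr add0r size_polyN.
    rewrite (leq_trans (size_polyD _ _))// geq_max size_polyXn leqnn size_polyN.
    exact: leqW.
  move=> [+ _]; rewrite inE => sz; apply/eqP => g0; move: sz.
  by rewrite g0 sub0r size_polyN size_polyXn ltnn.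
pose d n := Num.sqrt (pform C (g n) (g n)).
exists (fun n => (d n)^-1 *: g n) => m n.
rewrite pformZl pformC// pformZl pformC//.
have [<-|mn] := eqVneq m n; last by rewrite gE// !mulr0.
have gg : pform C (g m) (g m) != 0 by apply: contra (gn0 m) => /eqP /Cdef ->.
rewrite mulrA -invfM -expr2 sqr_sqrtr// mulVf//.
Qed.

End Cholesky.

(** * The covariance kernel *)

Section Kernel.
Context {R : realType}.

Let fact_neq0 n : n`!%:R != 0 :> R.
Proof. by rewrite pnatr_eq0 -lt0n fact_gt0. Qed.

(** Dividing the kernel by i! j! removes the coefficients i and j from the right-hand side of the
    Lyapunov equation, as [kred_rec] shows. *)
Definition kred (i j : nat) : R :=
  \sum_(m < j.+1) m.+1%:R ^+ 2 / ((i + m.+2)`!%:R * (j - m)`!%:R).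

Lemma kcov_kred i j : kcov i.+1 j.+1 = i`!%:R * j`!%:R * kred i j.
Proof.
rewrite /kcov /kred mulr_sumr; apply: eq_bigr => m _.
rewrite subSS addSnnS !factS !natrM.
have h1 := fact_neq0 (i + m.+2); have h2 := fact_neq0 (j - m).
have h3 : i.+1%:R != 0 :> R by rewrite pnatr_eq0.
have h4 : j.+1%:R != 0 :> R by rewrite pnatr_eq0.
move: h1 h2 h3 h4.
move: ((i + m.+2)`!%:R) ((j - m)`!%:R) (i.+1%:R) (j.+1%:R) => a b c e h1 h2 h3 h4.
by field; rewrite h1 h2 h3 h4.
Qed.

(** In each summand i + 1 + j + 2 = (i + 1 + m + 2) + (j - m), and each part cancels the leading
    factor of one of the two factorials. The second sum loses its term m = j, which also covers
    [j = 0]. *)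
Lemma kred_rec i j :
  (i.+1 + j + 2)%:R * kred i.+1 j =
  kred i j + (if j is k.+1 then kred i.+1 k else 0).
Proof.
have E : (if j is k.+1 then kred i.+1 k else 0) =
    \sum_(m < j.+1) m.+1%:R ^+ 2 * (j - m)%:R / ((i.+1 + m.+2)`!%:R * (j - m)`!%:R).
  case: j => [|k]; first by rewrite big_ord_recl big_ord0 subnn mulr0 mul0r addr0.
  rewrite [RHS]big_ord_recr/= subnn mulr0 mul0r addr0; apply: eq_bigr => m _.
  have mk : (m <= k)%N by rewrite -ltnS.
  rewrite subSn// factS natrM.
  have h1 := fact_neq0 (i.+1 + m.+2); have h2 := fact_neq0 (k - m).
  have h3 : (k - m).+1%:R != 0 :> R by rewrite pnatr_eq0.
  move: h1 h2 h3; move: ((i.+1 + m.+2)`!%:R) ((k - m)`!%:R) ((k - m).+1%:R) => a b c h1 h2 h3.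
  by field; rewrite h1 h2 h3.
rewrite E /kred mulr_sumr -big_split/=; apply: eq_bigr => m _.
have mj : (m <= j)%N by rewrite -ltnS.
have -> : (i.+1 + j + 2)%:R = (i.+1 + m.+2)%:R + (j - m)%:R :> R.
  by rewrite -natrD; congr (_%:R); lia.
rewrite (addSn i m.+2) factS natrM.
have h1 := fact_neq0 (i + m.+2); have h2 := fact_neq0 (j - m).
have h3 : (i + m.+2).+1%:R != 0 :> R by rewrite pnatr_eq0.
move: h1 h2 h3; move: ((i + m.+2)`!%:R) ((j - m)`!%:R) ((i + m.+2).+1%:R) ((j - m)%:R).
move=> a b c e h1 h2 h3.
by field; rewrite h1 h2 h3.
Qed.

(** [kred] is not symmetric, as it comes from the formula for r >= s; this defect next to the
    diagonal is the source of the delta term in the Lyapunov equation. After an index shift the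
    terms differ by (2 m + 1) / ((i + m + 2)! (i + 1 - m)!) = [c m - c m.+1], and the sum
    telescopes. *)
Lemma kred_diag i : kred i i.+1 - kred i.+1 i = (i.+1`!%:R * i.+1`!%:R)^-1.
Proof.
pose c (m : nat) : R := if (m <= i.+1)%N then ((i.+1 + m)`!%:R * (i.+1 - m)`!%:R)^-1 else 0.
have c0 : c 0%N = (i.+1`!%:R * i.+1`!%:R)^-1 by rewrite /c /= addn0 subn0.
have cS : c i.+2 = 0 by rewrite /c ltnn.
have -> : (i.+1`!%:R * i.+1`!%:R)^-1 = c 0%N - c i.+2 by rewrite c0 cS subr0.
rewrite -[RHS]opprB -(telescope_sumr c (leq0n i.+2)) -sumrN big_mkord.
have -> : kred i.+1 i = \sum_(m < i.+2) m%:R ^+ 2 / ((i + m.+2)`!%:R * (i.+1 - m)`!%:R).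
  rewrite [RHS]big_ord_recl/= expr0n mul0r add0r; apply: eq_bigr => m _.
  by rewrite /bump /= add1n subSS addSnnS.
rewrite /kred -sumrB; apply: eq_bigr => m _.
have mi : (m <= i.+1)%N by rewrite -ltnS.
rewrite opprB /c mi.
have [mi'|mi'] := ltnP m i.+1.
  have [k ik] : exists k, i.+1 = (m + k.+1)%N by exists (i.+1 - m).-1; lia.
  have -> : (i.+1 - m)%N = k.+1 by lia.
  have -> : (i.+1 - m.+1)%N = k by lia.
  have -> : (i + m.+2)%N = (i.+1 + m).+1 by lia.
  have -> : (i.+1 + m.+1)%N = (i.+1 + m).+1 by lia.
  have EN : (i.+1 + m).+1%:R = m%:R + (m%:R + 1) + k.+1%:R :> R.
    by rewrite natr1 -!natrD; congr (_%:R); lia.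
  have h3 : m%:R + (m%:R + 1) + k.+1%:R != 0 :> R by rewrite -EN pnatr_eq0.
  have h1 := fact_neq0 (i.+1 + m); have h2 := fact_neq0 k.
  have h4 : k.+1%:R != 0 :> R by rewrite pnatr_eq0.
  have -> : m.+1%:R = m%:R + 1 :> R by rewrite natr1.
  move: h1 EN; move: (i.+1 + m)%N => N h1 EN.
  rewrite [N.+1`!]factS [k.+1`!]factS !natrM EN.
  move: h1 h2 h3 h4.
  move: (N`!%:R) (k`!%:R) (m%:R) (k.+1%:R) => a b M e h1 h2 h3 h4.
  by field; rewrite h1 h2 h3 h4.
have -> : (m : nat) = i.+1 by lia.
rewrite subnn fact0 mulr1 subr0.
have -> : (i + i.+3)%N = (i.+1 + i.+1).+1 by lia.
rewrite factS natrM.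
have h1 := fact_neq0 (i.+1 + i.+1).
have h3 : (i.+1 + i.+1).+1%:R != 0 :> R by rewrite pnatr_eq0.
have E : (i.+1 + i.+1).+1%:R = i.+2%:R + i.+1%:R :> R by rewrite -natrD; congr (_%:R); lia.
have E2 : i.+2%:R = i.+1%:R + 1 :> R by rewrite natr1.
move: h3; rewrite E E2; move: h1; move: ((i.+1 + i.+1)`!%:R) (i.+1%:R) => a b h1 h3.
by field; rewrite h1 h3.
Qed.

Definition kmat (i j : nat) : R := kcov (maxn i j).+1 (minn i j).+1.

Lemma kmatC i j : kmat i j = kmat j i.
Proof. by rewrite /kmat maxnC minnC. Qed.

Lemma kmat_ge i j : (j <= i)%N -> kmat i j = i`!%:R * j`!%:R * kred i j.
Proof. by move=> ji; rewrite /kmat (maxn_idPl ji) (minn_idPr ji) kcov_kred. Qed.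

(* Lyapunov equation of the linear SDE, index [i] standing for [zeta_(i+1)]. *)
Lemma kmat_lyapunov i j : (i.+1%:R + j.+1%:R) * kmat i j =
  i%:R * kmat i.-1 j + j%:R * kmat i j.-1 + (i == j)%:R.
Proof.
wlog ij : i j / (j <= i)%N.
  move=> H; have [/H//|/ltnW /H E] := leqP j i.
  by rewrite kmatC addrC E eq_sym [X in X + _]addrC (kmatC j) (kmatC j.-1).
have [ij'|ij'] := ltnP j i.
  case: i ij ij' => // i ij ij'.
  rewrite [i.+1.-1]/= (kmat_ge ij) (@kmat_ge i j ij') (gtn_eqF ij') mulr0n addr0.
  have -> : i.+2%:R + j.+1%:R = (i.+1 + j + 2)%:R :> R.
    by rewrite -natrD; congr (_%:R); lia.
  rewrite mulrCA kred_rec factS natrM mulrDr; congr (_ + _); first ring.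
  case: j {ij'} ij => [|j] ij; first by rewrite mulr0 mul0r.
  rewrite kmat_ge; last exact: ltnW.
  by rewrite /= !factS !natrM; ring.
have -> : i = j by lia.
rewrite eqxx (kmat_ge (leqnn j)).
case: j {ij ij'} => [|j].
  rewrite !mul0r add0r add0r /kred big_ord_recl big_ord0 /= fact0 expr1n addr0.
  by rewrite !mul1r mulr1 /= -(natrD _ 1 1) divff// pnatr_eq0.
rewrite (kmatC j.+1.-1) kmat_ge//=.
have -> : j.+2%:R + j.+2%:R = (j.+1 + j.+1 + 2)%:R :> R.
  by rewrite -natrD; congr (_%:R); lia.
rewrite mulrCA kred_rec.
have -> : kred j j.+1 = kred j.+1 j + (j.+1`!%:R * j.+1`!%:R)^-1.
  by rewrite -kred_diag addrC subrK.
have h := fact_neq0 j.+1; move: (h); rewrite factS natrM.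
have h1 := fact_neq0 j.
have h2 : j.+1%:R != 0 :> R by rewrite pnatr_eq0.
move: h1 h2; move: (j`!%:R) (j.+1%:R) (kred j.+1 j) => a b c h1 h2 _.
by field; rewrite h1 h2.
Qed.

(* A null vector [p] satisfies [\sum_i p`_i * kmat i j = 0] for all [j]; pairing the
   Lyapunov equation with [p] twice then leaves [\sum_i p`_i ^+ 2 = 0]. *)
Lemma kmat_definite : (forall p : {poly R}, 0 <= pform kmat p p) ->
  forall p, pform kmat p p = 0 -> p = 0.
Proof.
move=> K0 p p0.
have Kp j : \sum_(i < size p) p`_i * kmat i j = 0.
  have := @ip_null R _ (pform kmat) (fun x y => pformC x y kmatC) (@pformDl _ _)
    (@pformZl _ _) K0 p 'X^j p0.
  rewrite /pform size_polyXn; under eq_bigr.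
    move=> i _; rewrite (bigD1 ord_max)//= big1 ?addr0; last first.
      move=> k kj; rewrite coefXn.
      by rewrite (_ : (k == j :> nat) = false) ?mulr0 ?mul0r//; exact: negbTE kj.
    rewrite coefXn eqxx mulr1; over.
  by [].
have S : \sum_(i < size p) p`_i ^+ 2 = 0.
  have -> : \sum_(i < size p) p`_i ^+ 2 = \sum_(i < size p) \sum_(j < size p)
      p`_i * p`_j * ((i.+1%:R + j.+1%:R) * kmat i j -
        i%:R * kmat i.-1 j - j%:R * kmat i j.-1).
    apply: eq_bigr => i _; rewrite (bigD1 i)//= big1 ?addr0; last first.
      move=> j ji; rewrite kmat_lyapunov.
      rewrite (_ : (i == j :> nat) = false); last by rewrite eq_sym; exact: negbTE ji.
      by rewrite mulr0n; ring.
    by rewrite kmat_lyapunov eqxx mulr1n; ring.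
  have ex (F : nat -> R) (f : nat -> nat) :
      \sum_(i < size p) \sum_(j < size p) F j * (p`_i * kmat i (f j)) = 0.
    rewrite exchange_big/= big1// => j _.
    by rewrite -mulr_sumr Kp mulr0.
  transitivity (\sum_(i < size p) p`_i * i.+1%:R * (\sum_(j < size p) p`_j * kmat j i)
    + \sum_(i < size p) \sum_(j < size p) p`_j * j.+1%:R * (p`_i * kmat i (id j))
    - \sum_(i < size p) p`_i * i%:R * (\sum_(j < size p) p`_j * kmat j i.-1)
    - \sum_(i < size p) \sum_(j < size p) p`_j * j%:R * (p`_i * kmat i (predn j))).
    rewrite -big_split/= -!sumrB; apply: eq_bigr => i _.
    rewrite !mulr_sumr -big_split/= -!sumrB; apply: eq_bigr => j _.
    by rewrite (kmatC j i) (kmatC j i.-1); ring.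
  rewrite (ex (fun j => p`_j * j.+1%:R) id) (ex (fun j => p`_j * j%:R) predn).
  by rewrite !big1 ?subr0 ?addr0// => i _; rewrite Kp mulr0.
apply/polyP => i; rewrite coef0; have [ip|] := ltnP i (size p); last exact: nth_default.
have := @psumr_eq0P R 'I_(size p) xpredT (fun i => p`_i ^+ 2).
move=> /(_ (fun i _ => sqr_ge0 _) S (Ordinal ip) isT) /eqP.
by rewrite sqrf_eq0 => /eqP.
Qed.

End Kernel.

(** * Asymptotics of the covariances *)

Section Asymptotics.
Context {R : realType}.
Notation mu := (@lebesgue_measure R).
Notation pos := (`[(0:R), +oo[%classic).

Definition climit (t : R) : R :=
  (\int[mu]_(y in pos) (y ^+ 2 * expR (- y ^+ 2 - t * y)))%R.

Lemma integrable_sqr_gauss (s : R) : 0 < s ->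
  mu.-integrable setT (fun y => (y ^+ 2 * expR (- (s * y ^+ 2)))%:E) /\
  mu.-integrable setT (fun y => (expR (- (s * y ^+ 2)))%:E).
Proof.
move=> s0; pose v := Num.sqrt (2 * s)^-1.
have v0 : 0 < v by rewrite sqrtr_gt0 invr_gt0 mulr_gt0.
have vn0 : v != 0 by rewrite gt_eqF.
have v2 : v ^+ 2 = (2 * s)^-1 by rewrite sqr_sqrtr// invr_ge0 mulr_ge0// ltW.
have pE y : normal_pdf 0 v y = normal_peak v * expR (- (s * y ^+ 2)).
  rewrite normal_pdfE// /normal_fun subr0; congr (_ * expR _).
  by rewrite v2 mulr2n; field; rewrite gt_eqF.
have p0 := normal_peak_gt0 vn0.
have mT : measurable ([set: R] : set (measurableTypeR R)) by exact: measurableT.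
have i0 := integrableZl mT (normal_peak v)^-1 (integrable_normal_pdf 0 v).
have i2 := integrableZl mT (normal_peak v)^-1 (integrable_sqr_normal_pdf 0 vn0).
split.
  rewrite (_ : (fun y => _) = (fun y => (normal_peak v)^-1%:E *
    ((y - 0) ^+ 2 * normal_pdf 0 v y)%:E)%E)//.
  apply/funext => y; rewrite -EFinM pE subr0; congr (_%:E).
  by field; rewrite gt_eqF.
rewrite (_ : (fun y => _) = (fun y => (normal_peak v)^-1%:E * (normal_pdf 0 v y)%:E)%E)//.
apply/funext => y; rewrite -EFinM pE; congr (_%:E).
by field; rewrite gt_eqF.
Qed.

Lemma measurable_climit_fun (n : nat) (t : R) (D : set R) :
  measurable_fun D (fun y => y ^+ n * expR (- y ^+ 2 - t * y)).
Proof.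
apply: measurable_funTS; apply: continuous_measurable_fun => x.
apply: cvgM; first exact: exprn_continuous.
apply: (@continuous_comp _ _ _ (fun y : R => - y ^+ 2 - t * y) expR); last first.
  exact: continuous_expR.
apply: cvgB; first by apply: cvgN; exact: exprn_continuous.
by apply: cvgMr; exact: cvg_id.
Qed.

(** Half of the Gaussian factor absorbs one power of y; the other half, with y^n <= y^2 + 1, gives
    the dominating function. The case n = 1 is the covariance, n = 2 the Lipschitz constant
    below. *)
Lemma integrable_climit (n : nat) (t : R) : (n <= 2)%N -> 0 <= t ->
  mu.-integrable pos (fun y => (y ^+ n.+1 * expR (- y ^+ 2 - t * y))%:E).
Proof.
move=> n2 t0.
have mpos : measurable (pos : set (measurableTypeR R)) by exact: measurable_itv.
have [j2 j0] := @integrable_sqr_gauss (2^-1) (ltac:(by rewrite invr_gt0)).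
have i2 := integrableS measurableT mpos (@subsetT _ _) j2.
have i0 := integrableS measurableT mpos (@subsetT _ _) j0.
have := integrableD mpos i2 i0; apply: le_integrable => //.
  by apply/measurable_EFinP; exact: (@measurable_climit_fun n.+1 t pos).
move=> y /=; rewrite in_itv/= andbT => y0.
rewrite lee_fin !ger0_norm; last 2 first.
- by rewrite addr_ge0 ?mulr_ge0 ?sqr_ge0 ?expR_ge0.
- by rewrite mulr_ge0 ?exprn_ge0 ?expR_ge0.
have -> : - y ^+ 2 - t * y = - (2^-1 * y ^+ 2) + (- (2^-1 * y ^+ 2) - t * y) by field.
rewrite expRD.
have ty : 0 <= t * y by rewrite mulr_ge0.
have h1 : expR (- (2^-1 * y ^+ 2) - t * y) <= expR (- (2^-1 * y ^+ 2)) by rewrite ler_expR; lra.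
have h2 : y * expR (- (2^-1 * y ^+ 2)) <= 1.
  rewrite expRN ler_pdivrMr ?expR_gt0// mul1r.
  apply: le_trans (expR_ge1Dx _); have := sqr_ge0 (y - 1); nra.
have h3 : y ^+ n <= y ^+ 2 + 1.
  case: n n2 => [|[|[|//]]] _; rewrite ?expr0 ?expr1; have := sqr_ge0 (y - 1); nra.
have yn : 0 <= y ^+ n by rewrite exprn_ge0.
have e0 := expR_gt0 (- (2^-1 * y ^+ 2)).
have e1 := expR_gt0 (- (2^-1 * y ^+ 2) - t * y).
move: (expR (- (2^-1 * y ^+ 2) - t * y)) (expR (- (2^-1 * y ^+ 2))) h1 h2 e0 e1.
move=> a b h1 h2 b0 a0.
have ya1 : y * a <= 1 by nra.
have ya0 : 0 <= y * a by rewrite mulr_ge0// ltW.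
have -> : y ^+ n.+1 * (b * a) = b * (y ^+ n * (y * a)) by rewrite exprS; ring.
have -> : y ^+ 2 * b + b = b * ((y ^+ 2 + 1) * 1) by ring.
by rewrite ler_pM2l// ler_pM.
Qed.

Lemma climit_EFin (t : R) : 0 <= t ->
  (climit t)%:E = (\int[mu]_(y in pos) (y ^+ 2 * expR (- y ^+ 2 - t * y))%:E)%E.
Proof.
move=> t0; rewrite /climit fineK//; apply: integrable_fin_num.
  exact: measurable_itv.
exact: (@integrable_climit 1).
Qed.

Lemma climit_lipschitz : exists2 K : R, 0 <= K &
  forall s t, 0 <= s -> 0 <= t -> `|climit s - climit t| <= K * `|s - t|.
Proof.
(* The integral of y^3 e^(- y^2), because |e^(- s y) - e^(- t y)| <= |s - t| y; the term [0 * y]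
   matches the form of [integrable_climit]. *)
pose K := (\int[mu]_(y in pos) (y ^+ 3 * expR (- y ^+ 2 - 0 * y)))%R.
have mpos : measurable (pos : set (measurableTypeR R)) by exact: measurable_itv.
have K0 : 0 <= K.
  apply: Rintegral_ge0 => y /=; rewrite in_itv/= andbT => y0.
  by rewrite mulr_ge0 ?exprn_ge0 ?expR_ge0.
exists K => // s t; wlog st : s t / s <= t.
  move=> H s0 t0; have [st|ts] := leP s t; first exact: H.
  by rewrite distrC [X in K * X]distrC; apply: H => //; exact: ltW.
move=> s0 t0.
have is1 := @integrable_climit 1 s isT s0; have it1 := @integrable_climit 1 t isT t0.
have ik := @integrable_climit 2 0 isT (lexx 0).
rewrite /climit -RintegralB//.
have iB := integrableB mpos is1 it1.
rewrite (le_trans (le_normr_Rintegral _ _))//.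
have -> : K * `|s - t| = (\int[mu]_(y in pos) (`|s - t| * (y ^+ 3 * expR (- y ^+ 2 - 0 * y))))%R.
  by rewrite RintegralZl// mulrC.
apply: le_Rintegral => //.
- exact: (integrable_abse iB).
- exact: (integrableZl mpos `|s - t| ik).
move=> y /=; rewrite in_itv/= andbT => y0.
have -> : expR (- y ^+ 2 - t * y) = expR (- y ^+ 2 - s * y) * expR (- ((t - s) * y)).
  by rewrite -expRD; congr expR; ring.
rewrite -mulrBr -{1}[expR (- y ^+ 2 - s * y)]mulr1 -mulrBr.
rewrite normrM (ger0_norm (sqr_ge0 _)) [`|s - t|]distrC (ger0_norm (_ : 0 <= t - s)) ?subr_ge0//.
rewrite normrM (ger0_norm (expR_ge0 _)).
have ts0 : 0 <= (t - s) * y by rewrite mulr_ge0// subr_ge0.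
have b1 : `|1 - expR (- ((t - s) * y))| <= (t - s) * y.
  have h := expR_ge1Dx (- ((t - s) * y)).
  have h' : expR (- ((t - s) * y)) <= 1 by rewrite -[leRHS]expR0 ler_expR; lra.
  by rewrite ger0_norm; lra.
have b2 : expR (- y ^+ 2 - s * y) <= expR (- y ^+ 2 - 0 * y).
  by rewrite ler_expR; have := mulr_ge0 s0 y0; lra.
have -> : (t - s) * (y ^+ 3 * expR (- y ^+ 2 - 0 * y)) =
  y ^+ 2 * (expR (- y ^+ 2 - 0 * y) * ((t - s) * y)) by ring.
by rewrite ler_wpM2l ?sqr_ge0// ler_pM ?expR_ge0.
Qed.


Definition fratio (r s m : nat) : R :=
  r`!%:R * s`!%:R / ((r + m)`!%:R * (s - m)`!%:R).

Let fact_neq0 n : n`!%:R != 0 :> R.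
Proof. by rewrite pnatr_eq0 -lt0n fact_gt0. Qed.

Lemma fratio0 r s : fratio r s 0 = 1.
Proof. by rewrite /fratio addn0 subn0 divff// mulf_neq0. Qed.

Lemma fratioS r s m : (m < s)%N ->
  fratio r s m.+1 = fratio r s m * ((s%:R - m%:R) / (r%:R + m.+1%:R)).
Proof.
move=> ms; rewrite /fratio addnS factS.
have [k sk] : exists k, s = (m + k.+1)%N by exists (s - m).-1; lia.
have -> : (s - m.+1)%N = k by lia.
have -> : (s - m)%N = k.+1 by lia.
have -> : s%:R - m%:R = k.+1%:R :> R by rewrite sk natrD addrAC subrr add0r.
rewrite [k.+1`!]factS !natrM -natrD addnS.
have h1 := fact_neq0 (r + m); have h2 := fact_neq0 k.
have h3 : (r + m).+1%:R != 0 :> R by rewrite pnatr_eq0.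
have h4 : k.+1%:R != 0 :> R by rewrite pnatr_eq0.
move: h1 h2 h3 h4.
move: ((r + m)`!%:R) (k`!%:R) ((r + m).+1%:R) (k.+1%:R) => a b c e h1 h2 h3 h4.
by field; rewrite h1 h2 h3 h4.
Qed.

(** [fratio r s m] is the product over j < m of (s - j) / (r + j + 1) = 1 - (r - s + 2 j + 1) / (r +
    j + 1); the numerators r - s + 2 j + 1 add up to [fexp r s m]. *)
Definition fexp (r s m : nat) : R := m%:R * (r%:R - s%:R) + m%:R ^+ 2.

Lemma fexpS r s m : fexp r s m.+1 = fexp r s m + (r%:R - s%:R + 2 * m%:R + 1).
Proof. by rewrite /fexp -natr1; ring. Qed.

Lemma fratio_gt0 r s m : 0 < fratio r s m.
Proof. by rewrite /fratio divr_gt0// mulr_gt0// ltr0n fact_gt0. Qed.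

(** 1 - x <= e^(- x) in every factor, with the denominators r + j + 1 raised to the common value r +
    M; this is why M stays fixed in the induction on m. *)
Lemma fratio_ub r s M : (0 < r)%N -> (s <= r)%N -> (M <= s)%N ->
  fratio r s M <= expR (- (fexp r s M / (r%:R + M%:R))).
Proof.
move=> r0 sr Ms.
have rM : 0 < r%:R + M%:R :> R by rewrite -natrD ltr0n addn_gt0 r0.
have srR : s%:R <= r%:R :> R by rewrite ler_nat.
suff H m : (m <= M)%N -> fratio r s m <= expR (- (fexp r s m / (r%:R + M%:R))) by exact: H.
elim: m => [|m IH] mM.
  by rewrite fratio0 /fexp mul0r expr0n addr0 mul0r oppr0 expR0.
rewrite fratioS; last exact: leq_trans mM Ms.
have -> : - (fexp r s m.+1 / (r%:R + M%:R)) = - (fexp r s m / (r%:R + M%:R)) +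
    - ((r%:R - s%:R + 2 * m%:R + 1) / (r%:R + M%:R)) by rewrite fexpS mulrDl opprD.
rewrite expRD.
have mMR : m.+1%:R <= M%:R :> R by rewrite ler_nat.
have m0 : 0 <= m%:R :> R by [].
have msR : m.+1%:R <= s%:R :> R by rewrite ler_nat (leq_trans mM Ms).
have mS : m.+1%:R = m%:R + 1 :> R by rewrite natr1.
apply: ler_pM.
- exact: ltW (fratio_gt0 _ _ _).
- by rewrite divr_ge0//; lra.
- by apply: IH; exact: ltnW.
apply: le_trans (expR_ge1Dx _).
have rm : 0 < r%:R + m.+1%:R :> R by lra.
rewrite ler_pdivrMr//.
have h : (r%:R - s%:R + 2 * m%:R + 1) / (r%:R + M%:R) * (r%:R + m.+1%:R) <=
    r%:R - s%:R + 2 * m%:R + 1 :> R.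
  rewrite mulrAC ler_pdivrMr// ler_wpM2l//; lra.
by rewrite mulrDl mul1r mulNr; lra.
Qed.

(** The same for the inverse factors: (r + j + 1) / (s - j) = 1 + x <= e^x with x = (r - s + 2 j +
    1) / (s - j), whose denominator is lowered to s - M. *)
Lemma fratio_lb r s M : (s <= r)%N -> (M < s)%N ->
  expR (- (fexp r s M / (s%:R - M%:R))) <= fratio r s M.
Proof.
move=> sr Ms.
have sM : 0 < s%:R - M%:R :> R by rewrite subr_gt0 ltr_nat.
have srR : s%:R <= r%:R :> R by rewrite ler_nat.
suff H m : (m <= M)%N -> expR (- (fexp r s m / (s%:R - M%:R))) <= fratio r s m by exact: H.
elim: m => [|m IH] mM.
  by rewrite fratio0 /fexp mul0r expr0n addr0 mul0r oppr0 expR0.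
rewrite fratioS; last exact: ltn_trans mM Ms.
have -> : - (fexp r s m.+1 / (s%:R - M%:R)) = - (fexp r s m / (s%:R - M%:R)) +
    - ((r%:R - s%:R + 2 * m%:R + 1) / (s%:R - M%:R)) by rewrite fexpS mulrDl opprD.
rewrite expRD.
have mMR : m.+1%:R <= M%:R :> R by rewrite ler_nat.
have m0 : 0 <= m%:R :> R by [].
have mS : m.+1%:R = m%:R + 1 :> R by rewrite natr1.
apply: ler_pM; rewrite ?expR_ge0//.
  by apply: IH; exact: ltnW.
have sm : 0 < s%:R - m%:R :> R by lra.
have rm : 0 < r%:R + m.+1%:R :> R by lra.
rewrite expRN -[leRHS]invrK lef_pV2 ?posrE ?expR_gt0 ?invr_gt0 ?divr_gt0//.
rewrite invf_div; apply: le_trans (expR_ge1Dx _).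
rewrite ler_pdivrMr//.
have h : r%:R - s%:R + 2 * m%:R + 1 <=
   (r%:R - s%:R + 2 * m%:R + 1) / (s%:R - M%:R) * (s%:R - m%:R) :> R.
  rewrite mulrAC ler_pdivlMr// ler_wpM2l//; lra.
by rewrite mulrDl mul1r; lra.
Qed.

End Asymptotics.

(** * Riemann sums and dominated convergence *)

Section RiemannSums.
Context {R : realType}.
Notation mu := (@lebesgue_measure R).
Notation pos := (`[(0:R), +oo[%classic).

(* [sqrt T * kcov r s] is the integral of this step function of mesh [1 / sqrt T]. *)
Definition step_density (T : R) (r s : nat) (y : R) : R :=
  let m := Num.truncn (y * Num.sqrt T) in
  if (m < s)%N then T * (m.+1%:R ^+ 2 / (r%:R * s%:R) * fratio r s m.+1) else 0.

Let cell (T : R) (m : nat) : set R :=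
  `[m%:R / Num.sqrt T, m.+1%:R / Num.sqrt T[%classic.

Let cellP T m y : 0 < T -> 0 <= y ->
  (y \in cell T m) = (Num.truncn (y * Num.sqrt T) == m).
Proof.
move=> T0 y0; have sT : 0 < Num.sqrt T by rewrite sqrtr_gt0.
rewrite truncn_eq; last by rewrite mulr_ge0// ltW.
rewrite /cell.
rewrite -ler_pdivrMr// -ltr_pdivlMr//.
by apply/idP/idP; rewrite inE /= in_itv.
Qed.

Let step_density_cells T r s y : 0 < T -> 0 <= y -> step_density T r s y =
  \sum_(m < s) T * (m.+1%:R ^+ 2 / (r%:R * s%:R) * fratio r s m.+1) * \1_(cell T m) y.
Proof.
move=> T0 y0; rewrite /step_density; set n := Num.truncn _.
have [ns|sn] := ltnP n s.
  rewrite (bigD1 (Ordinal ns))//= big1 ?addr0.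
    by rewrite indicE cellP// eqxx mulr1.
  move=> m mn; rewrite indicE cellP//.
  by rewrite (_ : (_ == _) = false) ?mulr0//; apply/negbTE; rewrite eq_sym; exact: mn.
rewrite big1// => m _; rewrite indicE cellP// (_ : (_ == _) = false) ?mulr0//.
by apply/negbTE; rewrite neq_ltn (leq_trans (ltn_ord m) sn) orbT.
Qed.

Let measurable_cell T m : measurable (cell T m : set (measurableTypeR R)).
Proof. exact: measurable_itv. Qed.

Lemma measurable_step_density T r s : 0 < T ->
  measurable_fun (pos : set (measurableTypeR R)) (step_density T r s).
Proof.
move=> T0; apply: (eq_measurable_fun (fun y => \sum_(m < s)
  T * (m.+1%:R ^+ 2 / (r%:R * s%:R) * fratio r s m.+1) * \1_(cell T m) y)).
  by move=> y; rewrite inE /= in_itv/= andbT => y0; rewrite step_density_cells.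
apply: measurable_sum => m; apply: measurable_funM => //.
by apply: measurable_funTS; apply: measurable_indic; exact: measurable_cell.
Qed.

Lemma Rintegral_step_density T r s : 0 < T ->
  (\int[mu]_(y in pos) step_density T r s y)%R = Num.sqrt T * kcov r s.
Proof.
move=> T0; have sT : 0 < Num.sqrt T by rewrite sqrtr_gt0.
have mpos : measurable (pos : set (measurableTypeR R)) by exact: measurable_itv.
have c0 m : 0 <= T * (m.+1%:R ^+ 2 / (r%:R * s%:R) * fratio r s m.+1).
  by rewrite mulr_ge0 ?(ltW T0)// mulr_ge0 ?divr_ge0 ?exprn_ge0// ltW// fratio_gt0.
rewrite /Rintegral.
transitivity (fine (\int[mu]_(y in pos) \sum_(m < s)
    ((T * (m.+1%:R ^+ 2 / (r%:R * s%:R) * fratio r s m.+1))%:E * (\1_(cell T m) y)%:E))).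
  congr fine; apply: eq_integral => y; rewrite inE /= in_itv/= andbT => y0.
  by rewrite step_density_cells// -sumEFin; apply: eq_bigr => m _; rewrite EFinM.
have mi (c : R) m : measurable_fun (pos : set (measurableTypeR R))
    (fun y => (c%:E * (\1_(cell T m) y)%:E)%E).
  apply: (@eq_measurable_fun _ _ _ _ _ (fun y => (c * \1_(cell T m) y)%:E)) => [y _|].
    by rewrite EFinM.
  apply/measurable_EFinP; apply: measurable_funM => //.
  by apply: measurable_funTS; apply: measurable_indic; exact: measurable_cell.
rewrite ge0_integral_sum//; last first.
  by move=> m y _; rewrite -EFinM lee_fin mulr_ge0.
have E m : (\int[mu]_(y in pos) ((T * (m.+1%:R ^+ 2 / (r%:R * s%:R) * fratio r s m.+1))%:E
     * (\1_(cell T m) y)%:E) =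
    (Num.sqrt T * (m.+1%:R ^+ 2 / (r%:R * s%:R) * fratio r s m.+1))%:E)%E.
  rewrite ge0_integralZl//; last 2 first.
  - apply/measurable_EFinP; apply: measurable_funTS; apply: measurable_indic.
    exact: measurable_cell.
  - by rewrite lee_fin.
  rewrite integral_indic//.
  have -> : cell T m `&` pos = cell T m.
    apply/setIidPl => y; rewrite /cell /= !in_itv/= andbT => /andP[+ _].
    by apply: le_trans; rewrite divr_ge0// ltW.
  have mc : mu (cell T m) = (m.+1%:R / Num.sqrt T - m%:R / Num.sqrt T)%:E.
    rewrite /cell lebesgue_measure_itv/= lte_fin ltr_pM2r ?invr_gt0// ltr_nat ltnSn.
    by rewrite -EFinB.
  rewrite [X in (_ * X)%E]mc -EFinM; congr (_%:E).
  have TE : T = Num.sqrt T * Num.sqrt T by rewrite -expr2 sqr_sqrtr// ltW.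
  rewrite {1}TE -natr1.
  move: sT; move: (Num.sqrt T) (_ * fratio r s m.+1) => t f t0.
  by field; rewrite gt_eqF.
under eq_bigr do rewrite E.
by rewrite sumEFin /= /kcov mulr_sumr.
Qed.


(** Put M = m + 1, so that y sqrt T <= M <= (y + 1) sqrt T. Since r + M <= 4 T, [fratio_ub] gives
    the exponent - y^2 / 4; since T^2 <= 4 r s, the prefactor is at most 4 (y + 1)^2 <= 8 y^2 +
    8. *)
Lemma step_density_ub T r s y : 1 <= T -> (0 < s)%N -> (s <= r)%N ->
  T <= 2 * s%:R -> r%:R <= 2 * T -> 0 <= y ->
  `|step_density T r s y| <=
  8 * (y ^+ 2 * expR (- (4^-1 * y ^+ 2))) + 8 * expR (- (4^-1 * y ^+ 2)).
Proof.
move=> T1 s0 sr Ts rT y0; rewrite /step_density; set m := Num.truncn _.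
have T0 : 0 < T by lra.
set t := Num.sqrt T; have t0 : 0 < t by rewrite sqrtr_gt0.
have TE : T = t ^+ 2 by rewrite sqr_sqrtr// ltW.
have t1 : 1 <= t by rewrite -sqrtr1 ler_wsqrtr.
case: ifPn => [ms|_]; last first.
  by rewrite normr0 addr_ge0// mulr_ge0 ?mulr_ge0 ?sqr_ge0 ?expR_ge0.
set M : R := m.+1%:R.
have M0 : 0 <= M by [].
have /andP[Ml Mu] : m%:R <= y * t < M by apply: truncn_itv; rewrite mulr_ge0// ltW.
have ME : M = m%:R + 1 by rewrite /M natr1.
have s0R : 0 < s%:R :> R by rewrite ltr0n.
have srR : s%:R <= r%:R :> R by rewrite ler_nat.
have MsR : M <= s%:R :> R by rewrite ler_nat.
have r0 : (0 < r)%N by exact: leq_trans s0 sr.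
have f1 : fratio r s m.+1 <= expR (- (4^-1 * y ^+ 2)).
  apply: le_trans (fratio_ub r0 sr ms) _; rewrite ler_expR lerN2.
  rewrite ler_pdivlMr; last by lra.
  have -> : fexp r s m.+1 = M * (r%:R - s%:R) + M ^+ 2 by [].
  have h1 : y ^+ 2 * T <= M ^+ 2.
    by rewrite TE -exprMn lerXn2r ?nnegrE ?mulr_ge0// ltW.
  have h2 : 0 <= M * (r%:R - s%:R) by rewrite mulr_ge0// subr_ge0.
  have h3 : y ^+ 2 * (r%:R + M) <= y ^+ 2 * (4 * T) by rewrite ler_wpM2l ?sqr_ge0//; lra.
  lra.
have f0 := fratio_gt0 (R := R) r s m.+1.
have f2 : T * (M ^+ 2 / (r%:R * s%:R)) <= 8 * y ^+ 2 + 8.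
  have rs : 0 < r%:R * s%:R :> R by rewrite mulr_gt0//; lra.
  rewrite mulrA ler_pdivrMr//.
  have h1 : M ^+ 2 <= T * (y + 1) ^+ 2.
    have h : M <= t * (y + 1) by rewrite mulrDr mulr1; lra.
    by rewrite TE -exprMn lerXn2r// nnegrE mulr_ge0//; lra.
  have h2 : T ^+ 2 <= 4 * (r%:R * s%:R).
    have : T * T <= (2 * r%:R) * (2 * s%:R) by rewrite ler_pM//; lra.
    by rewrite expr2; lra.
  have h3 : (y + 1) ^+ 2 <= 2 * y ^+ 2 + 2 by have := sqr_ge0 (y - 1); nra.
  apply: (@le_trans _ _ (T ^+ 2 * (y + 1) ^+ 2)).
    by rewrite expr2 -mulrA ler_pM2l.
  apply: (@le_trans _ _ (4 * (r%:R * s%:R) * (2 * y ^+ 2 + 2)));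
    last by rewrite le_eqVlt; apply/orP; left; apply/eqP; ring.
  by rewrite ler_pM ?sqr_ge0.
have f3 : 0 <= T * (M ^+ 2 / (r%:R * s%:R)).
  by rewrite mulr_ge0 ?(ltW T0)// divr_ge0 ?sqr_ge0.
rewrite [T * (_ * fratio _ _ _)]mulrA ger0_norm; last exact: mulr_ge0 f3 (ltW f0).
have -> : 8 * (y ^+ 2 * expR (- (4^-1 * y ^+ 2))) + 8 * expR (- (4^-1 * y ^+ 2)) =
  (8 * y ^+ 2 + 8) * expR (- (4^-1 * y ^+ 2)) by ring.
by rewrite ler_pM// ltW.
Qed.

(** In the variables al = (r - T) / sqrt T, be = (s - T) / sqrt T and x = (m + 1) / sqrt T, the
    exponent [fexp] is exactly T (x (al - be) + x^2), while the denominators r + m + 1 and s - m - 1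
    of the two bounds on [fratio] are both T (1 + o(1)). *)
Lemma step_density_cvg (T : R ^nat) (r s : nat -> nat) (a b y : R) :
  (forall k, 1 <= T k) -> T @ \oo --> +oo ->
  (forall k, 0 < s k)%N -> (forall k, s k <= r k)%N ->
  ((r k)%:R - T k) / Num.sqrt (T k) @[k --> \oo] --> a ->
  ((s k)%:R - T k) / Num.sqrt (T k) @[k --> \oo] --> b ->
  0 <= y ->
  step_density (T k) (r k) (s k) y @[k --> \oo] -->
    y ^+ 2 * expR (- y ^+ 2 - (a - b) * y).
Proof.
move=> T1 Ty s0 sr ra sb y0.
pose t k := Num.sqrt (T k).
have T0 k : 0 < T k by have := T1 k; lra.
have t0 k : 0 < t k by rewrite sqrtr_gt0.
have tn k : t k != 0 by rewrite gt_eqF.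
have TE k : T k = t k ^+ 2 by rewrite sqr_sqrtr// ltW.
have tV : (t k)^-1 @[k --> \oo] --> (0 : R).
  apply/cvgrPdist_lt => e e0; near=> k.
  rewrite sub0r normrN ger0_norm ?invr_ge0 ?(ltW (t0 k))//.
  rewrite invf_plt ?posrE//.
  have -> : e^-1 = Num.sqrt (e^-1 ^+ 2) by rewrite sqrtr_sqr ger0_norm// invr_ge0 ltW.
  rewrite ltr_sqrt//; near: k.
  by move/cvgryPgt : Ty; apply.
pose m k := Num.truncn (y * t k).
pose x k := (m k).+1%:R / t k.
have xy : x k @[k --> \oo] --> y.
  have h : y + (t k)^-1 @[k --> \oo] --> y.
    by rewrite -[X in _ --> X]addr0; apply: cvgD tV; exact: cvg_cst.
  apply: (squeeze_cvgr _ (cvg_cst y) h); apply: nearW => k.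
  have /andP[Ml Mu] : (m k)%:R <= y * t k < (m k).+1%:R.
    by apply: truncn_itv; rewrite mulr_ge0// ltW.
  rewrite /x ler_pdivlMr// (ltW Mu) /= ler_pdivrMr// mulrDl mulVf//.
  by rewrite -natr1 lerD2r.
pose al k := ((r k)%:R - T k) / t k.
pose be k := ((s k)%:R - T k) / t k.
have rT : 1 + al k * (t k)^-1 @[k --> \oo] --> (1 : R).
  rewrite -[X in _ --> X]addr0 -(mulr0 a); apply: cvgD; first exact: cvg_cst.
  exact: cvgM.
have sT : 1 + be k * (t k)^-1 @[k --> \oo] --> (1 : R).
  rewrite -[X in _ --> X]addr0 -(mulr0 b); apply: cvgD; first exact: cvg_cst.
  exact: cvgM.
have mT : x k * (t k)^-1 @[k --> \oo] --> (0 : R).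
  by rewrite -(mulr0 y); exact: cvgM.
have rE k : (r k)%:R = (1 + al k * (t k)^-1) * t k ^+ 2.
  by rewrite /al -TE; move: (TE k) (tn k); move: (t k) => u -> u0; field.
have sE k : (s k)%:R = (1 + be k * (t k)^-1) * t k ^+ 2.
  by rewrite /be; move: (TE k) (tn k); move: (t k) => u -> u0; field.
have mE k : (m k).+1%:R = x k * t k by rewrite /x divfK.
pose L k := x k * (al k - be k) + x k ^+ 2.
have LE k : fexp (r k) (s k) (m k).+1 = L k * t k ^+ 2.
  rewrite /fexp mE rE sE /L; move: (tn k) => u0.
  by field.
have cL : L k @[k --> \oo] --> y * (a - b) + y ^+ 2.
  apply: cvgD; first by apply: cvgM => //; exact: cvgB.
  by under eq_fun do rewrite expr2; rewrite expr2; exact: cvgM.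
have cub : expR (- (L k / (1 + al k * (t k)^-1 + x k * (t k)^-1))) @[k --> \oo] -->
    expR (- y ^+ 2 - (a - b) * y).
  have -> : - y ^+ 2 - (a - b) * y = - ((y * (a - b) + y ^+ 2) / (1 + 0)).
    by rewrite addr0 divr1; ring.
  apply: (@cvg_comp _ _ _ _ expR); last exact: continuous_expR.
  apply: cvgN; apply: cvgM => //; apply: cvgV; first by rewrite addr0 oner_eq0.
  exact: cvgD.
have clb : expR (- (L k / (1 + be k * (t k)^-1 - x k * (t k)^-1))) @[k --> \oo] -->
    expR (- y ^+ 2 - (a - b) * y).
  have -> : - y ^+ 2 - (a - b) * y = - ((y * (a - b) + y ^+ 2) / (1 - 0)).
    by rewrite subr0 divr1; ring.
  apply: (@cvg_comp _ _ _ _ expR); last exact: continuous_expR.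
  apply: cvgN; apply: cvgM => //; apply: cvgV; first by rewrite subr0 oner_eq0.
  exact: cvgB.
have ms : \forall k \near \oo, ((m k).+1 < s k)%N.
  have h : 1 + be k * (t k)^-1 - x k * (t k)^-1 @[k --> \oo] --> (1 - 0 : R).
    exact: cvgB.
  have : \forall k \near \oo, 0 < 1 + be k * (t k)^-1 - x k * (t k)^-1.
    by apply: cvgr_gt h _ _; rewrite subr0.
  apply: filterS => k hk; rewrite -(ltr_nat R) mE sE -subr_gt0.
  have -> : (1 + be k / t k) * t k ^+ 2 - x k * t k =
    (1 + be k / t k - x k / t k) * t k ^+ 2 by move: (tn k) => u0; field.
  by rewrite mulr_gt0// exprn_gt0.
have cf : fratio (r k) (s k) (m k).+1 @[k --> \oo] --> expR (- y ^+ 2 - (a - b) * y).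
  apply: (squeeze_cvgr _ clb cub); apply: filterS ms => k msk.
  have e1 : L k / (1 + be k / t k - x k / t k) =
      fexp (r k) (s k) (m k).+1 / ((s k)%:R - (m k).+1%:R).
    rewrite LE sE mE.
    have -> : (1 + be k / t k) * t k ^+ 2 - x k * t k =
      (1 + be k / t k - x k / t k) * t k ^+ 2 by move: (tn k) => u0; field.
    by rewrite -mulf_div divff ?mulr1// expf_neq0.
  have e2 : L k / (1 + al k / t k + x k / t k) =
      fexp (r k) (s k) (m k).+1 / ((r k)%:R + (m k).+1%:R).
    rewrite LE rE mE.
    have -> : (1 + al k / t k) * t k ^+ 2 + x k * t k =
      (1 + al k / t k + x k / t k) * t k ^+ 2 by move: (tn k) => u0; field.
    by rewrite -mulf_div divff ?mulr1// expf_neq0.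
  rewrite e1 e2 fratio_lb// fratio_ub//; first exact: leq_trans (s0 k) (sr k).
  exact: ltnW.
have cp : x k ^+ 2 / ((1 + al k * (t k)^-1) * (1 + be k * (t k)^-1)) @[k --> \oo] --> y ^+ 2.
  rewrite -[y ^+ 2]divr1 -[X in _ / X]mulr1; apply: cvgM.
    by under eq_fun do rewrite expr2; rewrite expr2; exact: cvgM.
  apply: cvgV; first by rewrite mulr1 oner_eq0.
  exact: cvgM.
apply: (cvg_trans _ (cvgM cp cf)); apply: near_eq_cvg.
apply: filterS ms => k msk.
rewrite /step_density -/(t k) -/(m k) (ltnW msk) mulrA; congr (_ * _).
have rn : (r k)%:R != 0 :> R by rewrite pnatr_eq0 -lt0n (leq_trans (s0 k) (sr k)).
have sn : (s k)%:R != 0 :> R by rewrite pnatr_eq0 -lt0n s0.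
move: rn sn; rewrite rE sE mE TE.
rewrite !mulf_eq0 !negb_or => /andP[rn _] /andP[sn _].
move: rn sn (tn k).
move: (t k) (1 + al k / t k) (1 + be k / t k) (x k) => u p q z p0 q0 u0.
by field; rewrite p0 q0 u0.
Unshelve. all: end_near. Qed.

Lemma kcov_asymptotics_bounded (T : R ^nat) (r s : nat -> nat) (a b : R) :
  (forall k, 1 <= T k) -> T @ \oo --> +oo ->
  (forall k, 0 < s k)%N -> (forall k, s k <= r k)%N ->
  (forall k, T k <= 2 * (s k)%:R) -> (forall k, (r k)%:R <= 2 * T k) ->
  ((r k)%:R - T k) / Num.sqrt (T k) @[k --> \oo] --> a ->
  ((s k)%:R - T k) / Num.sqrt (T k) @[k --> \oo] --> b ->
  Num.sqrt (T k) * kcov (r k) (s k) @[k --> \oo] --> climit (a - b).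
Proof.
move=> T1 Ty s0 sr Ts rT ra sb.
have T0 k : 0 < T k by have := T1 k; lra.
under eq_fun do rewrite -Rintegral_step_density//.
have mpos : measurable (pos : set (measurableTypeR R)) by exact: measurable_itv.
have [j2 j0] := @integrable_sqr_gauss R (4^-1) (ltac:(by rewrite invr_gt0)).
have i2 := integrableS measurableT mpos (@subsetT _ _) j2.
have i0 := integrableS measurableT mpos (@subsetT _ _) j0.
have [|||||_ //] := @Rintegral_dominated_cvg _ _ R mu pos
  (fun k y => step_density (T k) (r k) (s k) y)
  (fun y => y ^+ 2 * expR (- y ^+ 2 - (a - b) * y))
  (fun y => 8 * (y ^+ 2 * expR (- (4^-1 * y ^+ 2))) + 8 * expR (- (4^-1 * y ^+ 2))).
- exact: mpos.
- by move=> k; exact: measurable_step_density.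
- by move=> y /=; rewrite in_itv/= andbT => y0; exact: step_density_cvg.
- exact: (integrableD mpos (integrableZl mpos 8 i2) (integrableZl mpos 8 i0)).
- by move=> k y /=; rewrite in_itv/= andbT => y0; exact: step_density_ub.
Qed.

(** The domination asks for T <= 2 s and r <= 2 T, which hold only from some index N on; all
    sequences are shifted by N. *)
Lemma kcov_asymptotics (T : R ^nat) (r s : nat -> nat) (a b : R) :
  T @ \oo --> +oo -> (forall k, s k <= r k)%N ->
  ((r k)%:R - T k) / Num.sqrt (T k) @[k --> \oo] --> a ->
  ((s k)%:R - T k) / Num.sqrt (T k) @[k --> \oo] --> b ->
  Num.sqrt (T k) * kcov (r k) (s k) @[k --> \oo] --> climit (a - b).
Proof.
move=> Ty sr ra sb.
have near_ratio (n : nat -> nat) (c : R) : ((n k)%:R - T k) / Num.sqrt (T k) @[k --> \oo] --> c ->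
    \forall k \near \oo, [/\ 1 <= T k, T k <= 2 * (n k)%:R & (n k)%:R <= 2 * T k].
  move=> nc; near=> k.
  have T1 : 1 <= T k by near: k; move/cvgryPge : Ty; apply.
  (* Once the quotient is within 1 of [c], this gives |n - T| <= (|c| + 1) sqrt T <= T / 2. *)
  have T2 : (2 * (`|c| + 1)) ^+ 2 <= T k by near: k; move/cvgryPge : Ty; apply.
  have t0 : 0 < Num.sqrt (T k) by rewrite sqrtr_gt0; lra.
  have TE : T k = Num.sqrt (T k) ^+ 2 by rewrite sqr_sqrtr//; lra.
  have c0 := normr_ge0 c.
  have tc : 2 * (`|c| + 1) <= Num.sqrt (T k).
    rewrite -[leLHS](ger0_norm (_ : 0 <= _)); last lra.
    by rewrite -sqrtr_sqr ler_wsqrtr.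
  have : `|c - ((n k)%:R - T k) / Num.sqrt (T k)| < 1.
    by near: k; move/cvgrPdist_lt : nc; apply.
  set q := _ / Num.sqrt _ => qc.
  have qE : (n k)%:R - T k = q * Num.sqrt (T k) by rewrite divfK// gt_eqF.
  have q1 : `|q| <= `|c| + 1.
    have -> : q = c - (c - q) by ring.
    by rewrite (le_trans (ler_normB _ _))// lerD// ltW.
  have : `|q * Num.sqrt (T k)| <= T k / 2.
    rewrite normrM (ger0_norm (ltW t0)) [X in _ <= X / 2]TE expr2 mulrAC.
    rewrite ler_pM2r// ler_pdivlMr//; lra.
  by rewrite -qE ler_norml => /andP[? ?]; split => //; lra.
have [N _ HN] : \forall k \near \oo, [/\ 1 <= T k, T k <= 2 * (s k)%:R & (r k)%:R <= 2 * T k].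
  by apply: filterS2 (near_ratio _ _ ra) (near_ratio _ _ sb) => k [? _ ?] [_ ? _].
rewrite -(cvg_shiftn N).
have H k := HN (k + N)%N (leq_addl _ _).
apply: kcov_asymptotics_bounded.
- by move=> k; have [] := H k.
- by rewrite (cvg_shiftn N).
- move=> k; have [h1 h2 _] := H k; rewrite -(ltr_nat R).
  have : T (k + N)%N <= 2 * (s (k + N)%N)%:R by [].
  by lra.
- by move=> k; exact: sr.
- by move=> k; have [] := H k.
- by move=> k; have [] := H k.
- by rewrite (cvg_shiftn N (fun k => ((r k)%:R - T k) / Num.sqrt (T k))).
- by rewrite (cvg_shiftn N (fun k => ((s k)%:R - T k) / Num.sqrt (T k))).
Unshelve. all: end_near. Qed.

End RiemannSums.

(** * Gaussian families *)

Section SquareIntegrable.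
Context {R : realType} d {W : measurableType d} (P : probability W R).
Implicit Types X Y Z : W -> R.

Definition sqr_int X := measurable_fun setT X /\
  P.-integrable setT (fun x => (X x ^+ 2)%:E).

(** Second moments without centering, as real numbers; for mean-zero variables they are the
    covariances. *)
Definition gram X Y : R := (\int[P]_x (X x * Y x))%R.

Lemma sqr_intM X Y : sqr_int X -> sqr_int Y ->
  P.-integrable setT (fun x => (X x * Y x)%:E).
Proof.
move=> [mX iX] [mY iY]; have := integrableD measurableT iX iY.
apply: le_integrable => //; first exact/measurable_EFinP/measurable_funM.
move=> x _; rewrite /= lee_fin [leRHS]ger0_norm ?addr_ge0 ?sqr_ge0// normrM.
rewrite -(real_normK (num_real (X x))) -(real_normK (num_real (Y x))).
have := sqr_ge0 (`|X x| - `|Y x|).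
have := normr_ge0 (X x); have := normr_ge0 (Y x).
move: `|X x| `|Y x| => a b; nra.
Qed.

Lemma sqr_int_cst c : sqr_int (cst c).
Proof.
split=> //; apply: (@bdd_meas_integrable _ W R P (fun=> c ^+ 2)).
exact: bdd_meas_cst.
Qed.

Lemma sqr_int_integrable X : sqr_int X -> P.-integrable setT (fun x => (X x)%:E).
Proof.
move=> iX; have := sqr_intM iX (sqr_int_cst 1).
by under eq_fun do rewrite /= mulr1.
Qed.

Lemma gramC X Y : gram X Y = gram Y X.
Proof. by apply: eq_Rintegral => x _; rewrite mulrC. Qed.

Lemma sqr_intD X Y : sqr_int X -> sqr_int Y -> sqr_int (fun x => X x + Y x).
Proof.
move=> hX hY; have [mX iX] := hX; have [mY iY] := hY.
split; first exact: measurable_funD.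
have := integrableD measurableT (integrableD measurableT iX iY)
  (integrableZl measurableT 2 (sqr_intM hX hY)).
congr (_.-integrable _ _); apply/funext => x /=.
by rewrite -EFinM -!EFinD; congr (_%:E); ring.
Qed.

Lemma sqr_intZ a X : sqr_int X -> sqr_int (fun x => a * X x).
Proof.
move=> [mX iX]; split; first exact: measurable_funM.
have := integrableZl measurableT (a ^+ 2) iX.
by congr (_.-integrable _ _); apply/funext => x /=; rewrite -EFinM exprMn.
Qed.

Lemma gramDl X Y Z : sqr_int X -> sqr_int Y -> sqr_int Z ->
  gram (fun x => X x + Y x) Z = gram X Z + gram Y Z.
Proof.
move=> hX hY hZ; rewrite /gram; under eq_Rintegral do rewrite mulrDl.
by rewrite RintegralD//; exact: sqr_intM.
Qed.

Lemma gramZl a X Z : sqr_int X -> sqr_int Z ->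
  gram (fun x => a * X x) Z = a * gram X Z.
Proof.
move=> hX hZ; rewrite /gram; under eq_Rintegral do rewrite -mulrA.
by rewrite RintegralZl//; exact: sqr_intM.
Qed.

Lemma sqr_int_sum (I : Type) (r : seq I) (a : I -> R) (X : I -> W -> R) :
  (forall i, sqr_int (X i)) -> sqr_int (fun x => \sum_(i <- r) a i * X i x).
Proof.
move=> hX; elim: r => [|i r IH].
  by under eq_fun do rewrite big_nil; exact: sqr_int_cst.
under eq_fun do rewrite big_cons.
by apply: sqr_intD => //; exact: sqr_intZ.
Qed.

Lemma gram_suml (I : Type) (r : seq I) (a : I -> R) (X : I -> W -> R) Z :
  (forall i, sqr_int (X i)) -> sqr_int Z ->
  gram (fun x => \sum_(i <- r) a i * X i x) Z = \sum_(i <- r) a i * gram (X i) Z.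
Proof.
move=> hX hZ; elim: r => [|i r IH].
  rewrite big_nil /gram; under eq_Rintegral do rewrite big_nil mul0r.
  by rewrite Rintegral_cst// mul0r.
rewrite big_cons -IH -gramZl// -gramDl//; [|exact: sqr_intZ|exact: sqr_int_sum].
by congr gram; apply/funext => x; rewrite big_cons.
Qed.

Lemma gram_ge0 X : 0 <= gram X X.
Proof. by apply: Rintegral_ge0 => x _; rewrite -expr2 sqr_ge0. Qed.

End SquareIntegrable.

Section LawTransfer.
Context {R : realType}.

Lemma law_eq_Rintegral d d' (W : measurableType d) (W' : measurableType d')
    (P : probability W R) (P' : probability W' R)
    e (T : measurableType e) (X : W -> T) (X' : W' -> T) (g : T -> R) :
  measurable_fun setT X -> measurable_fun setT X' ->
  (forall A, measurable A -> pushforward P X A = pushforward P' X' A) ->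
  bdd_meas g -> (\int[P]_x g (X x))%R = (\int[P']_x g (X' x))%R.
Proof.
move=> mX mX' law bg; have [mg [M gM]] := bg.
pose Y : {mfun W >-> T} := mfun_Sub (mem_set mX).
pose Y' : {mfun W' >-> T} := mfun_Sub (mem_set mX').
have E d1 (V : measurableType d1) (Q : probability V R) (Z : {mfun V >-> T}) :
    (\int[Q]_x g (Z x))%R = (\int[distribution Q Z]_y g y)%R.
  rewrite /Rintegral; congr fine; rewrite integral_distribution//.
    exact/measurable_EFinP.
  apply: (@bdd_meas_integrable _ V R Q (g \o Z)); split.
    exact: measurableT_comp.
  by exists M => x; exact: gM.
rewrite (E _ _ P Y) (E _ _ P' Y') /Rintegral; congr fine.
by apply: eq_measure_integral => A mA _; exact: law.
Qed.

End LawTransfer.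

Section GaussianFamilies.
Context {R : realType}.

Section Definitions.
Context d {W : measurableType d} (P : probability W R).

Definition centered_normal (X : W -> R) := measurable_fun setT X /\
  forall A, measurable A ->
    pushforward P X A = normal_law 0 (Num.sqrt (gram P X X)) A.

(** [gaussian_process] leaves mean and deviation existential. Here the mean is 0 and the deviation
    is tied to [gram], so that second moments determine all laws. *)
Definition gaussian_family (I : Type) (X : I -> W -> R) :=
  forall n (t : 'I_n -> I) (a : 'I_n -> R),
    centered_normal (fun x => \sum_(i < n) a i * X (t i) x).

Lemma normal_law_centered (X : W -> R) (m s : R) : measurable_fun setT X ->
  (forall A, measurable A -> pushforward P X A = normal_law m s A) ->
  (\int[P]_x X x)%R = 0 -> centered_normal X /\ gram P X X = s ^+ 2.
Proof.
move=> mX law E0; have [_ E1 E2] := normal_law_moments mX law.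
have m0 : m = 0 by rewrite -E1.
have g : gram P X X = s ^+ 2.
  rewrite /gram; under eq_Rintegral do rewrite -expr2.
  by rewrite E2 m0 expr0n add0r.
split; last exact: g.
split=> [|A mA]; first exact: mX.
apply: (etrans (law A mA)); rewrite m0; apply: normal_law_sqr.
by rewrite g sqr_sqrtr// sqr_ge0.
Qed.

Lemma centered_normal_moments (X : W -> R) : centered_normal X ->
  sqr_int P X /\ (\int[P]_x X x)%R = 0.
Proof. by move=> [mX law]; have [i2 E1 _] := normal_law_moments mX law. Qed.

Lemma gaussian_family1 (I : Type) (X : I -> W -> R) i :
  gaussian_family X -> centered_normal (X i).
Proof.
move=> /(_ 1%N (fun=> i) (fun=> 1)); congr centered_normal.
by apply/funext => x; rewrite big_ord1 mul1r.
Qed.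

Lemma gaussian_family_sqr_int (I : Type) (X : I -> W -> R) i :
  gaussian_family X -> sqr_int P (X i).
Proof. by move=> /(gaussian_family1 i)/centered_normal_moments[]. Qed.

End Definitions.

Section JointLaws.
Context d d' {W : measurableType d} {W' : measurableType d'}
  (P : probability W R) (P' : probability W' R).

Lemma centered_normal_law (X : W -> R) (X' : W' -> R) :
  centered_normal P X -> centered_normal P' X' -> gram P X X = gram P' X' X' ->
  forall A, measurable A -> pushforward P X A = pushforward P' X' A.
Proof.
move=> [_ h] [_ h'] g A mA; apply: (etrans (h A mA)).
by rewrite g; exact: (esym (h' A mA)).
Qed.

Lemma measurable_tuple_family e (V : measurableType e) n (X : 'I_n -> V -> R) :
  (forall i, measurable_fun setT (X i)) ->
  measurable_fun setT (fun x => [tuple X i x | i < n]).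
Proof.
move=> mX; apply/measurable_fun_tnthP => i.
rewrite (_ : _ \o _ = X i)//; apply/funext => x /=; exact: tnth_mktuple.
Qed.

Lemma joint_law_eq n (X : 'I_n -> W -> R) (X' : 'I_n -> W' -> R) :
  (forall i, measurable_fun setT (X i)) -> (forall i, measurable_fun setT (X' i)) ->
  (forall a b, (\int[P]_x cos (\sum_(i < n) a i * X i x + b) =
    \int[P']_x cos (\sum_(i < n) a i * X' i x + b))%R) ->
  forall A, measurable A ->
    pushforward P (fun x => [tuple X i x | i < n]) A =
    pushforward P' (fun x => [tuple X' i x | i < n]) A.
Proof.
move=> mX mX' E A mA.
pose Y : {mfun W >-> n.-tuple R} := mfun_Sub (mem_set (measurable_tuple_family mX)).
pose Y' : {mfun W' >-> n.-tuple R} := mfun_Sub (mem_set (measurable_tuple_family mX')).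
have key e (V : measurableType e) (Q : probability V R) (Z : 'I_n -> V -> R)
    (mZ : forall i, measurable_fun setT (Z i)) a b :
    (\int[distribution Q (mfun_Sub (mem_set (measurable_tuple_family mZ))
       : {mfun V >-> n.-tuple R})]_x
       cos (dotp a x + b))%R =
    (\int[Q]_x cos (\sum_(i < n) a i * Z i x + b))%R.
  have bc : bdd_meas (fun x : n.-tuple R => cos (dotp a x + b)).
    by apply: bdd_meas_cos; apply: measurable_funD => //; exact: measurable_dotp.
  rewrite /Rintegral; congr fine; rewrite integral_distribution/=.
  - apply: eq_integral => x _ /=; congr (cos (_ + _))%:E.
    by apply: eq_bigr => i _; rewrite tnth_mktuple.
  - by apply/measurable_EFinP; case: bc.
  - apply: (@bdd_meas_integrable _ V R Q (fun x => cos (dotp a [tuple Z i x | i < n] + b))).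
    have [mc [M cM]] := bc; split; last by exists M => x; exact: cM.
    apply: (measurableT_comp mc); exact: measurable_tuple_family.
exact: (@charfun_unique R n (distribution P Y) (distribution P' Y')
  (fun a b => etrans (key _ _ _ _ mX a b) (etrans (E a b) (esym (key _ _ _ _ mX' a b)))) A mA).
Qed.

(** Equality of the Gram matrices passes to the variances of linear combinations, hence to their
    laws and to their cosine integrals. *)
Lemma gaussian_joint_law (I I' : Type) (X : I -> W -> R) (X' : I' -> W' -> R) n
    (t : 'I_n -> I) (t' : 'I_n -> I') :
  gaussian_family P X -> gaussian_family P' X' ->
  (forall i j, gram P (X (t i)) (X (t j)) = gram P' (X' (t' i)) (X' (t' j))) ->
  forall A, measurable A ->
    pushforward P (fun x => [tuple X (t i) x | i < n]) A =
    pushforward P' (fun x => [tuple X' (t' i) x | i < n]) A.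
Proof.
move=> gX gX' G; apply: joint_law_eq.
- by move=> i; case: (gaussian_family_sqr_int (t i) gX).
- by move=> i; case: (gaussian_family_sqr_int (t' i) gX').
move=> a b; have cX := gX n t a; have cX' := gX' n t' a.
have bc : bdd_meas (fun y : R => cos (y + b)).
  by apply: bdd_meas_cos; exact: measurable_funD.
refine (law_eq_Rintegral cX.1 cX'.1 _ bc).
- apply: centered_normal_law; [exact: cX|exact: cX'|].
  have sX i := gaussian_family_sqr_int (t i) gX.
  have sX' i := gaussian_family_sqr_int (t' i) gX'.
  rewrite !gram_suml//; [|exact: (sqr_int_sum _ _ sX')|exact: (sqr_int_sum _ _ sX)].
  apply: eq_bigr => i _; rewrite gramC [in RHS]gramC !gram_suml//.
  by congr (_ * _); apply: eq_bigr => j _; rewrite G.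
Qed.

End JointLaws.

Section PolynomialCombinations.
Context d {W : measurableType d} (P : probability W R) (X : nat -> W -> R).
Hypothesis gX : gaussian_family P X.

Definition combo (p : {poly R}) (x : W) : R := \sum_(i < size p) p`_i * X i x.

Lemma combo_widen (p : {poly R}) N x : (size p <= N)%N -> combo p x = \sum_(i < N) p`_i * X i x.
Proof.
move=> pN; rewrite /combo -(subnKC pN) big_split_ord/=.
rewrite [X in _ = _ + X]big1 ?addr0// => i _.
by rewrite nth_default ?leq_addr// mul0r.
Qed.

Lemma comboD p q x : combo (p + q) x = combo p x + combo q x.
Proof.
pose N := maxn (size p) (size q).
rewrite (@combo_widen (p + q) N) ?size_polyD// (@combo_widen p N) ?leq_maxl//.
rewrite (@combo_widen q N) ?leq_maxr// -big_split/=.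
by apply: eq_bigr => i _; rewrite coefD mulrDl.
Qed.

Lemma comboZ a p x : combo (a *: p) x = a * combo p x.
Proof.
rewrite (@combo_widen (a *: p) (size p)) ?size_scale_leq// mulr_sumr.
by apply: eq_bigr => i _; rewrite coefZ mulrA.
Qed.

Lemma combo_sum (I : Type) (r : seq I) (a : I -> R) (p : I -> {poly R}) x :
  combo (\sum_(i <- r) a i *: p i) x = \sum_(i <- r) a i * combo (p i) x.
Proof.
elim: r => [|i r IH]; first by rewrite !big_nil /combo size_poly0 big_ord0.
by rewrite !big_cons comboD comboZ IH.
Qed.

Lemma combo_Xn n x : combo 'X^n x = X n x.
Proof.
rewrite /combo size_polyXn big_ord_recr/= big1 ?add0r.
  by rewrite coefXn eqxx mul1r.
by move=> i _; rewrite coefXn ltn_eqF// mul0r.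
Qed.

(** A linear combination of images is the image of the combined polynomial, so the family can be
    indexed by all polynomials at once. *)
Lemma gaussian_combo : gaussian_family P combo.
Proof.
move=> n t a.
have := gX (fun i : 'I_(size (\sum_(i < n) a i *: t i)) => i : nat)
  (fun i => (\sum_(i < n) a i *: t i)`_i).
congr centered_normal; apply/funext => x.
by rewrite -combo_sum.
Qed.

Lemma gram_combo p q :
  gram P (combo p) (combo q) = pform (fun i j => gram P (X i) (X j)) p q.
Proof.
have sX i := gaussian_family_sqr_int i gX.
rewrite /combo gram_suml//; last exact: (sqr_int_sum _ _ (fun i : 'I_(size q) => sX i)).
apply: eq_bigr => i _; rewrite gramC gram_suml// mulr_sumr.
by apply: eq_bigr => j _; rewrite gramC; ring.
Qed.

Lemma pform_gram_ge0 p : 0 <= pform (fun i j => gram P (X i) (X j)) p p.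
Proof. by rewrite -gram_combo gram_ge0. Qed.

End PolynomialCombinations.

End GaussianFamilies.

Lemma cvg_sumr {R : realType} T (F : set_system T) {FF : Filter F} n
    (f : 'I_n -> T -> R) (l : 'I_n -> R) :
  (forall i, f i x @[x --> F] --> l i) ->
  \sum_(i < n) f i x @[x --> F] --> \sum_(i < n) l i.
Proof. by move=> fl; apply: cvg_big => //; exact: add_continuous. Qed.

(** * Almost sure limits of Gaussian families *)

Section GaussianLimits.
Context {R : realType} d {W : measurableType d} (P : probability W R).
Implicit Types X Y Z : W -> R.

Lemma Rintegral_bounded_cvg (f_ : nat -> W -> R) (f : W -> R) (M : R) :
  (forall n, measurable_fun setT (f_ n)) -> measurable_fun setT f ->
  (forall n x, `|f_ n x| <= M) ->
  {ae P, forall x, f_ ^~ x @ \oo --> f x} ->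
  (\int[P]_x f_ n x)%R @[n --> \oo] --> (\int[P]_x f x)%R.
Proof.
move=> mf_ mf fM cf.
have [|||||i _ c] := @dominated_convergence _ W R P setT measurableT
  (fun n => EFin \o f_ n) (EFin \o f) (EFin \o cst M).
- by move=> n; apply/measurable_EFinP.
- exact/measurable_EFinP.
- by apply: filterS cf => x cx _; apply: cvg_EFin; [exact: nearW|exact: cx].
- by apply: (@bdd_meas_integrable _ W R P (cst M)); exact: bdd_meas_cst.
- by apply/aeW => x n _; rewrite /= lee_fin fM.
apply: fine_cvg; rewrite fineK//.
exact: integrable_fin_num i.
Qed.

Lemma law_eq_cos X Y : measurable_fun setT X -> measurable_fun setT Y ->
  (forall a b, (\int[P]_x cos (a * X x + b) = \int[P]_x cos (a * Y x + b))%R) ->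
  forall A, measurable A -> pushforward P X A = pushforward P Y A.
Proof.
move=> mX mY E A mA.
have mtA : measurable ((fun x : 1.-tuple R => tnth x ord0) @^-1` A).
  by rewrite -[X in measurable X]setTI; exact: (measurable_tnth ord0).
have := @joint_law_eq R _ _ W W P P 1 (fun=> X) (fun=> Y) (fun=> mX) (fun=> mY) _ _ mtA.
have pE (Z : W -> R) : pushforward P (fun x => [tuple Z x | i < 1])
    ((fun x : 1.-tuple R => tnth x ord0) @^-1` A) = pushforward P Z A.
  by rewrite /pushforward; congr (P _); apply/seteqP; split=> x /=; rewrite tnth_mktuple.
rewrite !pE.
apply=> a b; have := E (a ord0) b; congr (_ = _);
  by apply: eq_Rintegral => x _; rewrite big_ord1.
Qed.

Lemma gramZ a X : sqr_int P X ->
  gram P (fun x => a * X x) (fun x => a * X x) = a ^+ 2 * gram P X X.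
Proof.
move=> hX; rewrite gramZl//; last exact: sqr_intZ.
by rewrite gramC gramZl// mulrA expr2.
Qed.

Lemma sqr_int_centered X : (forall a, centered_normal P (fun x => a * X x)) ->
  sqr_int P X.
Proof.
move=> /(_ 1)/centered_normal_moments[+ _]; congr sqr_int.
by apply/funext => x; rewrite mul1r.
Qed.

(** [Y k] has the law of [s k * xi], which converges pointwise to [Num.sqrt v * xi]. Comparing the
    limits of the cosine integrals identifies the law of [Z]. *)
Lemma centered_normal_lim (xi : W -> R) (Y : nat -> W -> R) Z v :
  (forall a, centered_normal P (fun x => a * xi x)) -> gram P xi xi = 1 ->
  (forall k, centered_normal P (Y k)) -> measurable_fun setT Z ->
  {ae P, forall x, Y ^~ x @ \oo --> Z x} ->
  gram P (Y k) (Y k) @[k --> \oo] --> v ->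
  centered_normal P Z /\ gram P Z Z = v.
Proof.
move=> cxi xi1 cY mZ aeZ gv.
have sxi := sqr_int_centered cxi.
have v0 : 0 <= v.
  have cg : cvgn (fun k => gram P (Y k) (Y k)) by apply/cvg_ex; exists v.
  have <- : limn (fun k => gram P (Y k) (Y k)) = v by apply/cvg_lim.
  by apply: limr_ge => //; apply: nearW => k; exact: gram_ge0.
pose s k := Num.sqrt (gram P (Y k) (Y k)).
have sv : s k @[k --> \oo] --> Num.sqrt v.
  by apply: continuous_cvg => //; exact: sqrt_continuous.
have mcos a b X : measurable_fun setT X ->
    measurable_fun setT (fun x => cos (a * X x + b)).
  move=> mX; have [] // := @bdd_meas_cos _ W R (fun x => a * X x + b).
  by apply: measurable_funD => //; exact: measurable_funM.
have cos1 (x : R) : `|cos x| <= 1 by rewrite ler_norml cos_geN1 cos_le1.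
have clim (a b : R) (u : nat -> R) l : u @ \oo --> l ->
    cos (a * u k + b) @[k --> \oo] --> cos (a * l + b).
  move=> ul; apply: continuous_cvg; first exact: continuous_cos.
  by apply: cvgD; [apply: cvgM => //; exact: cvg_cst|exact: cvg_cst].
have lawZ A : measurable A ->
    pushforward P Z A = pushforward P (fun x => Num.sqrt v * xi x) A.
  apply: law_eq_cos => //; first by have [] := cxi (Num.sqrt v).
  move=> a b.
  have c1 : (\int[P]_x cos (a * Y k x + b))%R @[k --> \oo] -->
      (\int[P]_x cos (a * Z x + b))%R.
    apply: (Rintegral_bounded_cvg (M := 1)) => //.
    - by move=> k; apply: mcos; case: (cY k).
    - exact: mcos.
    - by apply: filterS aeZ => x cx; exact: clim.
  have c2 : (\int[P]_x cos (a * (s k * xi x) + b))%R @[k --> \oo] -->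
      (\int[P]_x cos (a * (Num.sqrt v * xi x) + b))%R.
    apply: (Rintegral_bounded_cvg (M := 1)) => //.
    - by move=> k; apply: mcos; case: (cxi (s k)).
    - by apply: mcos; case: (cxi (Num.sqrt v)).
    - by apply: aeW => x; apply: clim; apply: cvgM => //; exact: cvg_cst.
  suff E : (fun k => (\int[P]_x cos (a * Y k x + b))%R) =
      (fun k => (\int[P]_x cos (a * (s k * xi x) + b))%R).
    by rewrite E in c1; exact: (cvg_unique _ c1 c2).
  apply/funext => k.
  have bc : bdd_meas (fun y : R => cos (a * y + b)).
    by apply: bdd_meas_cos; apply: measurable_funD => //; exact: measurable_funM.
  refine (law_eq_Rintegral (cY k).1 (cxi (s k)).1 _ bc).
  apply: centered_normal_law; [exact: cY|exact: cxi|].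
  by rewrite gramZ// xi1 mulr1 sqr_sqrtr// gram_ge0.
have [_ law] := cxi (Num.sqrt v).
have gs : gram P (fun x => Num.sqrt v * xi x) (fun x => Num.sqrt v * xi x) = v.
  by rewrite gramZ// xi1 mulr1 sqr_sqrtr.
have law' A : measurable A -> pushforward P Z A = normal_law 0 (Num.sqrt v) A.
  by move=> mA; apply: (etrans (lawZ A mA)); apply: (etrans (law A mA)); rewrite gs.
have [_ E1 _] := normal_law_moments mZ law'.
by have [cZ ->] := normal_law_centered mZ law' E1; rewrite sqr_sqrtr.
Qed.

(** The increments have L^2 norms of order 2^(-k), so they are absolutely summable almost
    everywhere. *)
Lemma ae_cvg_summable (Y : nat -> W -> R) (c : R) :
  (forall k, sqr_int P (Y k)) ->
  (forall k, gram P (fun x => Y k.+1 x - Y k x) (fun x => Y k.+1 x - Y k x)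
     <= c * 4^-1 ^+ k) ->
  exists2 Z : W -> R, measurable_fun setT Z & {ae P, forall x, Y ^~ x @ \oo --> Z x}.
Proof.
move=> sY gc.
pose D k x := Y k.+1 x - Y k x.
have sD k : sqr_int P (D k).
  rewrite (_ : D k = fun x => Y k.+1 x + (-1) * Y k x); last first.
    by apply/funext => x; rewrite mulN1r.
  by apply: sqr_intD => //; exact: sqr_intZ.
(* AM-GM: [|D| <= 2^-k + 2^k D^2], and the right-hand sides have summable expectations. *)
pose h k x : R := 2^-1 ^+ k + 2 ^+ k * D k x ^+ 2.
have half0 : 0 <= 2^-1 :> R by rewrite invr_ge0.
have h0 k x : 0 <= h k x.
  by apply: addr_ge0; [exact: exprn_ge0|apply: mulr_ge0; [exact: exprn_ge0|exact: sqr_ge0]].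
have Dh k x : `|D k x| <= h k x.
  rewrite /h exprVn -(real_normK (num_real (D k x))).
  have t0 : 0 < 2 ^+ k :> R by exact: exprn_gt0.
  have sq (t y : R) : 0 < t -> y <= t^-1 + t * y ^+ 2; last exact: sq.
  move=> {}t0.
  rewrite -subr_ge0 (_ : _ - _ = ((1 - t * y / 2) ^+ 2 + 3 / 4 * (t * y) ^+ 2) / t).
    apply: divr_ge0; last exact: ltW.
    by apply: addr_ge0; [|apply: mulr_ge0 => //]; exact: sqr_ge0.
  by field; rewrite gt_eqF.
have ic k : P.-integrable setT (EFin \o (cst (2^-1 ^+ k) : W -> R)).
  by apply: (@bdd_meas_integrable _ W R P (cst (2^-1 ^+ k))); exact: bdd_meas_cst.
have ih k : P.-integrable setT (fun x => (h k x)%:E).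
  have [_ iD] := sD k.
  have := integrableD measurableT
    (ic k)
    (integrableZl measurableT (2 ^+ k) iD).
  by congr (_.-integrable _ _); apply/funext => x /=; rewrite -EFinM -EFinD.
have mh k : measurable_fun setT (fun x => (h k x)%:E).
  by have /integrableP[] := ih k.
have Eh k : (\int[P]_x (h k x)%:E <= ((1 + c) * 2^-1 ^+ k)%:E)%E.
  have -> : (\int[P]_x (h k x)%:E = (\int[P]_x h k x)%R%:E)%E.
    by rewrite /Rintegral fineK//; exact: (integrable_fin_num measurableT (ih k)).
  have [_ iD] := sD k.
  rewrite lee_fin /h RintegralD//.
  - have -> : (\int[P]_x (2^-1 ^+ k))%R = 2^-1 ^+ k :> R.
      by rewrite /Rintegral integral_cst// [X in (_ * X)%E](@probability_setT _ _ _ P) mule1.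
    rewrite RintegralZl//.
    have -> : (\int[P]_x D k x ^+ 2)%R = gram P (D k) (D k).
      by apply: eq_Rintegral => x _; rewrite expr2.
    rewrite mulrDl mul1r lerD2l (le_trans (ler_wpM2l _ (gc k))) ?exprn_ge0//.
    rewrite mulrCA ler_wpM2l//; last first.
      by rewrite -exprMn (_ : 2 * 4^-1 = 2^-1)//; field.
    by have := le_trans (gram_ge0 P _) (gc 0%N); rewrite expr0 mulr1.
  - exact: ic.
  - have := integrableZl measurableT (2 ^+ k) iD.
    by congr (_.-integrable _ _); apply/funext => x /=; rewrite -EFinM.
have c0 : 0 <= c.
  by have := le_trans (gram_ge0 P _) (gc 0%N); rewrite expr0 mulr1.
have S_lt : (\int[P]_x (\sum_(k <oo) (h k x)%:E) < +oo)%E.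
  rewrite integral_nneseries//; last by move=> k x _; rewrite lee_fin.
  apply: (@le_lt_trans _ _ ((1 + c) * 2)%:E); last exact: ltry.
  apply: lime_le.
    by apply: is_cvg_nneseries => k _ _; apply: integral_ge0 => x _; rewrite lee_fin.
  apply: nearW => n.
  apply: (@le_trans _ _ (\sum_(0 <= k < n) ((1 + c) * 2^-1 ^+ k)%:E)%E).
    by apply: lee_sum => k _; exact: Eh.
  rewrite sumEFin lee_fin -mulr_sumr ler_wpM2l ?addr_ge0//.
  have -> : \sum_(0 <= k < n) 2^-1 ^+ k = 2 - 2 * 2^-1 ^+ n :> R.
    elim: n => [|n IH]; first by rewrite big_nil expr0; ring.
    by rewrite big_nat_recr//= IH exprS; field.
  by rewrite gerBl mulr_ge0// exprn_ge0.
have S0 x : (0 <= \sum_(k <oo) (h k x)%:E)%E.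
  by apply: nneseries_ge0 => k _ _; rewrite lee_fin.
have iS : P.-integrable setT (fun x => \sum_(k <oo) (h k x)%:E)%E.
  apply/integrableP; split.
    apply: ge0_emeasurable_sum; last by move=> k _; exact: mh.
    by move=> k x _ _; rewrite lee_fin.
  by under eq_integral do rewrite gee0_abs//.
(* The limsup is measurable on all of [W], whatever happens on the exceptional null set. *)
exists (fun x => fine (limn_esup (fun k => (Y k x)%:E))).
  apply: measurableT_comp => //; apply: measurable_fun_limn_esup => k.
  by apply/measurable_EFinP; case: (sY k).
have := integrable_ae measurableT iS; apply: filterS => x /(_ I) Sx.
have ch : cvgn (series (h ^~ x)).
  by apply: nnseries_is_cvg => //; rewrite ltey_eq Sx.
have cD : cvgn (series (D ^~ x)).
  apply: normed_cvg; apply: (@series_le_cvg _ _ (h ^~ x)) ch => k;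
    [exact: normr_ge0|exact: h0|exact: Dh].
have cY : cvgn (Y ^~ x).
  rewrite (_ : Y ^~ x = fun n => Y 0%N x + series (D ^~ x) n).
    by apply: is_cvgD => //; exact: is_cvg_cst.
  apply/funext => n; rewrite /series /= /D telescope_sumr//; ring.
move/cvg_ex: cY => [l cl].
have cE : (Y k x)%:E @[k --> \oo] --> l%:E by apply: cvg_EFin => //; exact: nearW.
by have [_ ->] := cvg_limn_einf_sup cE.
Qed.

Lemma gaussian_family_lim (xi : W -> R) (I : Type) (Y : nat -> I -> W -> R)
    (Z : I -> W -> R) (C : I -> I -> R) :
  (forall a, centered_normal P (fun x => a * xi x)) -> gram P xi xi = 1 ->
  (forall k, gaussian_family P (Y k)) ->
  (forall i, measurable_fun setT (Z i)) ->
  (forall i, {ae P, forall x, Y ^~ i ^~ x @ \oo --> Z i x}) ->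
  (forall i j, gram P (Y k i) (Y k j) @[k --> \oo] --> C i j) ->
  gaussian_family P Z /\ forall i j, gram P (Z i) (Z j) = C i j.
Proof.
move=> cxi xi1 gY mZ aeZ gC.
have key n (t : 'I_n -> I) (a : 'I_n -> R) :
    centered_normal P (fun x => \sum_(i < n) a i * Z (t i) x) /\
    gram P (fun x => \sum_(i < n) a i * Z (t i) x) (fun x => \sum_(i < n) a i * Z (t i) x) =
      \sum_(i < n) a i * \sum_(j < n) a j * C (t i) (t j).
  apply: (@centered_normal_lim xi (fun k x => \sum_(i < n) a i * Y k (t i) x)) => //.
  - by move=> k; exact: gY.
  - by apply: measurable_sum => i; exact: measurable_funM.
  - have : {ae P, forall x, forall i : 'I_n, Y ^~ (t i) ^~ x @ \oo --> Z (t i) x}.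
      by apply: filter_forall => i; exact: aeZ.
    apply: filterS => x cx; apply: cvg_sumr => i.
    by apply: cvgM; [exact: cvg_cst|exact: cx].
  - rewrite (_ : (fun k => _) = fun k =>
      \sum_(i < n) a i * \sum_(j < n) a j * gram P (Y k (t i)) (Y k (t j))).
      apply: cvg_sumr => i; apply: cvgM; first exact: cvg_cst.
      by apply: cvg_sumr => j; apply: cvgM; [exact: cvg_cst|exact: gC].
    apply/funext => k; have sY i := gaussian_family_sqr_int i (gY k).
    rewrite gram_suml//; last exact: (sqr_int_sum _ _ (fun i => sY (t i))).
    by apply: eq_bigr => i _; rewrite gramC gram_suml//;
      congr (_ * _); apply: eq_bigr => j _; rewrite gramC.
have gZ : gaussian_family P Z by move=> n t a; case: (key n t a).
split=> // i j.
have sZ i' := gaussian_family_sqr_int i' gZ.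
have diag i' : gram P (Z i') (Z i') = C i' i'.
  have [_] := key 1%N (fun=> i') (fun=> 1).
  rewrite !big_ord1 !mul1r => <-; congr gram; apply/funext => x;
    by rewrite big_ord1 mul1r.
have CC : C j i = C i j.
  have := gC j i; under eq_fun do rewrite gramC.
  by move=> c; exact: (cvg_unique _ c (gC i j)).
(* [key] gives the second moment of a combination with itself; the mixed ones follow by polarization
   from Z_i + Z_j. *)
have [_] := key 2%N (fun k => if k == ord0 then i else j) (fun=> 1).
rewrite !big_ord_recl !big_ord0 /= !mul1r !addr0 CC.
have -> : (fun x => \sum_(k < 2) 1 * Z (if k == ord0 then i else j) x) =
    (fun x => Z i x + Z j x).
  by apply/funext => x; rewrite !big_ord_recl big_ord0 /= !mul1r addr0.
rewrite gramDl//; last exact: sqr_intD.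
rewrite ![gram P _ (fun x => _ + _)]gramC !gramDl// !diag [gram P (Z j) (Z i)]gramC.
lra.
Qed.

End GaussianLimits.

(** * The interpolated process *)

Section InterpolationPolynomials.
Context {R : realType}.

Lemma sqrt_pinfty (T : R ^nat) : T @ \oo --> +oo ->
  (fun k => (Num.sqrt (T k))^-1) @ \oo --> (0 : R).
Proof.
move=> Ty; apply/gtr0_cvgV0.
  near=> k; rewrite sqrtr_gt0.
  by near: k; move/cvgryPgt : Ty; apply.
apply/cvgryPge => A; near=> k.
have : `|A| ^+ 2 <= T k by near: k; move/cvgryPge : Ty; apply.
move=> /ler_wsqrtr; rewrite sqrtr_sqr normr_id; exact: le_trans (ler_norm _).
Unshelve. all: end_near. Qed.

Lemma cvg_near_index (T : R ^nat) (n : nat -> nat) (a c : R) :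
  T @ \oo --> +oo ->
  (\forall k \near \oo, `|(n k)%:R - (T k + a * Num.sqrt (T k))| <= c) ->
  ((n k)%:R - T k) / Num.sqrt (T k) @[k --> \oo] --> a.
Proof.
move=> Ty nc.
have c0 : (c * (Num.sqrt (T k))^-1) @[k --> \oo] --> (0 : R).
  by rewrite -(mulr0 c); apply: cvgMr; exact: sqrt_pinfty.
apply/cvgrPdist_le => e e0; near=> k.
have T0 : 0 < Num.sqrt (T k).
  by rewrite sqrtr_gt0; near: k; move/cvgryPgt : Ty; apply.
have : `|0 - c * (Num.sqrt (T k))^-1| <= e by near: k; move/cvgrPdist_le : c0; apply.
rewrite sub0r normrN; apply: le_trans; rewrite (le_trans _ (ler_norm _))//.
have -> : a - ((n k)%:R - T k) / Num.sqrt (T k) =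
    - ((n k)%:R - (T k + a * Num.sqrt (T k))) / Num.sqrt (T k) by field; rewrite gt_eqF.
rewrite normrM normrN normfV (gtr0_norm T0) ler_pM2r ?invr_gt0//.
by near: k.
Unshelve. all: end_near. Qed.

Lemma natr_maxn m n : (maxn m n)%:R = Num.max m%:R n%:R :> R.
Proof. by rewrite /maxn /Num.max ltr_nat; case: ifP. Qed.

Lemma kmat_asymptotics (T : R ^nat) (r s : nat -> nat) (a b : R) :
  T @ \oo --> +oo ->
  ((r k)%:R - T k) / Num.sqrt (T k) @[k --> \oo] --> a ->
  ((s k)%:R - T k) / Num.sqrt (T k) @[k --> \oo] --> b ->
  Num.sqrt (T k) * kmat (r k) (s k) @[k --> \oo] --> climit `|a - b|.
Proof.
move=> Ty ra sb.
have shift (n : nat -> nat) (c : R) :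
    ((n k)%:R - T k) / Num.sqrt (T k) @[k --> \oo] --> c ->
    ((n k).+1%:R - T k) / Num.sqrt (T k) @[k --> \oo] --> c.
  move=> nc; rewrite -[c]addr0.
  rewrite (_ : (fun k => _) = fun k => ((n k)%:R - T k) / Num.sqrt (T k) + (Num.sqrt (T k))^-1).
    by apply: cvgD => //; exact: sqrt_pinfty.
  by apply/funext => k; rewrite -natr1 addrAC mulrDl mul1r.
have -> : `|a - b| = Num.max a b - Num.min a b.
  case: (leP a b) => [ab|/ltW ab]; last by rewrite ger0_norm ?subr_ge0.
  by rewrite ler0_norm ?subr_le0// opprB.
(* Maximum and minimum are written with absolute values, so that their limits follow from those of
   sums and norms. *)
have dmax (x y : R) : Num.max x y = (x + y + `|x - y|) / 2.
  by case: (leP x y) => [xy|/ltW xy];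
    [rewrite ler0_norm ?subr_le0//|rewrite ger0_norm ?subr_ge0//]; field.
have dmin (x y : R) : Num.min x y = (x + y - `|x - y|) / 2.
  by case: (leP x y) => [xy|/ltW xy];
    [rewrite ler0_norm ?subr_le0//|rewrite ger0_norm ?subr_ge0//]; field.
have nmax m n : (maxn m n)%:R = (m%:R + n%:R + `|m%:R - n%:R|) / 2 :> R.
  by rewrite -dmax natr_maxn.
have nmin m n : (minn m n)%:R = (m%:R + n%:R - `|m%:R - n%:R|) / 2 :> R.
  have := congr1 (fun k => k%:R : R) (addn_min_max m n).
  by rewrite !natrD nmax => E; lra.
have cabs : `|((r k)%:R - T k) / Num.sqrt (T k) - ((s k)%:R - T k) / Num.sqrt (T k)|
    @[k --> \oo] --> `|a - b|.
  by apply: cvg_norm; exact: cvgB.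
have absE k : `|((r k)%:R - T k) / Num.sqrt (T k) - ((s k)%:R - T k) / Num.sqrt (T k)|
    = `|(r k)%:R - (s k)%:R| / Num.sqrt (T k).
  rewrite -mulrBl normrM normfV (ger0_norm (sqrtr_ge0 _)); congr (`|_| / _); ring.
apply: kcov_asymptotics => //.
- by move=> k; rewrite ltnS; exact: leq_trans (geq_minl _ _) (leq_maxl _ _).
- apply: (shift (fun k => maxn (r k) (s k))) => //.
  rewrite dmax (_ : (fun k => _) = fun k => (((r k)%:R - T k) / Num.sqrt (T k) +
      ((s k)%:R - T k) / Num.sqrt (T k) +
      `|((r k)%:R - T k) / Num.sqrt (T k) - ((s k)%:R - T k) / Num.sqrt (T k)|) / 2).
    by apply: cvgMl; apply: cvgD => //; exact: cvgD.
  by apply/funext => k; rewrite nmax absE; move: ((Num.sqrt (T k))^-1) => w; field.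
- apply: (shift (fun k => minn (r k) (s k))) => //.
  rewrite dmin (_ : (fun k => _) = fun k => (((r k)%:R - T k) / Num.sqrt (T k) +
      ((s k)%:R - T k) / Num.sqrt (T k) -
      `|((r k)%:R - T k) / Num.sqrt (T k) - ((s k)%:R - T k) / Num.sqrt (T k)|) / 2).
    by apply: cvgMl; apply: cvgB => //; exact: cvgD.
  by apply/funext => k; rewrite nmin absE; move: ((Num.sqrt (T k))^-1) => w; field.
Qed.

(* The coefficient of ['X^k] in [scaled_poly T s] is that of [zeta_(k+1)] in [R^(T)_s];
   the [0] stands for [Y_0 = 0]. *)
Definition interp_poly (t : R) : {poly R} :=
  let n := Num.truncn t in
  let alpha := t - n%:R in
  (1 - alpha) *: (if n is m.+1 then 'X^m else 0) + alpha *: 'X^n.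

Definition scaled_poly (T s : R) : {poly R} :=
  T `^ (4^-1) *: interp_poly (T + s * Num.sqrt T).

(** By bilinearity the form is a double convex combination of four values sqrt T * [kmat] at
    adjacent indices, the two factors T^(1/4) producing sqrt T. All four values have the same
    limit. *)
Lemma scaled_poly_asymptotics (T : R ^nat) (a b : R) : T @ \oo --> +oo ->
  pform kmat (scaled_poly (T k) a) (scaled_poly (T k) b) @[k --> \oo] --> climit `|a - b|.
Proof.
move=> Ty.
pose u (c : R) k := T k + c * Num.sqrt (T k).
pose n c k := Num.truncn (u c k).
(* This makes the truncation [n c k] positive eventually, beyond the first segment, where Y_0 = 0
   enters. *)
have u1 c : \forall k \near \oo, 1 <= u c k.
  near=> k.
  have T1 : (`|c| + 1) ^+ 2 <= T k by near: k; move/cvgryPge : Ty; apply.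
  have c0 : 0 <= `|c| + 1 by rewrite addr_ge0.
  have t1 : `|c| + 1 <= Num.sqrt (T k).
    by rewrite -[leLHS](ger0_norm c0) -sqrtr_sqr ler_wsqrtr.
  have TE : T k = Num.sqrt (T k) ^+ 2.
    by rewrite sqr_sqrtr// (le_trans _ T1)// sqr_ge0.
  rewrite /u {1}TE; have := ler_norm (- c); rewrite normrN.
  have := normr_ge0 c; move: t1; move: (Num.sqrt _) `|c| => t y.
  nra.
have nu c : \forall k \near \oo, (n c k)%:R <= u c k < (n c k)%:R + 1.
  near=> k; rewrite natr1; apply: truncn_itv.
  by rewrite (@le_trans _ _ 1)//; near: k; exact: u1.
have n_gt0 c : \forall k \near \oo, (0 < n c k)%N.
  near=> k; rewrite -(ltr_nat R).
  have : 1 <= u c k by near: k; exact: u1.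
  have : (n c k)%:R <= u c k < (n c k)%:R + 1 by near: k; exact: nu.
  lra.
have idx c : ((n c k)%:R - T k) / Num.sqrt (T k) @[k --> \oo] --> c.
  apply: (cvg_near_index (c := 1)) => //; near=> k.
  have : (n c k)%:R <= u c k < (n c k)%:R + 1 by near: k; exact: nu.
  by rewrite /u ler_norml => /andP[? ?]; lra.
have idx' c : ((n c k).-1%:R - T k) / Num.sqrt (T k) @[k --> \oo] --> c.
  apply: (cvg_near_index (c := 2)) => //; near=> k.
  have : (n c k)%:R <= u c k < (n c k)%:R + 1 by near: k; exact: nu.
  have : (0 < n c k)%N by near: k; exact: n_gt0.
  case: (n c k) => // m _ /=; rewrite -natr1 /u ler_norml => /andP[? ?]; lra.
have c00 := kmat_asymptotics Ty (idx' a) (idx' b).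
have c01 := kmat_asymptotics Ty (idx' a) (idx b).
have c10 := kmat_asymptotics Ty (idx a) (idx' b).
have c11 := kmat_asymptotics Ty (idx a) (idx b).
(* The weights depend on k and need not converge, so limits cannot be combined termwise; the
   convexity of the interval of radius [e] around the limit is used instead. *)
have conv (al x y l e : R) : 0 <= al <= 1 -> `|l - x| <= e -> `|l - y| <= e ->
    `|l - ((1 - al) * x + al * y)| <= e.
  rewrite !ler_norml => /andP[? ?] /andP[? ?] /andP[? ?]; apply/andP; split; nra.
apply/cvgrPdist_le => e e0; near=> k.
pose al := u a k - (n a k)%:R; pose be := u b k - (n b k)%:R.
have -> : pform kmat (scaled_poly (T k) a) (scaled_poly (T k) b) =
    (1 - al) * ((1 - be) * (Num.sqrt (T k) * kmat (n a k).-1 (n b k).-1) +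
                be * (Num.sqrt (T k) * kmat (n a k).-1 (n b k))) +
    al * ((1 - be) * (Num.sqrt (T k) * kmat (n a k) (n b k).-1) +
                be * (Num.sqrt (T k) * kmat (n a k) (n b k))).
  have T0 : 0 < T k by near: k; move/cvgryPgt : Ty; apply.
  have TE : Num.sqrt (T k) = T k `^ 4^-1 * T k `^ 4^-1.
    rewrite -powRD; last by rewrite gt_eqF// implybT.
    by rewrite -powR12_sqrt ?ltW//; congr (_ `^ _); field.
  rewrite /scaled_poly pformZl pformC; last exact: kmatC.
  rewrite pformZl mulrA -TE pformC; last exact: kmatC.
  have polyE (c : R) : (0 < n c k)%N -> interp_poly (u c k) =
      (1 - (u c k - (n c k)%:R)) *: 'X^((n c k).-1) + (u c k - (n c k)%:R) *: 'X^((n c k)).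
    by rewrite /interp_poly -/(n c k); case: (n c k).
  have na : (0 < n a k)%N by near: k; exact: n_gt0.
  have nb : (0 < n b k)%N by near: k; exact: n_gt0.
  rewrite -/(u a k) -/(u b k) !polyE// -/al -/be.
  have pDr p q r : pform kmat p (q + r) = pform kmat p q + pform kmat p r :> R.
    by rewrite pformC ?pformDl; [rewrite pformC ?[pform _ r p]pformC//; exact: kmatC|exact: kmatC].
  have pZr x p q : pform kmat p (x *: q) = x * pform kmat p q :> R.
    by rewrite pformC ?pformZl; [rewrite pformC//; exact: kmatC|exact: kmatC].
  by rewrite !pformDl !pformZl !pDr !pZr !pform_Xn; ring.
have ua : (n a k)%:R <= u a k < (n a k)%:R + 1 by near: k; exact: nu.
have ub : (n b k)%:R <= u b k < (n b k)%:R + 1 by near: k; exact: nu.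
have al01 : 0 <= al <= 1 by rewrite /al; move/andP: ua => [? ?]; apply/andP; split; lra.
have be01 : 0 <= be <= 1 by rewrite /be; move/andP: ub => [? ?]; apply/andP; split; lra.
apply: (conv _ _ _ _ _ al01); apply: (conv _ _ _ _ _ be01); near: k.
- by move/cvgrPdist_le : c00; apply.
- by move/cvgrPdist_le : c01; apply.
- by move/cvgrPdist_le : c10; apply.
- by move/cvgrPdist_le : c11; apply.
Unshelve. all: end_near. Qed.

Lemma climit_psd (x : nat -> R) (p : {poly R}) :
  (forall q : {poly R}, 0 <= pform kmat q q) ->
  0 <= pform (fun i j => climit `|x i - x j|) p p.
Proof.
move=> K0; pose T k : R := k%:R.
have Ty : T @ \oo --> +oo by exact: cvgr_idn.
pose q k := \sum_(i < size p) p`_i *: scaled_poly (T k) (x i).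
have qE k : pform kmat (q k) (q k) = \sum_(i < size p) \sum_(j < size p)
    p`_i * p`_j * pform kmat (scaled_poly (T k) (x i)) (scaled_poly (T k) (x j)).
  have ips r (F : 'I_(size p) -> {poly R}) :
      pform kmat (\sum_i F i) r = \sum_i pform kmat (F i) r.
    apply: (@ip_suml R {poly R} (pform kmat)); [exact: pformDl|exact: pformZl].
  rewrite /q ips; apply: eq_bigr => i _.
  rewrite pformZl pformC; last exact: kmatC.
  rewrite ips mulr_sumr; apply: eq_bigr => j _.
  by rewrite pformZl mulrA pformC//; exact: kmatC.
have cq : pform kmat (q k) (q k) @[k --> \oo] --> pform (fun i j => climit `|x i - x j|) p p.
  under eq_fun do rewrite qE.
  apply: cvg_sumr => i; apply: cvg_sumr => j; apply: cvgM; first exact: cvg_cst.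
  exact: scaled_poly_asymptotics.
have cv : cvgn (fun k => pform kmat (q k) (q k)).
  by apply/cvg_ex; exists (pform (fun i j => climit `|x i - x j|) p p).
have <- : limn (fun k => pform kmat (q k) (q k)) =
    pform (fun i j => climit `|x i - x j|) p p by apply/cvg_lim.
by apply: limr_ge => //; exact: nearW.
Qed.

End InterpolationPolynomials.

(** * Weak convergence *)

Section FiniteDimensionalTests.
Context {R : realType}.

Lemma cvg_row T (F : set_system T) {FF : Filter F} n (u : 'I_n -> T -> R) (l : 'I_n -> R) :
  (forall i, u i x @[x --> F] --> l i) ->
  \row_(i < n) u i x @[x --> F] --> \row_(i < n) l i.
Proof.
move=> ul A [Q nQ QA].
have : \forall x \near F, forall i, Q ord0 i (u i x).
  by apply: filter_forall => i; apply: (ul i); have := nQ ord0 i; rewrite mxE.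
apply: filterS => x Qx; apply: QA => i j /=.
by rewrite (ord1 i) mxE.
Qed.

Lemma bdd_meas_row n (f : 'rV[R]_n -> R) : continuous f ->
  (exists M, forall x, `|f x| <= M) ->
  bdd_meas (fun x : n.-tuple R => f (\row_(i < n) tnth x i)).
Proof.
move=> cf [M fM].
(* Approximation of the argument by grid points: there are countably many of them, and
   row vectors carry no measurable structure. *)
pose idx k (x : n.-tuple R) : {ffun 'I_n -> int} :=
  [ffun i => Num.floor (k.+1%:R * tnth x i)].
pose h k (z : {ffun 'I_n -> int}) : R := f (\row_(i < n) ((z i)%:~R / k.+1%:R)).
apply: (@bdd_meas_lim _ _ R (fun k x => h k (idx k x)) _ M) => [k|k x|x].
- split; last by exists M => x; exact: fM.
  move=> _ B mB; rewrite setTI.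
  have -> : (fun x => h k (idx k x)) @^-1` B =
      \bigcup_(z : {ffun 'I_n -> int}) (if h k z \in B then idx k @^-1` [set z] else set0).
    apply/seteqP; split => [x /= Bx|x [z _]].
      by exists (idx k x) => //; rewrite mem_set.
    by case: ifPn => // zB /= ->; exact: set_mem zB.
  apply: countable_bigcupT_measurable; first exact: countableP.
  move=> z; case: ifPn => // _.
  have -> : idx k @^-1` [set z] = \bigcap_(i in [set: 'I_n])
      ((fun x : n.-tuple R => tnth x i) @^-1`
        `[(z i)%:~R / k.+1%:R, (z i + 1)%:~R / k.+1%:R[%classic).
    have E (x : n.-tuple R) i : (Num.floor (k.+1%:R * tnth x i) == z i) =
        (tnth x i \in `[(z i)%:~R / k.+1%:R, (z i + 1)%:~R / k.+1%:R[).
      by rewrite floor_eq in_itv/= ler_pdivrMr// ltr_pdivlMr// mulrC.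
    apply/seteqP; split => [x /= zE i _ /=|x /= zx].
      by rewrite -E -zE ffunE.
    apply/ffunP => i; rewrite ffunE; apply/eqP; rewrite E.
    exact: zx.
  apply: fin_bigcap_measurable; first exact: finite_finset.
  move=> i _; rewrite -[X in measurable X]setTI.
  by apply: (measurable_tnth i) => //; exact: measurable_itv.
- exact: fM.
- suff c : \row_i ((idx k x i)%:~R / k.+1%:R) @[k --> \oo] --> \row_i tnth x i.
    exact: (cvg_comp _ _ c (cf _)).
  apply: cvg_row => i.
  under eq_fun do rewrite ffunE.
  apply/cvgrPdist_le => e e0.
  have := @cvg_harmonic R; move/cvgrPdist_le => /(_ e e0).
  apply: filterS => k; rewrite sub0r normrN => /(le_trans (ler_norm _)).
  apply: le_trans.
  have /andP[] := floor_itv (k.+1%:R * tnth x i).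
  set z := Num.floor _; rewrite intrD /= => z1 z2.
  have k0 : 0 < k.+1%:R :> R by rewrite ltr0n.
  have -> : tnth x i - z%:~R / k.+1%:R = (k.+1%:R * tnth x i - z%:~R) / k.+1%:R.
    by field; rewrite gt_eqF.
  rewrite normrM normfV (gtr0_norm k0) ler_piMl ?invr_ge0 ?ltW// ger0_norm; lra.
Qed.

Lemma increasing_seq_cvg (g : nat -> nat) : increasing_seq g -> g @ \oo --> \oo.
Proof.
move=> gi; apply/cvgnyPge => A; exists A => //= k /= Ak; apply: leq_trans Ak _.
elim: k => // k; move/leq_ltn_trans; apply.
by rewrite (leqW_mono (gi : {mono g : m n / (m <= n)%N})).
Qed.

(** One extraction per index; coordinates already treated keep their limits along further
    subsequences. *)
Lemma bolzano_weierstrass_family (I : finType) (u : I -> R ^nat) :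
  (forall i, exists M, forall k, `|u i k| <= M) ->
  exists2 g : nat -> nat, increasing_seq g & forall i, cvgn (u i \o g).
Proof.
move=> ub.
have : exists2 g : nat -> nat, increasing_seq g &
    forall i, i \in enum I -> cvgn (u i \o g).
  elim: (enum I) => [|i s [g gi gs]]; first by exists id.
  have [M uM] := ub i.
  have [|h hi hc] := @bolzano_weierstrass R (u i \o g).
    exists M; split; first exact: num_real.
    by move=> x Mx k _ /=; rewrite (le_trans (uM _))// ltW.
  exists (g \o h); first by move=> m n /=; rewrite gi; exact: hi.
  move=> j; rewrite inE => /predU1P[->//|js].
  have /cvg_ex[l cl] := gs j js; apply/cvg_ex; exists l.
  exact: (cvg_comp _ _ (increasing_seq_cvg hi) cl).
by move=> [g gi gc]; exists g => // i; apply: gc; rewrite mem_enum.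
Qed.

End FiniteDimensionalTests.

Section GaussianProcesses.
Context {R : realType} d {W : measurableType d} (P : probability W R) (I : Type).

Lemma gaussian_process_family (Z : I -> {RV P >-> R}) :
  gaussian_process Z -> mean_zero Z ->
  gaussian_family P (fun i => Z i : W -> R) /\
  forall i j, covariance P (Z i) (Z j) = (gram P (Z i) (Z j))%:E.
Proof.
move=> gZ mZ.
have mZi i : measurable_fun setT (Z i : W -> R) by [].
have sZ i : sqr_int P (Z i).
  have [m [s law]] := gZ 1%N (fun=> i) (fun=> 1).
  have mi : measurable_fun setT (fun x => \sum_(k < 1) 1 * Z i x).
    by apply: measurable_sum => k; exact: measurable_funM.
  have [i2 _ _] := normal_law_moments mi law.
  split=> //; congr (_.-integrable _ _): i2.
  by apply/funext => x; rewrite big_ord1 mul1r.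
have E0 i : (\int[P]_x Z i x)%R = 0.
  by have := mZ i; rewrite expectation.unlock /Rintegral => ->.
split=> [n t a|i j].
  have [m [s law]] := gZ n t a.
  have mi : measurable_fun setT (fun x => \sum_(i < n) a i * Z (t i) x).
    by apply: measurable_sum => k; exact: measurable_funM.
  have [] // := normal_law_centered mi law.
  have := @gram_suml R _ W P _ (index_enum 'I_n) a (fun i => Z (t i) : W -> R) (cst 1)
    (fun i => sZ (t i)) (sqr_int_cst P 1).
  rewrite /gram; under eq_Rintegral do rewrite mulr1.
  move=> ->; apply: big1 => i _.
  by under eq_Rintegral do rewrite mulr1; rewrite E0 mulr0.
rewrite covariance.unlock !mZ expectation.unlock /gram /Rintegral.
rewrite fineK.
  by apply: eq_integral => x _; rewrite !fctE /= !subr0.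
by apply: integrable_fin_num => //; exact: sqr_intM.
Qed.

Lemma gaussian_family_process (Z : I -> {RV P >-> R}) :
  gaussian_family P (fun i => Z i : W -> R) ->
  gaussian_process Z /\ mean_zero Z.
Proof.
move=> gZ; split=> [n t a|i].
  have [_ law] := gZ n t a.
  exists 0, (Num.sqrt (gram P (fun x => \sum_(i < n) a i * Z (t i) x)
    (fun x => \sum_(i < n) a i * Z (t i) x))).
  exact: law.
have := centered_normal_moments (gaussian_family1 i gZ) => -[sZ E0].
rewrite expectation.unlock -[LHS]fineK; first by congr _%:E.
exact: (integrable_fin_num measurableT (sqr_int_integrable sZ)).
Qed.

End GaussianProcesses.

(** The covariance depends on |b - a| alone, so a time shift preserves Gram matrices, and
    stationarity becomes a case of [gaussian_joint_law]. *)
Lemma limit_process_gram {R : realType} d {W : measurableType d} (P : probability W R)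
    (L : R -> {RV P >-> R}) : limit_process L <->
  gaussian_family P (fun s => L s : W -> R) /\
  forall a b, gram P (L a) (L b) = climit `|b - a|.
Proof.
split=> [[gL mL _ cL]|[gL GL]].
  have [gf cg] := gaussian_process_family gL mL; split=> // a b.
  by apply: EFin_inj; rewrite -cg cL climit_EFin.
have [gp mz] := gaussian_family_process gL; split=> //.
  move=> h n t A mA.
  apply: (@gaussian_joint_law R _ _ W W P P _ _ _ _ n (fun i => t i + h) t gL gL) => //.
  by move=> i j; rewrite !GL opprD addrACA subrr addr0.
by move=> a b; rewrite (gaussian_process_family gp mz).2 GL climit_EFin.
Qed.

(** * Realization of the limit process, and subsequential limits *)

Section WeakLimit.
Context {R : realType} d {W : measurableType d} (P : probability W R) (X : nat -> W -> R).
Hypotheses (gX : gaussian_family P X) (GX : forall i j, gram P (X i) (X j) = kmat i j).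
Variable B : nat -> {poly R}.
Hypothesis BB : forall m n, pform kmat (B m) (B n) = (m == n)%:R.

Lemma gram_comboE p q : gram P (combo X p) (combo X q) = pform kmat p q.
Proof.
rewrite gram_combo//; apply: eq_bigr => i _; apply: eq_bigr => j _.
by rewrite GX.
Qed.

Lemma kmat_psd (p : {poly R}) : 0 <= pform kmat p p.
Proof. by rewrite -gram_comboE gram_ge0. Qed.

Lemma pform_orthonormal (a b : nat -> R) N :
  pform kmat (\sum_(k < N) a k *: B k) (\sum_(k < N) b k *: B k) = \sum_(k < N) a k * b k.
Proof.
have ips r (F : 'I_N -> {poly R}) : pform kmat (\sum_i F i) r = \sum_i pform kmat (F i) r.
  by apply: (@ip_suml R {poly R} (pform kmat)); [exact: pformDl|exact: pformZl].
rewrite ips; apply: eq_bigr => i _.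
rewrite pformZl pformC; last exact: kmatC.
rewrite ips (bigD1 i)//= big1 ?addr0 => [|j ji]; rewrite pformZl BB.
  by rewrite eqxx mulr1.
by rewrite (negbTE (ji : (j : nat) != i)) mulr0.
Qed.

(** Over the orthonormal system [B], the rows of a Cholesky factor of [C] have Gram matrix [C]. *)
Lemma gaussian_realization (C : nat -> nat -> R) : (forall i j, C i j = C j i) ->
  (forall p, 0 <= pform C p p) ->
  exists V : nat -> {poly R}, forall i j, pform kmat (V i) (V j) = C i j.
Proof.
move=> CC C0; have [A [A0 AE]] := cholesky CC C0.
exists (fun n => \sum_(k < n.+1) A n k *: B k) => i j.
pose N := maxn i.+1 j.+1.
have widen n : (n < N)%N -> \sum_(k < n.+1) A n k *: B k = \sum_(k < N) A n k *: B k.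
  move=> nN; rewrite -[in RHS](subnKC nN) big_split_ord/= [X in _ + X]big1 ?addr0// => k _.
  by rewrite A0 ?scale0r// ltn_addr.
rewrite !widen ?leq_maxl ?leq_maxr// pform_orthonormal.
by rewrite (AE i j N)// leq_maxl.
Qed.

(** The standard normal that serves as the reference in [centered_normal_lim]. *)
Let xi := combo X (B 0).

Lemma centered_normal_xi a : centered_normal P (fun x => a * xi x).
Proof.
have := gaussian_family1 (a *: B 0) (gaussian_combo gX).
by congr centered_normal; apply/funext => x; rewrite comboZ.
Qed.

Lemma gram_xi : gram P xi xi = 1.
Proof. by rewrite gram_comboE BB. Qed.

Lemma limit_process_exists : exists L : R -> {RV P >-> R}, limit_process L.
Proof.
(* An enumeration of the rationals; indices that code no rational give 0, a repetition that the
   semidefinite Cholesky factorization tolerates. *)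
pose q (i : nat) : R := ratr (odflt 0 (unpickle i)).
have [V VE] : exists V : nat -> {poly R}, forall i j,
    pform kmat (V i) (V j) = climit `|q i - q j|.
  apply: gaussian_realization => [i j|p]; first by rewrite distrC.
  by apply: climit_psd => p'; exact: kmat_psd.
have [K K0 lipK] := @climit_lipschitz R.
(* The rate 4^(-k) in time passes to the variance of the k-th increment, which is 2 (C(0) - C(d)) <=
   2 K d with d <= 2 * 4^(-k); hence the constant [4 * K] below. *)
have [r rE] : {r : nat -> R -> nat | forall k s, `|q (r k s) - s| <= 4^-1 ^+ k}.
  have ex k s : exists i, `|q i - s| <= 4^-1 ^+ k.
    have e0 : 0 < 4^-1 ^+ k :> R by rewrite exprn_gt0 ?invr_gt0.
    have [|x] := @rat_in_itvoo R (s - 4^-1 ^+ k) (s + 4^-1 ^+ k).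
      by rewrite ltrD2l gtrN.
    rewrite in_itv/= => /andP[x1 x2]; exists (pickle x).
    by rewrite /q pickleK/= ler_distl ltW// ltW.
  by exists (fun k s => xchoose (ex k s)) => k s; exact: (xchooseP (ex k s)).
pose Y k s := combo X (V (r k s)).
have gY k s l t : gram P (Y k s) (Y l t) = climit `|q (r k s) - q (r l t)|.
  by rewrite gram_comboE VE.
have sY k s : sqr_int P (Y k s) by exact: gaussian_family_sqr_int (gaussian_combo gX).
have dq k s : `|q (r k.+1 s) - q (r k s)| <= 2 * 4^-1 ^+ k.
  have -> : q (r k.+1 s) - q (r k s) = (q (r k.+1 s) - s) - (q (r k s) - s) by ring.
  rewrite (le_trans (ler_normB _ _))// mulr_natl mulr2n lerD//.
  rewrite (le_trans (rE k.+1 s))// exprS ler_piMl ?exprn_ge0 ?invr_ge0//.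
  by rewrite invf_le1 ?ler1n.
have limY s : exists2 Z : W -> R, measurable_fun setT Z &
    {ae P, forall x, (Y ^~ s) ^~ x @ \oo --> Z x}.
  apply: (@ae_cvg_summable R _ W P (Y ^~ s) (4 * K)) => // k.
  pose p := V (r k.+1 s) + (-1) *: V (r k s).
  have -> : (fun x => Y k.+1 s x - Y k s x) = combo X p.
    by apply/funext => x; rewrite /p comboD comboZ mulN1r.
  have -> : gram P (combo X p) (combo X p) =
      2 * (climit 0 - climit `|q (r k.+1 s) - q (r k s)|).
    rewrite gram_comboE /p pformDl pformZl.
    rewrite pformC; last exact: kmatC.
    rewrite [X in _ + _ * X]pformC; last exact: kmatC.
    rewrite !pformDl !pformZl !VE !subrr normr0 [`|q (r k s) - _|]distrC; ring.
  have := lipK 0 `|q (r k.+1 s) - q (r k s)| (lexx _) (normr_ge0 _).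
  rewrite sub0r normrN normr_id => /(le_trans (ler_norm _)) le1.
  have le2 : K * `|q (r k.+1 s) - q (r k s)| <= K * (2 * 4^-1 ^+ k).
    by rewrite ler_wpM2l.
  by rewrite -mulrA; lra.
have [Z Zm Zae] : exists2 Z : R -> W -> R, (forall s, measurable_fun setT (Z s)) &
    forall s, {ae P, forall x, (Y ^~ s) ^~ x @ \oo --> Z s x}.
  have ex s : exists Z : W -> R, measurable_fun setT Z /\
      {ae P, forall x, (Y ^~ s) ^~ x @ \oo --> Z x}.
    by have [Z mZ cZ] := limY s; exists Z.
  have [Z HZ] := choice ex.
  by exists Z => s; have [] := HZ s.
have cq s : (fun k => q (r k s)) @ \oo --> s.
  have c4 : (fun k => 4^-1 ^+ k : R) @ \oo --> (0 : R).
    by apply: cvg_expr; rewrite ger0_norm ?invr_ge0// invf_lt1 ?ltr1n.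
  apply/cvgrPdist_le => e e0.
  move/cvgrPdist_le : c4 => /(_ e e0); apply: filterS => k.
  rewrite sub0r normrN ger0_norm ?exprn_ge0 ?invr_ge0// => /(le_trans (rE k s)).
  by rewrite distrC.
have cC s t : gram P (Y k s) (Y k t) @[k --> \oo] --> climit `|t - s|.
  under eq_fun do rewrite gY.
  have cd : `|q (r k s) - q (r k t)| @[k --> \oo] --> `|t - s|.
    by rewrite distrC; apply: cvg_norm; apply: cvgB; exact: cq.
  apply/cvgrPdist_le => e e0.
  have K1 : 0 < K + 1 by rewrite ltr_wpDl.
  move/cvgrPdist_le : cd => /(_ (e / (K + 1))); rewrite divr_gt0// => /(_ isT).
  apply: filterS => k ck.
  rewrite (le_trans (lipK _ _ (normr_ge0 _) (normr_ge0 _)))//.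
  apply: (@le_trans _ _ ((K + 1) * (e / (K + 1)))).
    by apply: ler_pM => //; rewrite lerDl.
  by rewrite mulrCA divff ?mulr1// gt_eqF.
have [gZ GZ] := gaussian_family_lim centered_normal_xi gram_xi
  (fun k n (t : 'I_n -> R) a => gaussian_combo gX (fun i => V (r k (t i))) a) Zm Zae cC.
exists (fun s => mfun_Sub (mem_set (Zm s))).
by apply/limit_process_gram.
Qed.

Lemma combo_subsequence n (p : nat -> nat -> {poly R}) (C : nat -> nat -> R) :
  (forall i j, pform kmat (p k i) (p k j) @[k --> \oo] --> C i j) ->
  exists g : nat -> nat, exists r : nat -> {poly R}, [/\ increasing_seq g,
    forall i j, (i < n)%N -> (j < n)%N -> pform kmat (r i) (r j) = C i j &
    forall f : 'rV[R]_n -> R, continuous f -> (exists M, forall x, `|f x| <= M) ->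
      (\int[P]_x f (\row_(i < n) combo X (p (g k) i) x))%R @[k --> \oo] -->
      (\int[P]_x f (\row_(i < n) combo X (r i) x))%R].
Proof.
move=> pC.
have chol k : exists A : nat -> nat -> R, (forall i l, (i < l)%N -> A i l = 0) /\
    forall i j N, (i < N)%N -> pform kmat (p k i) (p k j) = \sum_(l < N) A i l * A j l.
  apply: (@cholesky R (fun i j => pform kmat (p k i) (p k j))).
    by move=> i j; rewrite pformC//; exact: kmatC.
  move=> a.
  have gf : gaussian_family P (fun i => combo X (p k i)).
    by move=> m t b; exact: (gaussian_combo gX (fun i => p k (t i))).
  have := pform_gram_ge0 gf a; rewrite /pform.
  by under eq_bigr do under eq_bigr do rewrite gram_comboE.
have [A HA] := choice chol.
have Ab (il : 'I_n * 'I_n) : exists M, forall k, `|A k il.1 il.2| <= M.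
  have : cvgn (fun k => pform kmat (p k il.1) (p k il.1)).
    by apply/cvg_ex; exists (C il.1 il.1); exact: pC.
  move=> /cvg_seq_bounded[M0 [_ bM]].
  have {}bM k : `|pform kmat (p k il.1) (p k il.1)| <= M0 + 1 by apply: bM; rewrite ?ltrDl.
  (* The squares in a row of the factor add up to a variance, and the variances are bounded because
     they converge; [M0 + 2] comes from t <= t^2 + 1. *)
  exists (M0 + 2) => k; have := le_trans (ler_norm _) (bM k).
  rewrite ((HA k).2 _ _ n (ltn_ord il.1)) (bigD1 il.2)//= -expr2.
  set S := \sum_(l < n | _) _; have S0 : 0 <= S.
    by apply: sumr_ge0 => l _; rewrite -expr2 sqr_ge0.
  rewrite -real_normK ?num_real//; have := sqr_ge0 (`|A k il.1 il.2| - 1).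
  by have := normr_ge0 (A k il.1 il.2); move: `|_| => t; nra.
have [g gi gc] := @bolzano_weierstrass_family R _ (fun (il : 'I_n * 'I_n) k => A k il.1 il.2) Ab.
pose a i l := limn (fun k => A (g k) i l).
have ca i l : (i < n)%N -> (l < n)%N -> A (g k) i l @[k --> \oo] --> a i l.
  by move=> i_n l_n; exact: (gc (Ordinal i_n, Ordinal l_n)).
pose r i := \sum_(l < n) a i l *: B l.
(* [rk k] has the Gram matrix of [p (g k)], hence the same joint law after [combo], and in addition
   it converges pointwise. *)
pose rk k i := \sum_(l < n) A (g k) i l *: B l.
have pg i j : pform kmat (p (g k) i) (p (g k) j) @[k --> \oo] --> C i j.
  exact: (cvg_comp _ _ (increasing_seq_cvg gi) (pC i j)).
have rkE k i j : (i < n)%N -> pform kmat (rk k i) (rk k j) = pform kmat (p (g k) i) (p (g k) j).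
  by move=> i_n; rewrite pform_orthonormal ((HA (g k)).2 _ _ n).
exists g, r; split => //.
  move=> i j i_n j_n.
  have c1 : pform kmat (rk k i) (rk k j) @[k --> \oo] --> pform kmat (r i) (r j).
    rewrite pform_orthonormal; under eq_fun do rewrite pform_orthonormal.
    by apply: cvg_sumr => l; apply: cvgM; exact: ca.
  suff E : (fun k => pform kmat (rk k i) (rk k j)) =
      (fun k => pform kmat (p (g k) i) (p (g k) j)).
    by rewrite E in c1; exact: (cvg_unique _ c1 (pg i j)).
  by apply/funext => k; exact: rkE.
move=> f cf [M fM].
have bf := bdd_meas_row cf (ex_intro _ M fM).
have mc (v : {poly R}) : measurable_fun setT (combo X v).
  by have [] := gaussian_family_sqr_int v (gaussian_combo gX).
have tupE (v : 'I_n -> {poly R}) x : f (\row_(i < n) combo X (v i) x) =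
    (fun y : n.-tuple R => f (\row_i tnth y i)) [tuple combo X (v i) x | i < n].
  by congr f; apply/rowP => i; rewrite !mxE tnth_mktuple.
have mt (v : 'I_n -> {poly R}) : measurable_fun setT (fun x => [tuple combo X (v i) x | i < n]).
  by apply: measurable_tuple_family => i; exact: mc.
have fE k : (\int[P]_x f (\row_(i < n) combo X (p (g k) i) x))%R =
    (\int[P]_x f (\row_(i < n) combo X (rk k i) x))%R.
  under eq_Rintegral do rewrite tupE; under [RHS]eq_Rintegral do rewrite tupE.
  refine (law_eq_Rintegral (mt _) (mt _) _ bf) => A' mA'.
  apply: (@gaussian_joint_law R _ _ W W P P _ _ _ _ n (fun i => p (g k) i) (fun i => rk k i)
    (gaussian_combo gX) (gaussian_combo gX)) => //.
  by move=> i j; rewrite !gram_comboE rkE.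
under eq_fun do rewrite fE.
apply: (Rintegral_bounded_cvg (M := M)).
- move=> k; under eq_fun do rewrite tupE.
  exact: (measurableT_comp bf.1 (mt _)).
- under eq_fun do rewrite tupE.
  exact: (measurableT_comp bf.1 (mt _)).
- by move=> k x; exact: fM.
- apply: aeW => x.
  suff c : \row_(i < n) combo X (rk k i) x @[k --> \oo] --> \row_(i < n) combo X (r i) x.
    exact: (cvg_comp _ _ c (cf _)).
  apply: cvg_row => i; rewrite combo_sum; under eq_fun do rewrite combo_sum.
  apply: cvg_sumr => l; apply: cvgM; last exact: cvg_cst.
  exact: ca.
Qed.

End WeakLimit.

Lemma Rproc_combo {R : realType} d {W : measurableType d} (zeta : nat -> W -> R) (T s : R) x :
  Rproc zeta T s x = combo (fun k => zeta k.+1) (scaled_poly T s) x.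
Proof.
rewrite /scaled_poly comboZ /interp_poly comboD !comboZ combo_Xn; congr (_ * _).
rewrite /Yproc /lin_interp; case: Num.truncn => [|m] /=; last by rewrite combo_Xn.
by rewrite /combo size_poly0 big_ord0.
Qed.

(** * Convergence of the interpolated process *)

Section WeakConvergence.
Context {R : realType} d {W : measurableType d} (P : probability W R) (X : nat -> W -> R).
Hypotheses (gX : gaussian_family P X) (GX : forall i j, gram P (X i) (X j) = kmat i j).
Variable B : nat -> {poly R}.
Hypothesis BB : forall m n, pform kmat (B m) (B n) = (m == n)%:R.
Context d' {W' : measurableType d'} (P' : probability W' R) (L : R -> {RV P' >-> R}).
Hypothesis limL : limit_process L.

(** If convergence failed, there would be T_k > k along which the integrals stay at distance more
    than [e] from [l]; but [combo_subsequence] extracts a subsequence along which they tend to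
    [l]. *)
Lemma cvg_scaled_combo n (t : 'I_n -> R) (f : 'rV[R]_n -> R) : continuous f ->
  (exists M, forall x, `|f x| <= M) ->
  (\int[P]_x f (\row_i combo X (scaled_poly T (t i)) x))%R @[T --> +oo] -->
  (\int[P']_x f (\row_i L (t i) x))%R.
Proof.
move=> cf bf; set l := (\int[P']_x _)%R.
pose I T := (\int[P]_x f (\row_i combo X (scaled_poly T (t i)) x))%R.
rewrite -/I; apply/cvgrPdist_le => e e0; apply: contrapT => notnear.
have ex (k : nat) : exists T : R, k%:R < T /\ ~ `|l - I T| <= e.
  apply: contrapT => noT; apply: notnear; exists k%:R; split; first exact: num_real.
  by move=> T kT; apply: contrapT => IT; apply: noT; exists T.
have [T HT] := choice ex.
have Ty : T @ \oo --> +oo.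
  apply/cvgryPge => A; have := @cvgr_idn R; move/cvgryPge => /(_ A).
  by apply: filterS => k Ak; rewrite (le_trans Ak)// ltW//; case: (HT k).
(* [combo_subsequence] takes families indexed by [nat], so the times are completed by the default
   value 0. *)
pose t' i := if insub i is Some j then t j else 0.
have t'E (i : 'I_n) : t' i = t i by rewrite /t' valK.
have [g [r [gi rC rf]]] := combo_subsequence gX GX BB n
  (p := fun k i => scaled_poly (T k) (t' i)) (C := fun i j => climit `|t' i - t' j|)
  (fun i j => @scaled_poly_asymptotics R T (t' i) (t' j) Ty).
have c := rf f cf bf.
have /limit_process_gram[gL GL] := limL.
have bF := bdd_meas_row cf bf.
have tupE V (Z : 'I_n -> V -> R) x : f (\row_(i < n) Z i x) =
    (fun y : n.-tuple R => f (\row_i tnth y i)) [tuple Z i x | i < n].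
  by congr f; apply/rowP => i; rewrite !mxE tnth_mktuple.
have E : (\int[P]_x f (\row_(i < n) combo X (r i) x))%R = l.
  rewrite /l; under eq_Rintegral do rewrite (tupE _ (fun i : 'I_n => combo X (r i))).
  under [RHS]eq_Rintegral do rewrite (tupE _ (fun i => L (t i) : W' -> R)).
  refine (law_eq_Rintegral _ _ _ bF).
  - apply: measurable_tuple_family => i.
    by have [] := gaussian_family_sqr_int (r i) (gaussian_combo gX).
  - by apply: measurable_tuple_family => i; have [] := gaussian_family_sqr_int (t i) gL.
  - apply: (@gaussian_joint_law R _ _ W W' P P' _ _ _ _ n (fun i => r i) t
      (gaussian_combo gX) gL) => i j.
    by rewrite (gram_comboE gX GX) rC// GL !t'E distrC.
rewrite E in c; move/cvgrPdist_le : c => /(_ e e0)[N _ /(_ N (leqnn N))].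
have [_] := HT (g N); suff -> : I (T (g N)) =
    (\int[P]_x f (\row_(i < n) combo X (scaled_poly (T (g N)) (t' i)) x))%R by [].
by apply: eq_Rintegral => x _; congr f; apply/rowP => i; rewrite !mxE t'E.
Qed.

Lemma cvg_fdd_scaled_combo :
  cvg_fdd P P' (fun T s x => combo X (scaled_poly T s) x) (fun s x => L s x).
Proof.
move=> n t f cf bf.
have bF := bdd_meas_row cf bf.
have EE d1 (V : measurableType d1) (Q : probability V R) (Z : 'I_n -> V -> R) :
    (forall i, measurable_fun setT (Z i)) ->
    ('E_Q[fun w => f (\row_i Z i w)] = (\int[Q]_x f (\row_i Z i x))%R%:E)%E.
  move=> mZ; rewrite expectation.unlock /Rintegral fineK//.
  apply: integrable_fin_num => //.
  apply: (@bdd_meas_integrable _ V R Q (fun x => f (\row_i Z i x))).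
  split; last by have [M fM] := bf; exists M => x; exact: fM.
  rewrite (_ : (fun x => _) = (fun y : n.-tuple R => f (\row_i tnth y i)) \o
    (fun x => [tuple Z i x | i < n])).
    exact: (measurableT_comp bF.1 (measurable_tuple_family mZ)).
  by apply/funext => x /=; congr f; apply/rowP => i; rewrite !mxE tnth_mktuple.
rewrite EE => [|i]; last by [].
rewrite (_ : (fun T => _) = fun T =>
    (\int[P]_x f (\row_i combo X (scaled_poly T (t i)) x))%R%:E); last first.
  apply/funext => T; rewrite EE// => i.
  by have [] := gaussian_family_sqr_int (scaled_poly T (t i)) (gaussian_combo gX).
apply: cvg_EFin; first exact: nearW.
exact: cvg_scaled_combo.
Qed.

End WeakConvergence.

Theorem theorem1p3 (R : realType) (d : measure_display) (W : measurableType d)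
    (P : probability W R) (zeta : nat -> {RV P >-> R}) (rho_w rho_z : R)
    (hrho_w : 0 < rho_w) (hrho_z : rho_w < rho_z)
    (hgauss : gaussian_process (fun k : nat => zeta k.+1))
    (hmean : mean_zero (fun k : nat => zeta k.+1))
    (hcov : forall r s : nat, (1 <= s)%N -> (s <= r)%N ->
       (fine (covariance P (zeta r) (zeta s)))%:C%C
       = zeta_cov rho_w rho_z r s) :
  exists (d' : measure_display) (W' : measurableType d')
      (P' : probability W' R) (L : R -> {RV P' >-> R}),
    [/\ limit_process L,
        (forall (d2 : measure_display) (W2 : measurableType d2)
           (P2 : probability W2 R) (L2 : R -> {RV P2 >-> R}),
           limit_process L2 -> same_fdd L2 L) &
        cvg_fdd P P' (fun (T s : R) (x : W) => Rproc (fun n => zeta n) T s x)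
          (fun (s : R) (x : W') => L s x)].
Proof.
have [gX cX] := gaussian_process_family hgauss hmean.
have GX i j : gram P (zeta i.+1) (zeta j.+1) = kmat i j.
  wlog ji : i j / (j <= i)%N => [H|].
    by have /orP[/H//|/H] := leq_total j i; rewrite gramC kmatC.
  have := hcov i.+1 j.+1 isT ji.
  rewrite cX (zeta_cov_kcov hrho_w hrho_z)// => /complexI /=.
  by rewrite /kmat (maxn_idPl ji) (minn_idPr ji).
have kpsd := kmat_psd gX GX.
have [B BB] := orthonormalization (@kmatC R) kpsd (kmat_definite kpsd).
have [L limL] := limit_process_exists gX GX BB.
exists d, W, P, L; split => //.
  move=> d2 W2 P2 L2 limL2 n t A mA.
  have /limit_process_gram[gL GL] := limL.
  have /limit_process_gram[gL2 GL2] := limL2.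
  apply: (gaussian_joint_law gL2 gL) => // i j.
  by rewrite GL GL2.
rewrite (_ : (fun T s x => _) = fun T s x =>
    combo (fun k => zeta k.+1 : W -> R) (scaled_poly T s) x).
  exact: (cvg_fdd_scaled_combo gX GX BB limL).
by apply/funext => T; apply/funext => s; apply/funext => x; exact: Rproc_combo.
Qed.
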